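(* Let $G$ be a metric graph, $p\ge1$ an integer, $L$ the Kirchhoff-Laplace operator on $G$, and $\{\phi_k\}_{k\ge0}$ a real orthonormal basis of $L^2(G)$ of eigenfunctions of $L$ with eigenvalues $0=\lambda_0<\lambda_1\le\lambda_2\le\dots$. Then for all $x_1,x_2\in G$ $$\gamma_p(x_1,x_2)=\sum_{k=1}^\infty\frac{(\phi_k(x_1)-\phi_k(x_2))^2}{\lambda_k^p}.$$ In addition, setting $\overline\phi_{k,V}:=\frac1n\sum_{v\in V}\phi_k(v)$, the covariance function $C_Z$ of $Z$ is $$C_Z(x_1,x_2)=\sum_{k=1}^\infty\frac{(\phi_k(x_1)-\overline\phi_{k,V})(\phi_k(x_2)-\overline\phi_{k,V})}{\lambda_k^p}.$$ Finally, $Z$ admits the spectral representation $$Z(x)=\sum_{k=1}^\infty\xi_k\,(\phi_k(x)-\overline\phi_{k,V}),\qquad \xi_k\sim\mathcal N\big(0,\lambda_k^{-p}\big)\ \text{independent},$$ where the convergence holds in the mean-square sense for every $x\in G$. None of these expressions depends on the choice of the orthonormal basis within each eigenspace.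
   Context: A metric graph $G=(V,E)$ has a finite vertex set $V$ ($n:=|V|$) and a finite edge set $E$; each edge $e\in E$ has a length $0<l_e<\infty$ and is identified with the segment $[0,l_e]$, edges being glued at their common endpoints (the vertices). $G$ also denotes the set of all points on the edges (vertices included). Throughout, $G$ is connected and simple (no self-loops, no multiple edges). For $f:G\to\mathbb R$, $f_e$ is the restriction of $f$ to $e$ viewed as a function on $[0,l_e]$, and $\int_G f(x)\,dx:=\sum_{e\in E}\int_0^{l_e}f_e(x)\,dx$. For $v\in V$, $E_v$ is the set of edges incident to $v$. The exiting directional derivative is $\partial_e f(v):=\lim_{h\to0^+}\frac{f(v+he)-f(v)}{h}$, where $v+he$ is the point of $e$ at shortest-path distance $h$ from $v$; $\partial_e^i$ is the $i$-th order exiting derivative. $f\in C^m(G)$ means: $f|_e\in C^m(e)$ for each $e\in E$, and at each $v\in V$ the Kirchhoff conditions of every order $i\in\{0,\dots,m\}$ hold: if $i$ is even, all exiting derivatives $\partial_e^i f(v)$, $e\in E_v$, are equal; if $i$ is odd, $\sum_{e\in E_v}\partial_e^i f(v)=0$. For an integer $p\ge1$ let $m:=p-1$. Let $\mathcal F$ be the set of $f:G\to\mathbb R$ such that $f\in C^m(G)$; for each $e\in E$, $f_e^{(m)}$ is absolutely continuous and $f_e^{(m+1)}\in L^2([0,l_e])$; and $\sum_{v\in V}f(v)=0$. Put $\langle f,g\rangle_{\mathcal F}:=\int_G f^{(p)}(x)g^{(p)}(x)\,dx$. Then $\mathcal H=(\mathcal F,\langle\cdot,\cdot\rangle_{\mathcal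 F})$ is a reproducing kernel Hilbert space (RKHS). $Z=Z_m$ is the (unique in law) zero-mean Gaussian process on $G$ whose RKHS is $\mathcal H$ (i.e. its covariance function is the reproducing kernel of $\mathcal H$), and $\gamma_p(x_1,x_2):=\mathrm{Var}(Z(x_1)-Z(x_2))$ is its variogram. The Kirchhoff-Laplace operator $L$ acts as $(Lf)_e:=-f_e''$ on each edge, with domain the functions that are edge-wise in $H^2(e)$, continuous on $G$, and with the sum of exiting first derivatives null at every vertex. It is an unbounded, non-negative, self-adjoint operator on $L^2(G)$ with compact resolvent, so there is a real orthonormal basis $\{\phi_k\}_{k\ge0}$ of $L^2(G)$ with $L\phi_k=\lambda_k\phi_k$, $0=\lambda_0<\lambda_1\le\lambda_2\le\dots$, $\lambda_k\to+\infty$ (eigenvalues repeated according to multiplicity; $\phi_0$ is constant). *)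

(* Defs.v *)
From HB Require Import structures.
From mathcomp Require Import all_boot all_order all_algebra.
From mathcomp Require Import all_classical all_reals all_analysis.

Set Implicit Arguments.
Unset Strict Implicit.
Unset Printing Implicit Defensive.

Import Order.TTheory GRing.Theory Num.Theory.
Import numFieldNormedType.Exports.

Local Open Scope classical_set_scope.
Local Open Scope ring_scope.

(** ** Functions on a segment [0, l] *)

(* A function on [0, l] is represented by a function R -> R whose values outside
   [0, l] are irrelevant: derivatives are limits within [0, l], hence one-sided
   at 0 and l. *)

Definition diff_quot {R : realType} (g : R -> R) (t s : R) : R :=
  (g s - g t) / (s - t).

Definition derivable_in {R : realType} (l : R) (g : R -> R) (t : R) : Prop :=
  cvg (diff_quot g t s @[s --> within `[0, l] t^']).

Definition deriv_in {R : realType} (l : R) (g : R -> R) (t : R) : R :=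
  lim (diff_quot g t s @[s --> within `[0, l] t^']).

Definition nderiv_in {R : realType} (l : R) (i : nat) (g : R -> R) : R -> R :=
  iter i (deriv_in l) g.

Definition Cm_segment {R : realType} (l : R) (m : nat) (g : R -> R) : Prop :=
  (forall i t, (i < m)%N -> t \in `[0, l] -> derivable_in l (nderiv_in l i g) t)
  /\ {within `[0, l], continuous (nderiv_in l m g)}.

Definition abs_continuous {R : realType} (l : R) (g : R -> R) : Prop :=
  forall eps : R, 0 < eps -> exists2 delta : R, 0 < delta &
    forall (n : nat) (a b : 'I_n -> R),
      (forall i, 0 <= a i /\ a i <= b i /\ b i <= l) ->
      trivIset setT (fun i => `]a i, b i[%classic) ->
      \sum_(i < n) (b i - a i) < delta ->
      \sum_(i < n) `|g (b i) - g (a i)| < eps.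

Definition L2_segment {R : realType} (l : R) (g : R -> R) : Prop :=
  measurable_fun `[0, l]%classic g /\
  (@lebesgue_measure R).-integrable `[0, l]%classic (fun t => (g t ^+ 2)%:E).

(* The Sobolev space H^p([0, l]), for p >= 1, through continuous representatives.
   The p-th derivative exists almost everywhere only; at the remaining points
   [deriv_in] takes a default value, which no integral sees. *)
Definition sobolev_segment {R : realType} (l : R) (p : nat) (g : R -> R) : Prop :=
  [/\ Cm_segment l p.-1 g,
      abs_continuous l (nderiv_in l p.-1 g),
      {ae @lebesgue_measure R,
        forall t, t \in `[0, l] -> derivable_in l (nderiv_in l p.-1 g) t} &
      L2_segment l (nderiv_in l p g)].

(** ** Metric graphs *)

(* The orientation src -> tgt of an edge only serves to identify it with
   [0, len e]. *)
Record metric_graph (R : realType) := MetricGraph {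
  vertex : finType;
  edge : finType;
  src : edge -> vertex;
  tgt : edge -> vertex;
  len : edge -> R;
  len_gt0 : forall e, 0 < len e;
  no_loop : forall e, src e != tgt e;
  no_multi_edge : forall e e',
    [set src e; tgt e]%SET = [set src e'; tgt e']%SET -> e = e';
  vertex_nonempty : (0 < #|vertex|)%N;
  graph_connected : forall u v,
    connect (fun x y => [exists e, [set src e; tgt e]%SET == [set x; y]%SET]) u v
}.

(* A point is a vertex, or an edge with a coordinate in the open interval
   ]0, len e[; endpoints of edges are thus glued by construction. *)
Definition gpoint {R : realType} (G : metric_graph R) : Type :=
  (vertex G + {e : edge G & {t : R | 0 < t < len e}})%type.

Definition edge_point {R : realType} (G : metric_graph R) (e : edge G) (t : R) :
    gpoint G :=
  if (insub t : option {t : R | 0 < t < len e}) is Some u then inr (existT _ e u)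
  else inl (if t <= 0 then src e else tgt e).

Definition incident {R : realType} (G : metric_graph R) (e : edge G)
    (v : vertex G) : bool :=
  (v == src e) || (v == tgt e).

Section functions_on_graph.
Context {R : realType} (G : metric_graph R).
Implicit Types (f g : gpoint G -> R) (e : edge G) (v : vertex G).

Definition edge_fun f e : R -> R := fun t => f (edge_point e t).

Definition integral_graph (F : edge G -> R -> R) : R :=
  \sum_(e : edge G) \int[@lebesgue_measure R]_(t in `[0, len e]) F e t.

(* For e incident to v and h in [0, len e], the point v + he of e. *)
Definition shift_point v e (h : R) : gpoint G :=
  edge_point e (if v == src e then h else len e - h).

Definition exit_deriv (i : nat) f v e : R :=
  nderiv_in (len e) i (f \o shift_point v e) 0.

Definition kirchhoff (i : nat) f v : Prop :=
  if odd i then \sum_(e | incident e v) exit_deriv i f v e = 0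
  else forall e e', incident e v -> incident e' v ->
         exit_deriv i f v e = exit_deriv i f v e'.

Definition Cm_graph (m : nat) f : Prop :=
  (forall e, Cm_segment (len e) m (edge_fun f e)) /\
  (forall i v, (i <= m)%N -> kirchhoff i f v).

(** ** The space F and its reproducing kernel *)

Definition nderiv_graph (i : nat) f (e : edge G) : R -> R :=
  nderiv_in (len e) i (edge_fun f e).

Definition in_F (p : nat) f : Prop :=
  [/\ Cm_graph p.-1 f,
      forall e, sobolev_segment (len e) p (edge_fun f e) &
      \sum_(v : vertex G) f (inl v) = 0].

Definition inner_F (p : nat) f g : R :=
  integral_graph (fun e t => nderiv_graph p f e t * nderiv_graph p g e t).

Definition reproducing_kernel (p : nat) (K : gpoint G -> gpoint G -> R) : Prop :=
  (forall x, in_F p (K x)) /\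
  (forall f x, in_F p f -> inner_F p f (K x) = f x).

(** ** The Kirchhoff-Laplace operator and its eigenbases *)

Definition L2_graph f : Prop := forall e, L2_segment (len e) (edge_fun f e).

Definition inner_L2 f g : R :=
  integral_graph (fun e t => edge_fun f e t * edge_fun g e t).

(* Elements of the domain are given by their continuous representatives. *)
Definition laplace_dom f : Prop :=
  [/\ forall e, sobolev_segment (len e) 2 (edge_fun f e),
      forall v, kirchhoff 0 f v &
      forall v, kirchhoff 1 f v].

Definition laplace f : edge G -> R -> R := fun e t => - nderiv_graph 2 f e t.

Definition laplace_eigen (lam : R) f : Prop :=
  laplace_dom f /\
  forall e, {ae @lebesgue_measure R, forall t, t \in `[0, len e] ->
    laplace f e t = lam * edge_fun f e t}.

Definition orthonormal_basis (phi : nat -> gpoint G -> R) : Prop :=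
  [/\ forall k, L2_graph (phi k),
      forall j k, inner_L2 (phi j) (phi k) = (j == k)%:R &
      forall f, L2_graph f ->
        let rest N x := f x - \sum_(k < N) inner_L2 f (phi k) * phi k x in
        inner_L2 (rest N) (rest N) @[N --> \oo] --> (0 : R)].

Definition laplace_eigenbasis (phi : nat -> gpoint G -> R) (lam : nat -> R) :
    Prop :=
  [/\ orthonormal_basis phi,
      forall k, laplace_eigen (lam k) (phi k),
      lam 0%N = 0 /\ 0 < lam 1%N,
      {homo lam : j k / (j <= k)%N >-> j <= k} &
      lam k @[k --> \oo] --> +oo].

Definition vertex_mean f : R := (#|vertex G|%:R)^-1 * \sum_(v : vertex G) f (inl v).

Definition variogram_sum (p : nat) (phi : nat -> gpoint G -> R) (lam : nat -> R)
    (x1 x2 : gpoint G) (N : nat) : R :=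
  \sum_(1 <= k < N) (phi k x1 - phi k x2) ^+ 2 / lam k ^+ p.

Definition covariance_sum (p : nat) (phi : nat -> gpoint G -> R) (lam : nat -> R)
    (x1 x2 : gpoint G) (N : nat) : R :=
  \sum_(1 <= k < N) (phi k x1 - vertex_mean (phi k)) *
                    (phi k x2 - vertex_mean (phi k)) / lam k ^+ p.

End functions_on_graph.

(** ** Gaussian processes *)

(* [normal_prob m 0] is not the Dirac mass at m in the library, so the
   degenerate case has to be singled out. *)
Definition normal_law {R : realType} (m var : R) : set R -> \bar R :=
  if var == 0 then \d_m else normal_prob m (Num.sqrt var).

Section processes.
Context {R : realType} {d : measure_display} {T : measurableType d}.
Variable P : probability T R.

Definition has_normal_law (X : T -> R) (m var : R) : Prop :=
  forall A : set R, measurable A -> P (X @^-1` A) = normal_law m var A.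

Definition gaussian_process (I : Type) (Z : I -> {RV P >-> R}) : Prop :=
  forall (n : nat) (x : 'I_n -> I) (a : 'I_n -> R),
    exists m var : R, 0 <= var /\
      has_normal_law (fun w => \sum_(i < n) a i * Z (x i) w) m var.

Definition independent_RVs (I : choiceType) (X : I -> {RV P >-> R}) : Prop :=
  forall (s : seq I) (A : I -> set R), uniq s -> (forall i, measurable (A i)) ->
    P (\bigcap_(i in [set` s]) X i @^-1` A i) =
    (\prod_(i <- s) P (X i @^-1` A i))%E.

Definition mean_square_cvg (X : nat -> T -> R) (Y : T -> R) : Prop :=
  'E_P[fun w => ((X N w - Y w) ^+ 2)%R]%E @[N --> \oo] --> 0%E.

Variable G : metric_graph R.

Definition gaussian_process_with_RKHS (p : nat) (Z : gpoint G -> {RV P >-> R}) :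
    Prop :=
  [/\ gaussian_process Z,
      forall x, 'E_P[Z x]%E = 0%E &
      exists2 K, reproducing_kernel p K &
        forall x1 x2, covariance P (Z x1) (Z x2) = (K x1 x2)%:E].

Definition variogram (Z : gpoint G -> {RV P >-> R}) (x1 x2 : gpoint G) : \bar R :=
  'V_P[fun w => (Z x1 w - Z x2 w)%R]%E.

(* Only the terms xi k with k >= 1 are used. *)
Definition spectral_representation (p : nat) (phi : nat -> gpoint G -> R)
    (lam : nat -> R) (Z : gpoint G -> {RV P >-> R}) : Prop :=
  exists xi : nat -> {RV P >-> R},
    [/\ forall k, (1 <= k)%N -> has_normal_law (xi k) 0 (lam k ^- p),
        independent_RVs (fun k => xi k.+1) &
        forall x, mean_square_cvg
          (fun N w => \sum_(1 <= k < N) xi k w * (phi k x - vertex_mean (phi k)))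
          (Z x)].

End processes.

(* Main.v *)
(* The centred eigenfunctions psi_k := phi_k - mean_V(phi_k) belong to F, and repeated
   integration by parts, in which the Kirchhoff conditions cancel all boundary terms,
   gives <f, phi_k>_F = lam_k^p <f, phi_k>_{L2} for f in F. By the reproducing property
   K(x, .) thus has the L2-coefficients psi_k(x) / lam_k^p. The eigenfunction expansion
   of an H^1 function converges pointwise: its remainder u tends to 0 in L2 and is
   bounded in H^1, while u(x)^2 <= (1/l + c) |u|^2 + (1/c) |u'|^2 on an edge of length
   l. This is the covariance formula; the variogram follows by polarization.

   The coefficient xi_k is the mean-square integral of phi_k Z over G, a limit of dyadic
   Riemann sums whose increments are controlled by gamma_p <= lam_1^(1-p) |t - s| on
   edges. Finite combinations of the xi_k are therefore limits of finite combinations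
   of values of Z, and characteristic functions (the expectations of cos and sin) give
   their joint normality and independence. That these determine the law is shown by
   approximating indicators of rays by bounded trigonometric polynomials. Conversely, a
   process with a spectral representation in one eigenbasis is Gaussian with covariance
   K, hence has one in every other eigenbasis. *)

Require Import Defs.
From HB Require Import structures.
From mathcomp Require Import all_boot all_order all_algebra.
From mathcomp Require Import all_classical all_reals all_analysis measurable_realfun.
From mathcomp Require Import ring lra zify.
Import Order.TTheory GRing.Theory Num.Theory.
Import numFieldNormedType.Exports.
Set Implicit Arguments.
Unset Strict Implicit.
Unset Printing Implicit Defensive.
Local Open Scope classical_set_scope.
Local Open Scope ring_scope.


(** * Derivatives and absolute continuity on a segment *)

(** No measurability of [Z] in the point of the graph is assumed, so a pathwise integral of
    [phi_k Z] need not make sense. This is why the coefficients are mean-square limits, controlled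
    through the covariance alone. The kernel [K] comes with the process, known only by its
    reproducing property; its expansion in an eigenbasis identifies it and shows its symmetry.

    On the analytic side, derivatives are limits within closed segments and the top one exists only
    almost everywhere. Integration by parts therefore rests on a fundamental theorem for absolutely
    continuous functions, proved by real induction, and Sobolev functions are handled as pairs made
    of a function and a chosen representative of its derivative. The boundary terms pair derivatives
    of orders i and j with i + j odd: one of the two Kirchhoff conditions is then an equality along
    the incident edges and the other a zero sum, which is why they cancel. *)

Section preliminaries.
Context {R : realType}.

Lemma measurable_itvR (i : interval R) : measurable ([set` i] : set (measurableTypeR R)).
Proof. exact: measurable_itv. Qed.

Lemma measurable_setR : measurable (setT : set (measurableTypeR R)).
Proof. exact: measurableT. Qed.

Lemma norm_cos_le1 (x : R) : `|cos x| <= 1.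
Proof. by rewrite ler_norml cos_geN1 cos_le1. Qed.

Lemma norm_sin_le1 (x : R) : `|sin x| <= 1.
Proof. by rewrite ler_norml sin_geN1 sin_le1. Qed.
End preliminaries.

Section segment_derivative.
Context {R : realType}.
Implicit Types (l t s c D : R) (u w : R -> R).

(** A relation with the value as an argument, so that a derivative can be asserted and computed
    without meeting the default value of [deriv_in] where the limit fails. *)
Definition has_deriv l u t D : Prop :=
  diff_quot u t s @[s --> within `[0, l] t^'] --> D.

(** Clearing the denominator makes [s = t] harmless, and the punctured limit becomes a first-order
    estimate on the whole segment. *)
Lemma has_derivP l u t D :
  has_deriv l u t D <->
  forall e : R, 0 < e -> exists2 d : R, 0 < d &
    forall s, 0 <= s <= l -> `|s - t| < d ->
      `|u s - u t - D * (s - t)| <= e * `|s - t|.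
Proof.
rewrite /has_deriv; split=> [/cvgrPdist_le H e e0|H].
  have := H _ e0; rewrite near_withinE => -[d /= d0 Hd]; exists d => // s sl sd.
  have [->|st] := eqVneq s t; first by rewrite !subrr mulr0 subrr normr0 mulr0.
  have st0 : s - t != 0 by rewrite subr_eq0.
  have := Hd s; rewrite /ball_ /= distrC => /(_ sd st); rewrite in_itv/= => /(_ sl).
  rewrite /diff_quot => Hs.
  have -> : u s - u t - D * (s - t) = - (D - (u s - u t) / (s - t)) * (s - t).
    by rewrite mulNr mulrBl divfK// opprB.
  by rewrite normrM normrN ler_pM2r// normr_gt0.
apply/cvgrPdist_le => e e0; have [d d0 Hd] := H _ e0.
rewrite near_withinE; exists d => //= s /=; rewrite distrC => sd st.
rewrite in_itv/= => sl.
have st0 : s - t != 0 by rewrite subr_eq0.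
rewrite /diff_quot -(ler_pM2r (_ : 0 < `|s - t|)) ?normr_gt0//.
by rewrite -normrM mulrBl divfK// distrC; apply: Hd.
Qed.

(** Uniqueness of the limits behind [deriv_in]: every point of a nondegenerate segment can be
    approached from inside, from the right when [t < l] and from the left at [t = l]. *)
Lemma segment_dnbhs_proper l t : 0 < l -> 0 <= t <= l ->
  ProperFilter (within `[0, l]%classic t^').
Proof.
move=> l0 /andP[t0 tl]; apply: Build_ProperFilter_ex => A.
rewrite /within/= => -[d /= d0 Hd].
have [tl'|tl'] := ltP t l.
  pose s := t + Num.min (d / 2) (l - t).
  have st : 0 < s - t by rewrite /s addrAC subrr add0r lt_min subr_gt0 tl' divr_gt0.
  exists s; apply: Hd => /=.
  - rewrite distrC gtr0_norm// /s addrAC subrr add0r gt_min; apply/orP; left; lra.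
  - by rewrite -subr_eq0 gt_eqF.
  - rewrite in_itv/=; apply/andP; split; first lra.
    by rewrite /s -lerBrDl ge_min lexx orbT.
pose s := t - Num.min (d / 2) t.
have st : 0 < t - s by rewrite /s opprB addrC subrK lt_min divr_gt0//=; lra.
exists s; apply: Hd => /=.
- by rewrite gtr0_norm// /s opprB addrC subrK gt_min; apply/orP; left; lra.
- by rewrite -subr_eq0 lt_eqF// -oppr_gt0 opprB.
- rewrite in_itv/=; apply/andP; split; last lra.
  by rewrite /s subr_ge0 ge_min lexx orbT.
Qed.

Lemma deriv_inE l u t D : 0 < l -> 0 <= t <= l -> has_deriv l u t D ->
  deriv_in l u t = D.
Proof.
move=> l0 tl ut; have F := segment_dnbhs_proper l0 tl.
exact: (cvg_lim (@Rhausdorff R) ut).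
Qed.

Lemma derivable_in_has_deriv l u t : derivable_in l u t ->
  has_deriv l u t (deriv_in l u t).
Proof. by []. Qed.

Lemma has_deriv_derivable_in l u t D : has_deriv l u t D -> derivable_in l u t.
Proof. by move=> H; apply/cvg_ex; exists D. Qed.

Lemma has_deriv_ext l u w t D : 0 <= t <= l ->
  (forall s, 0 <= s <= l -> u s = w s) -> has_deriv l u t D -> has_deriv l w t D.
Proof.
move=> tl uw /has_derivP H; apply/has_derivP => e e0.
by have [d d0 Hd] := H _ e0; exists d => // s sl sd; rewrite -!uw//; exact: Hd.
Qed.

Lemma has_deriv_cst l c t : has_deriv l (fun=> c) t 0.
Proof.
apply/has_derivP => e e0; exists 1 => // s _ _.
by rewrite subrr mul0r subrr normr0 mulr_ge0// ltW.
Qed.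

Lemma has_derivD l u w t D E : has_deriv l u t D -> has_deriv l w t E ->
  has_deriv l (fun s => u s + w s) t (D + E).
Proof.
move=> Hu Hw; apply: cvg_trans (cvgD Hu Hw); apply: near_eq_cvg; near=> s.
by rewrite /diff_quot /= ?fctE; ring.
Unshelve. all: by end_near. Qed.

Lemma has_derivZ l c u t D : has_deriv l u t D ->
  has_deriv l (fun s => c * u s) t (c * D).
Proof.
move=> Hu; apply: cvg_trans (cvgM (cvg_cst c) Hu); apply: near_eq_cvg; near=> s.
by rewrite /diff_quot /= ?fctE; ring.
Unshelve. all: by end_near. Qed.

Lemma has_deriv_continuous l u t D (e : R) : has_deriv l u t D -> 0 < e ->
  exists2 d : R, 0 < d & forall s, 0 <= s <= l -> `|s - t| < d -> `|u s - u t| < e.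
Proof.
move=> /has_derivP /(_ 1 ltr01)[d d0 Hd] e0.
have D0 : 0 < `|D| + 1 by rewrite ltr_wpDl.
exists (Num.min d (e / (`|D| + 1))); first by rewrite lt_min d0 divr_gt0.
move=> s sl; rewrite lt_min => /andP[sd se].
have := Hd s sl sd; rewrite mul1r => H.
have : `|u s - u t| <= (`|D| + 1) * `|s - t|.
  rewrite -[u s - u t](subrK (D * (s - t))) (le_trans (ler_normD _ _))//.
  by rewrite normrM mulrDl mul1r addrC lerD2l.
by move=> /le_lt_trans; apply; rewrite mulrC -ltr_pdivlMr.
Qed.

Lemma has_derivM l u w t D E : 0 <= t <= l ->
  has_deriv l u t D -> has_deriv l w t E ->
  has_deriv l (fun s => u s * w s) t (D * w t + u t * E).
Proof.
move=> tl Hu Hw.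
have cw : w s @[s --> within `[0, l]%classic t^'] --> w t.
  apply/cvgrPdist_le => e e0; have [d d0 Hd] := has_deriv_continuous Hw e0.
  rewrite near_withinE; exists d => //= s /=; rewrite distrC => sd _.
  by rewrite in_itv/= => sl; rewrite distrC ltW// Hd.
apply: cvg_trans (cvgD (cvgM Hu cw) (cvgM (cvg_cst (u t)) Hw)); apply: near_eq_cvg; near=> s.
transitivity (diff_quot u t s * w s + u t * diff_quot w t s) => //.
by rewrite /diff_quot; ring.
Unshelve. all: by end_near. Qed.

Lemma has_deriv_reflect l u t D : has_deriv l u (l - t) D ->
  has_deriv l (fun s => u (l - s)) t (- D).
Proof.
move=> /has_derivP H; apply/has_derivP => e e0; have [d d0 Hd] := H _ e0.
exists d => // s sl sd.
have := Hd (l - s); rewrite (_ : l - s - (l - t) = - (s - t)); last by ring.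
rewrite normrN mulrN mulNr; apply => //; lra.
Qed.

(** At an interior point small displacements stay in the segment, so the two notions coincide. This
    gives access to the mean value theorem and to the differentiation of integrals. *)
Lemma is_derive_has_deriv l u t D : 0 < t < l ->
  is_derive t (1 : R) u D <-> has_deriv l u t D.
Proof.
move=> tl; transitivity (h^-1 *: (u (h *: 1 + t) - u t) @[h --> 0^'] --> D).
  split=> [[du Du]|Q]; first by rewrite -Du; exact: du.
  by apply: DeriveDef; [apply/cvg_ex; exists D | exact: (cvg_lim (@Rhausdorff R) Q)].
split=> [/cvgrPdist_le H|/has_derivP H].
  apply/has_derivP => e e0; have [d /= d0 Hd] := H _ e0; exists d => // s sl sd.
  have [->|st] := eqVneq s t; first by rewrite !subrr mulr0 subrr normr0 mulr0.
  have st0 : s - t != 0 by rewrite subr_eq0.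
  have := Hd (s - t); rewrite /= sub0r normrN => /(_ sd st0).
  rewrite /GRing.scale/= mulr1 subrK => Hs.
  have -> : u s - u t - D * (s - t) =
      - (D - (s - t)^-1 * (u s - u t)) * (s - t).
    by rewrite mulNr mulrBl mulrAC mulVf// mul1r opprB.
  by rewrite normrM normrN ler_pM2r// normr_gt0.
apply/cvgrPdist_le => e e0; have [d d0 Hd] := H _ e0.
exists (Num.min d (Num.min t (l - t))) => /=; first by rewrite !lt_min d0; lra.
move=> h /=; rewrite sub0r normrN !lt_min => /and3P[hd ht hl] h0.
have := Hd (h + t); rewrite addrK => /(_ _ hd) Q.
rewrite -(ler_pM2r (_ : 0 < `|h|)) ?normr_gt0// -normrM mulrBl.
rewrite /GRing.scale/= mulr1 mulrAC mulVf// mul1r distrC; apply: Q.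
by move: ht hl; rewrite !ltr_norml; lra.
Qed.

Lemma within_continuousP l u :
  {within `[0, l], continuous u} <->
  forall t : R, 0 <= t <= l -> forall e : R, 0 < e -> exists2 d : R, 0 < d &
    forall s : R, 0 <= s <= l -> `|s - t| < d -> `|u s - u t| < e.
Proof.
split=> [/subspace_continuousP H t tl e e0|H].
  have /cvgrPdist_lt := H t ltac:(by rewrite /= in_itv).
  move=> /(_ e e0); rewrite near_withinE => -[d /= d0 Hd]; exists d => // s sl sd.
  by have := Hd s; rewrite /= distrC in_itv/= => /(_ sd sl); rewrite distrC.
apply/subspace_continuousP => t /=; rewrite in_itv/= => tl.
apply/cvgrPdist_lt => e e0; have [d d0 Hd] := H t tl e e0.
rewrite near_withinE; exists d => //= s /=; rewrite distrC => sd.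
by rewrite in_itv/= => sl; rewrite distrC Hd.
Qed.

Lemma has_deriv_within_continuous l u (v : R -> R) :
  (forall t, 0 <= t <= l -> has_deriv l u t (v t)) -> {within `[0, l], continuous u}.
Proof.
move=> H; apply/within_continuousP => t tl e e0.
exact: has_deriv_continuous (H t tl) e0.
Qed.

Lemma within_continuous_bounded l u : 0 <= l -> {within `[0, l], continuous u} ->
  exists2 M : R, 0 < M & forall t, 0 <= t <= l -> `|u t| <= M.
Proof.
move=> l0 cu.
have [a al Ha] := EVT_max l0 cu; have [b bl Hb] := EVT_min l0 cu.
exists (1 + `|u a| + `|u b|); first by rewrite -addrA ltr_pwDl// addr_ge0.
move=> t tl; have := Ha t; have := Hb t; rewrite in_itv/= => /(_ tl) h1 /(_ tl) h2.
have := ler_norm (u a); have := ler_norm (- u b); rewrite normrN.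
by have := normr_ge0 (u a); have := normr_ge0 (u b); rewrite ler_norml; lra.
Qed.

Lemma has_deriv_lipschitz l u (v : R -> R) M :
  (forall t, 0 <= t <= l -> has_deriv l u t (v t)) ->
  (forall t, 0 <= t <= l -> `|v t| <= M) ->
  forall a b : R, 0 <= a <= l -> 0 <= b <= l -> `|u b - u a| <= M * `|b - a|.
Proof.
move=> H vM; wlog ab : / forall a b : R, 0 <= a -> a <= b -> b <= l ->
    `|u b - u a| <= M * `|b - a|.
  apply => a b a0 ab bl.
  have cu : {within `[a, b], continuous u}.
    apply: continuous_subspaceW (has_deriv_within_continuous H).
    by apply: subset_itv; rewrite bnd_simp.
  have du x : x \in `]a, b[ -> is_derive x (1 : R) u (v x).
    rewrite in_itv/= => xab; apply/(@is_derive_has_deriv l); last by apply: H; lra.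
    by lra.
  have [c] := MVT_segment ab du cu; rewrite in_itv/= => cab ->.
  by rewrite normrM ler_wpM2r// vM//; lra.
move=> a b al bl; have [ab'|ab'] := leP a b; first by apply: ab; lra.
by rewrite distrC (distrC b); apply: ab; lra.
Qed.

Lemma abs_continuous_lipschitz l u M :
  (forall a b : R, 0 <= a <= l -> 0 <= b <= l -> `|u b - u a| <= M * `|b - a|) ->
  abs_continuous l u.
Proof.
move=> uM e e0; exists (e / (`|M| + 1)); first by rewrite divr_gt0// ltr_wpDl.
move=> n a b ab _; rewrite ltr_pdivlMr ?ltr_wpDl// => S.
apply: le_lt_trans S; rewrite mulrC mulr_sumr ler_sum// => i _.
have := ab i => abi; apply: le_trans (uM _ _ _ _) _; [lra|lra|].
rewrite ger0_norm; last lra.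
apply: ler_wpM2r; first lra.
by rewrite (le_trans (ler_norm M))// lerDl.
Qed.

Lemma abs_continuousD l u w : abs_continuous l u -> abs_continuous l w ->
  abs_continuous l (fun t => u t + w t).
Proof.
move=> Hu Hw e e0; have e2 : 0 < e / 2 by rewrite divr_gt0.
have [d1 d10 H1] := Hu _ e2; have [d2 d20 H2] := Hw _ e2.
exists (Num.min d1 d2); first by rewrite lt_min d10.
move=> n a b ab tab; rewrite lt_min => /andP[S1 S2].
rewrite [ltRHS](splitr e).
apply: le_lt_trans (ltrD (H1 n a b ab tab S1) (H2 n a b ab tab S2)).
rewrite -big_split/= ler_sum// => i _.
by rewrite opprD addrACA ler_normD.
Qed.

Lemma abs_continuous_continuous l u : abs_continuous l u ->
  {within `[0, l], continuous u}.
Proof.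
move=> Hu; apply/within_continuousP => t tl e e0.
have [d d0 Hd] := Hu _ e0; exists d => // s sl sd.
wlog st : s t sl tl sd / s < t.
  move=> W; have [st|ts|->] := ltgtP s t; first exact: W.
    by rewrite distrC W// distrC.
  by rewrite subrr normr0.
have := Hd 1%N (fun=> s) (fun=> t); rewrite !big_ord1 distrC; apply.
- by move=> _; lra.
- by move=> i j _ _ _; rewrite !ord1.
- by rewrite -(gtr0_norm (_ : 0 < t - s)) 1?distrC// subr_gt0.
Qed.

Lemma abs_continuousM l u w : 0 <= l -> abs_continuous l u -> abs_continuous l w ->
  abs_continuous l (fun t => u t * w t).
Proof.
move=> l0 Hu Hw e e0.
have [M M0 HM] := within_continuous_bounded l0 (abs_continuous_continuous Hu).
have [N N0 HN] := within_continuous_bounded l0 (abs_continuous_continuous Hw).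
have [d1 d10 H1] := Hu (e / (2 * N)) ltac:(by rewrite divr_gt0// mulr_gt0).
have [d2 d20 H2] := Hw (e / (2 * M)) ltac:(by rewrite divr_gt0// mulr_gt0).
exists (Num.min d1 d2); first by rewrite lt_min d10.
move=> n a b ab tab; rewrite lt_min => /andP[S1 S2].
have {}H1 := H1 n a b ab tab S1; have {}H2 := H2 n a b ab tab S2.
rewrite [ltRHS](_ : e = N * (e / (2 * N)) + M * (e / (2 * M))); last by field; lra.
have {}H1 : N * \sum_(i < n) `|u (b i) - u (a i)| < N * (e / (2 * N)) by rewrite ltr_pM2l.
have {}H2 : M * \sum_(i < n) `|w (b i) - w (a i)| < M * (e / (2 * M)) by rewrite ltr_pM2l.
apply: le_lt_trans (ltrD H1 H2).
rewrite !mulr_sumr -big_split/= ler_sum// => i _.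
rewrite (_ : _ - _ = w (b i) * (u (b i) - u (a i)) + u (a i) * (w (b i) - w (a i)));
  last by ring.
rewrite (le_trans (ler_normD _ _))// !normrM.
by have := ab i => abi; apply: lerD; apply: ler_wpM2r => //; [apply: HN|apply: HM]; lra.
Qed.

Lemma abs_continuous_cst l c : abs_continuous l (fun=> c).
Proof.
by move=> e e0; exists 1 => // n a b _ _ _; rewrite big1// => i _; rewrite subrr normr0.
Qed.
End segment_derivative.

(** * The fundamental theorem of calculus for absolutely continuous functions *)

Section fundamental_theorem.
Context {R : realType}.
Local Notation mu := (@lebesgue_measure R).
Implicit Types (l t x y z : R) (F f : R -> R).

(** Let m be the supremum of the points where [P] holds. Some such point lies within r to the left
    of m, and the local step carries [P] from it past m, which contradicts the supremum unless [l]
    is reached. *)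
Lemma real_induction l (P : R -> Prop) : 0 <= l -> P 0 ->
  (forall x, 0 <= x <= l -> exists2 r : R, 0 < r & forall y z, 0 <= y -> y <= x ->
     x <= z -> z <= l -> x - r < y -> z < x + r -> P y -> P z) ->
  P l.
Proof.
move=> l0 P0 H; pose S : set R := [set x | 0 <= x <= l /\ P x].
have S0 : S 0 by split=> //; rewrite lexx.
have supS : has_sup S by split; [exists 0 | exists l => x -[/andP[]]].
have ub : ubound S (sup S) by exact: sup_upper_bound.
set m := sup S in ub *.
have m0 : 0 <= m by exact: ub.
have ml : m <= l by apply: ge_sup; [exists 0 | move=> x [/andP[]]].
have [r r0 Hr] := H m ltac:(by rewrite m0 ml).
have [y [/andP[y0 yl] Py] my] := sup_adherent r0 supS.
have ym : y <= m by apply: ub; split=> //; rewrite y0.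
have [lr|lr] := ltP l (m + r); first exact: Hr Py.
have : S (m + r / 2).
  split; first by lra.
  by apply: Hr Py => //; lra.
by move=> /ub; lra.
Qed.

(** Non-overlapping intervals of [0, y] listed from right to left, so that an induction moving to
    the right adds the new interval at the head. *)
Fixpoint chain y (s : seq (R * R)) : Prop :=
  if s is (a, b) :: s' then [/\ a <= b, b <= y & chain a s'] else 0 <= y.

Lemma chain_le y z s : y <= z -> chain y s -> chain z s.
Proof.
case: s => [|[a b] s] /= yz; first by move=> /le_trans; exact.
by case=> ab /le_trans by_ ?; split=> //; exact: by_.
Qed.

Lemma chain_ge0 y s : chain y s -> 0 <= y.
Proof.
elim: s y => [|[a b] s IH] y //= [ab by_ /IH a0].
by rewrite (le_trans a0)// (le_trans ab).
Qed.

Lemma chain_nth y s i : chain y s -> (i < size s)%N ->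
  0 <= (nth (0, 0) s i).1 /\ (nth (0, 0) s i).1 <= (nth (0, 0) s i).2 /\
  (nth (0, 0) s i).2 <= y.
Proof.
elim: s y i => [|[a b] s IH] y [|i] //= [ab by_ c] H.
  by rewrite (chain_ge0 c).
have [? [? ?]] := IH _ _ c H; do 2 split=> //.
by rewrite (le_trans _ by_)// (le_trans _ ab).
Qed.

Lemma chain_lt y s i j : chain y s -> (i < j)%N -> (j < size s)%N ->
  (nth (0, 0) s j).2 <= (nth (0, 0) s i).1.
Proof.
elim: s y i j => [|[a b] s IH] y i [|j] //= [ab by_ c] ij jn.
case: i ij => [|i] ij /=; last exact: IH c _ _.
by have [_ []] := chain_nth c (jn : (j < size s)%N).
Qed.

Lemma abs_continuous_chain l F (e : R) : abs_continuous l F -> 0 < e ->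
  exists2 d : R, 0 < d & forall s, chain l s ->
    \sum_(p <- s) (p.2 - p.1) < d -> \sum_(p <- s) `|F p.2 - F p.1| < e.
Proof.
move=> HF e0; have [d d0 Hd] := HF _ e0; exists d => // s cs.
rewrite !(big_nth (0, 0)) !big_mkord => Hs.
apply: (Hd (size s) (fun i => (nth (0, 0) s i).1) (fun i => (nth (0, 0) s i).2)) => //.
  by move=> i; exact: (chain_nth cs).
apply/trivIsetP => /= i j _ _ ij; apply/seteqP; split=> // t [] /=.
rewrite !in_itv/= => /andP[i1 i2] /andP[j1 j2].
have [ij'|ji|/val_inj/eqP] := ltngtP (i : nat) j; last by rewrite (negbTE ij).
  by have := chain_lt cs ij' (ltn_ord j); lra.
by have := chain_lt cs ji (ltn_ord i); lra.
Qed.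

(* Real induction: each point either has a neighbourhood where [F] moves by at
   most [e] times the displacement, or lies in an open set of small measure, where
   the total displacement of [F] is small by absolute continuity. *)
Lemma abs_continuous_deriv0 l F : abs_continuous l F ->
  {ae mu, forall t, 0 < t < l -> has_deriv l F t 0} ->
  forall x, 0 <= x <= l -> F x = F 0.
Proof.
move=> HF [N [mN N0 HN]] x /andP[x0 xl].
apply/eqP; rewrite -subr_eq0 -normr_le0; apply/ler_addgt0Pr => e e0; rewrite add0r.
have l0 := le_trans x0 xl.
have e2 : 0 < e / 2 by rewrite divr_gt0.
have [d d0 Hd] := abs_continuous_chain HF e2.
(* The endpoints join the exceptional set because the derivative is known in the open interval only;
   they have measure zero. *)
pose N' := N `|` [set 0] `|` [set l].
have mN' : measurable N' by do 2 apply: measurableU => //; exact: measurable_set1.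
have N'0 : mu N' = 0%E.
  have m1 a : mu [set a] = 0%E by exact: lebesgue_measure_set1.
  have mN0 : measurable (N `|` [set 0]) by apply: measurableU.
  by rewrite /N' (measureU0 _ _ (m1 l))// (measureU0 _ _ (m1 0)).
have N'y : (mu N' < +oo)%E by rewrite N'0.
have [U [oU NU Ud]] := lebesgue_regularity_outer mN' N'y d0.
have mU : measurable U by exact: open_measurable.
have {}Ud : (mu U < d%:E)%E.
  apply: le_lt_trans Ud; rewrite -[X in (mu X <= _)%E](setDUK NU).
  rewrite (le_trans (measureU2 _ _ _))//; first exact: measurableD.
  by rewrite [X in (X + _)%E]N'0 add0e.
(* Half of the error is spread over the length, so that [c * x <= e / 2]; the other half goes to the
   chain. The [+ 1] covers [l = 0]. *)
pose c := e / 2 / (l + 1).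
have c0 : 0 < c by rewrite divr_gt0// ltr_wpDl.
(* The chain collects the intervals crossed inside [U]. Its total length is at most the measure of
   [U] in [0, y], hence stays below the [d] of absolute continuity however many intervals there are.
   The term [c * y] pays for the rest. *)
pose P y := exists s, [/\ chain y s,
  ((\sum_(p <- s) (p.2 - p.1))%:E <= mu (U `&` `[0%R, y]%classic))%E &
  `|F y - F 0| <= c * y + \sum_(p <- s) `|F p.2 - F p.1|].
have : P x.
  apply: real_induction => //.
    by exists [::]; rewrite /= !big_nil subrr normr0 mulr0 addr0.
  move=> y /andP[y0 yx].
  have step z1 z2 : 0 <= z1 -> z1 <= z2 -> `]z1, z2[ `<=` U -> P z1 -> P z2.
    move=> z10 z12 zU [s [cs ms Fs]]; exists ((z1, z2) :: s); split=> //.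
      rewrite big_cons/= addrC EFinD.
      have mi a b : measurable (`[a, b] : set R) by exact: measurable_itv.
      have sub : (U `&` `[0, z1] `|` `]z1, z2[ : set R) `<=` U `&` `[0, z2].
        move=> t; rewrite /= !in_itv/= => -[[tU tz]|tz]; first by split=> //; lra.
        by split; [apply: zU; rewrite /= in_itv | lra].
      have m12 : (mu `]z1, z2[ = (z2 - z1)%:E)%E.
        rewrite lebesgue_measure_itv/= lte_fin; case: ltP => // z21.
        by rewrite (_ : z2 = z1) ?subrr//; apply/eqP; rewrite eq_le z12 z21.
      rewrite -m12; apply: le_trans (leeD2r _ ms) _.
      rewrite -measureU//; last 2 first.
      - exact: measurableI.
      - apply/seteqP; split=> // t [[_ /=]]; rewrite !in_itv/=.
        by move=> /andP[_ t1] /andP[/(le_lt_trans t1)]; rewrite ltxx.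
      apply: le_measure; rewrite ?inE.
      - by apply: measurableU => //; exact: measurableI.
      - exact: measurableI.
      - exact: sub.
    rewrite big_cons/= (_ : F z2 - F 0 = (F z2 - F z1) + (F z1 - F 0)); last by ring.
    rewrite (le_trans (ler_normD _ _))// addrCA lerD2l (le_trans Fs)// lerD2r.
    by rewrite ler_wpM2l// ltW.
  have [/NU Uy|] := pselect (N' y).
    have [r /= r0 Hr] := oU _ Uy.
    exists r => // z1 z2 z10 z1y yz2 _ z1r z2r; apply: step => //; first exact: le_trans yz2.
    move=> t /=; rewrite in_itv/= => tz; apply: Hr => /=.
    by move: z1r z2r tz; clear; move: t => t; rewrite ltr_norml; lra.
  rewrite /N' => /not_orP[/not_orP[Ny /= /eqP y0'] /= /eqP yl].
  have yl' : 0 < y < l.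
    by rewrite !lt_neqAle eq_sym y0' y0 yl/= (le_trans yx).
  have : has_deriv l F y 0.
    by apply: contrapT => H; apply: Ny; apply: HN => /= Q; exact: H (Q yl').
  move=> /has_derivP /(_ c c0)[r r0 Hr]; exists r => // z1 z2 z10 z1y yz2 z2x z1r z2r.
  case=> s [cs ms Fs]; exists s; split=> //.
  - by apply: chain_le cs; exact: le_trans yz2.
  - apply: le_trans ms _; apply: le_measure; rewrite ?inE.
    + by apply: measurableI => //; exact: measurable_itv.
    + by apply: measurableI => //; exact: measurable_itv.
    + apply: setIS => t; rewrite /= !in_itv/= => /andP[-> t1].
      by rewrite (le_trans t1)// (le_trans z1y).
  - have := Hr z1; have := Hr z2; rewrite !mul0r !subr0.
    rewrite (ger0_norm (_ : 0 <= z2 - y)) ?subr_ge0// (ler0_norm (_ : z1 - y <= 0)) ?subr_le0//.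
    have z2l : 0 <= z2 <= l by rewrite (le_trans z10 (le_trans z1y yz2)) (le_trans z2x).
    have z1l : 0 <= z1 <= l by rewrite z10 (le_trans z1y)// (le_trans yx).
    move=> /(_ z2l) h2 /(_ z1l) h1.
    have {}h2 : `|F z2 - F y| <= c * (z2 - y) by apply: h2; rewrite ltrBlDl.
    have {}h1 : `|F z1 - F y| <= c * (- (z1 - y)) by apply: h1; rewrite opprB ltrBlDr -ltrBlDl.
    clear -Fs h1 h2.
    rewrite (_ : F z2 - F 0 = (F z2 - F y) - (F z1 - F y) + (F z1 - F 0)); last by ring.
    rewrite (le_trans (ler_normD _ _))// (le_trans (lerD (ler_normB _ _) Fs))//.
    rewrite addrA lerD2r; lra.
case=> s [cs ms Fs]; apply: le_trans Fs _.
have : \sum_(p <- s) `|F p.2 - F p.1| < e / 2.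
  apply: Hd; first exact: chain_le cs.
  rewrite -lte_fin; apply: le_lt_trans ms _; apply: le_lt_trans Ud.
  apply: le_measure; rewrite ?inE//.
  by apply: measurableI => //; exact: measurable_itv.
have : c * x <= e / 2.
  rewrite /c mulrAC ler_pdivrMr ?ltr_wpDl// ler_pM2l//; lra.
lra.
Qed.

(** The indefinite integral [G] of [f] is absolutely continuous and, by Lebesgue differentiation,
    has derivative [f] almost everywhere. So [F - G] has derivative zero almost everywhere and is
    constant by [abs_continuous_deriv0]. *)
Lemma ftc_abs_continuous l F f : abs_continuous l F ->
  {ae mu, forall t, 0 < t < l -> has_deriv l F t (f t)} ->
  mu.-integrable `[0, l] (EFin \o f) ->
  forall x, 0 <= x <= l -> \int[mu]_(t in `[0, x]) f t = F x - F 0.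
Proof.
move=> HF Hf fi x /andP[x0 xl].
have l0 := le_trans x0 xl.
(* Extended by zero, the integrand is integrable on the whole line, where [FTC1] is applied. *)
pose g := f \_ `[0, l].
have mi (i : interval R) : measurable [set` i] by exact: measurable_itv.
have gi : mu.-integrable setT (EFin \o g).
  by rewrite -restrict_EFin; apply/integrable_restrict => //; rewrite setTI.
have giS (A : set R) : measurable A -> mu.-integrable A (EFin \o g).
  by move=> mA; apply: integrableS gi.
pose G y := \int[mu]_(t in [set` Interval (BLeft 0) (BRight y)]) g t.
have GB a b : 0 <= a -> a <= b -> G b - G a = \int[mu]_(t in `]a, b[) g t.
  move=> a0 ab; rewrite /G (Rintegral_itvB (giS _ (mi _)))//.
  by rewrite -Rintegral_itv_bndo_bndc//; exact: giS.
(* The increments of [G] over disjoint intervals add up to at most the integral of [|g|] over their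
   union, which is small when the union has small measure. *)
have GAC : abs_continuous l G.
  move=> e e0; have [d [d0 Hd]] := integral_normr_continuous gi e0.
  exists d => // n a b ab tab S.
  pose A := \big[setU/set0]_(i < n) `]a i, b i[%classic.
  have mA : measurable A by apply: bigsetU_measurable.
  apply: le_lt_trans (Hd A mA _).
    apply: (@le_trans _ _ (\sum_(i < n) \int[mu]_(t in `]a i, b i[) `|g t|)).
      apply: ler_sum => i _; have := ab i => abi.
      rewrite GB; [|lra|lra].
      by apply: le_normr_Rintegral => //; exact: giS.
    have Ei (B : set R) : measurable B ->
        (\int[mu]_(t in B) `|g t|)%:E = (\int[mu]_(t in B) `|g t|%:E)%E.
      move=> mB; rewrite fineK//; apply: integrable_fin_num => //.
      exact: (integrable_norm (giS B mB)).
    rewrite -lee_fin -sumEFin Ei// (eq_bigr (fun i => \int[mu]_(t in `]a i, b i[) `|g t|%:E)%E); last first.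
      by move=> i _; rewrite Ei.
    rewrite ge0_integral_bigsetU//.
    - exact: index_enum_uniq.
    - by move: tab; apply: sub_trivIset.
    - by have /integrableP[] := integrable_norm (giS A mA).
  rewrite /A measure_bigsetU_ord//.
  rewrite (eq_bigr (fun i => (b i - a i)%:E)) ?sumEFin// => i _.
  transitivity (mu `]a i, b i[%classic) => //.
  rewrite lebesgue_measure_itv/= lte_fin; case: ltP => // ba.
  by have := ab i => abi; congr EFin; lra.
suff : F x - G x = F 0 - G 0.
  have -> : G 0 = 0 by rewrite /G set_itv1 Rintegral_set1.
  move=> H.
  have -> : \int[mu]_(t in `[0, x]) f t = G x.
    apply: eq_Rintegral => t; rewrite inE/= in_itv/= => tx.
    by rewrite /g patchE mem_set//= in_itv/=; lra.
  lra.
have gl : locally_integrable [set: R] g by apply: integrable_locally => //; exact: openT.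
have Hae := @FTC1 R g (BLeft 0) (fun y => giS _ (mi _)) gl.
have NE (u : R -> R) t : - u t = (-1) * u t by rewrite mulN1r.
have FG : (fun t => F t - G t) = (fun t => F t + (-1) * G t).
  by apply/funext => t; rewrite mulN1r.
apply: (@abs_continuous_deriv0 l (fun t => F t - G t)); last by rewrite x0.
  rewrite FG; apply: abs_continuousD => //.
  by apply: abs_continuousM => //; exact: abs_continuous_cst.
apply: (@filterS2 _ _ (ae_filter_ringOfSetsType mu) _ _ _ _ Hf Hae) => t Ft Gt tl.
have tR : (0%:E < (t : R)%:E)%E by rewrite lte_fin; case/andP: tl.
have [dG GE] := Gt tR.
have GD : has_deriv l G t (g t).
  apply/(@is_derive_has_deriv R l G t (g t) tl).
  by have := derivableP dG; rewrite -derive1E GE.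
have := has_derivD (Ft tl) (@has_derivZ R l (-1) _ _ _ GD).
have -> : g t = f t by rewrite /g patchE mem_set//= in_itv/=; lra.
by rewrite mulN1r subrr FG.
Qed.
End fundamental_theorem.

(** * Sobolev functions on a segment *)

Section real_integrable.
Context {d : measure_display} {T : measurableType d} {R : realType}.
Variables (mu : {measure set T -> \bar R}) (D : set T).
Hypothesis mD : measurable D.
Implicit Types (f g : T -> R).
Local Notation rint f := (mu.-integrable D (EFin \o f)).

Lemma integrable_addr f g : rint f -> rint g -> rint (fun x => f x + g x).
Proof. by move=> fi gi; have := integrableD mD fi gi. Qed.

Lemma integrable_subr f g : rint f -> rint g -> rint (fun x => f x - g x).
Proof. by move=> fi gi; have := integrableB mD fi gi. Qed.

Lemma integrable_mulr (c : R) f : rint f -> rint (fun x => c * f x).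
Proof. by move=> fi; have := integrableZl mD c fi. Qed.

Lemma integrable_normr f : rint f -> rint (fun x => `|f x|).
Proof. by move=> fi; have := integrable_norm fi. Qed.

Lemma integrable_sumr (I : Type) (s : seq I) (F : I -> T -> R) :
  (forall i, rint (F i)) -> rint (fun x => \sum_(i <- s) F i x).
Proof.
move=> Fi; elim: s => [|i s IH].
  rewrite (_ : (fun x => _) = fun=> 0).
    exact: (@integrable0 _ _ _ mu D).
  by apply/funext => x; rewrite big_nil.
rewrite (_ : (fun x => _) = fun x => F i x + \sum_(i <- s) F i x).
  exact: integrable_addr.
by apply/funext => x; rewrite big_cons.
Qed.

Lemma Rintegral_sum (I : Type) (s : seq I) (F : I -> T -> R) :
  (forall i, rint (F i)) ->
  \int[mu]_(x in D) (\sum_(i <- s) F i x) = \sum_(i <- s) \int[mu]_(x in D) F i x.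
Proof.
move=> Fi; elim: s => [|i s IH].
  rewrite big_nil; under eq_Rintegral do rewrite big_nil.
  by rewrite Rintegral_cst// mul0r.
rewrite big_cons -IH -RintegralD//; last exact: integrable_sumr.
by apply: eq_Rintegral => x _; rewrite big_cons.
Qed.

Lemma integrable_dominated f g : measurable_fun D f ->
  (forall x, D x -> `|f x| <= g x) -> rint g -> rint f.
Proof.
move=> mf fg; apply: le_integrable => //; first exact/measurable_EFinP.
by move=> x Dx; rewrite /= lee_fin (le_trans (fg x Dx))// ler_norm.
Qed.

Lemma Rintegral_ge0_subset (A : set T) f : measurable A -> A `<=` D -> rint f ->
  (forall x, 0 <= f x) -> \int[mu]_(x in A) f x <= \int[mu]_(x in D) f x.
Proof.
move=> mA AD fi f0; apply: fine_le.
- by apply: integrable_fin_num => //; exact: integrableS fi.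
- exact: integrable_fin_num.
- apply: ge0_subset_integral => //; last by move=> x _; rewrite lee_fin.
  by case/integrableP: fi.
Qed.
End real_integrable.

(** * Square-integrable functions and H^1 pairs on a segment *)

Section sobolev_pairs.
Context {R : realType}.
Local Notation mu := (@lebesgue_measure R).
Implicit Types (l t x y c : R) (u v w z : R -> R).

Lemma L2_segment_mul l v w : L2_segment l v -> L2_segment l w ->
  mu.-integrable `[0, l] (EFin \o (fun t => v t * w t)).
Proof.
move=> [mv v2] [mw w2].
have m0 := measurable_itvR `[0, l].
apply: (integrable_dominated m0 _ _ (integrable_addr m0 v2 w2)).
  exact: measurable_funM.
move=> t _; have := sqr_ge0 (v t - w t); have := sqr_ge0 (v t + w t).
have := sqr_ge0 (v t); have := sqr_ge0 (w t).
by rewrite sqrrB sqrrD ler_norml; lra.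
Qed.

Lemma L2_segmentZ l c v : L2_segment l v -> L2_segment l (fun t => c * v t).
Proof.
move=> [mv v2]; split; first exact: measurable_funM.
have m0 := measurable_itvR `[0, l].
have := integrable_mulr m0 (c ^+ 2) v2; congr (mu.-integrable _ _).
by apply/funext => t; rewrite /= exprMn.
Qed.

Lemma L2_segmentD l v w : L2_segment l v -> L2_segment l w ->
  L2_segment l (fun t => v t + w t).
Proof.
move=> Lv Lw; have Lvw := L2_segment_mul Lv Lw; case: (Lv) (Lw) => mv v2 [mw w2].
split; first exact: measurable_funD.
have m0 := measurable_itvR `[0, l].
have := integrable_addr m0 (integrable_addr m0 v2 w2) (integrable_mulr m0 2 Lvw).
congr (mu.-integrable _ _); apply/funext => t /=; congr EFin; ring.
Qed.

Lemma L2_segment_continuous l v : {within `[0, l], continuous v} -> L2_segment l v.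
Proof.
move=> cv.
have m0 := measurable_itvR `[0, l].
split; first exact: subspace_continuous_measurable_fun.
apply: (@continuous_compact_integrable R (fun t => v t ^+ 2)); first exact: segment_compact.
by move=> t; apply: (@continuousM R (subspace `[0, l])); exact: cv.
Qed.

Lemma L2_segment_integrable l v : L2_segment l v -> mu.-integrable `[0, l] (EFin \o v).
Proof.
move=> Lv; have L1 : L2_segment l (fun=> 1 : R).
  by apply: L2_segment_continuous; apply: continuous_subspaceT => t; exact: cvg_cst.
have := L2_segment_mul Lv L1; congr (mu.-integrable _ _).
by apply/funext => t; rewrite /= mulr1.
Qed.

Lemma segment_integrable_cst l c : mu.-integrable `[0, l] (EFin \o (fun=> c)).
Proof.
apply/L2_segment_integrable/L2_segment_continuous.
by apply: continuous_subspaceT => t; exact: cvg_cst.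
Qed.

Lemma fine_lebesgue_oc x y : x <= y -> fine (mu `]x, y]%classic) = y - x.
Proof.
move=> xy; rewrite lebesgue_measure_itv/= lte_fin; case: ltP => //= yx.
by apply/esym/eqP; rewrite subr_eq0 eq_le yx xy.
Qed.

(** [v] is any almost everywhere derivative of [u], not necessarily [deriv_in l u]. A better
    representative can be substituted, as when [- lam * u] stands for the second derivative of an
    eigenfunction. *)
Definition H1_segment l u v : Prop :=
  [/\ abs_continuous l u,
      {ae mu, forall t, 0 < t < l -> has_deriv l u t (v t)} & L2_segment l v].

Lemma H1_segment_L2 l u v : H1_segment l u v -> L2_segment l u.
Proof. by case=> /abs_continuous_continuous /L2_segment_continuous. Qed.

Lemma H1_segmentD l u v w z : H1_segment l u v -> H1_segment l w z ->
  H1_segment l (fun t => u t + w t) (fun t => v t + z t).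
Proof.
move=> [Au Du Lv] [Aw Dw Lz]; split; first exact: abs_continuousD.
  apply: (@filterS2 _ _ (ae_filter_ringOfSetsType mu) _ _ _ _ Du Dw) => t ut wt tl.
  by apply: has_derivD; [exact: ut | exact: wt].
exact: L2_segmentD.
Qed.

Lemma H1_segmentZ l c u v : 0 <= l -> H1_segment l u v ->
  H1_segment l (fun t => c * u t) (fun t => c * v t).
Proof.
move=> l0 [Au Du Lv]; split.
- by apply: abs_continuousM => //; exact: abs_continuous_cst.
- apply: (@filterS _ _ (ae_filter_ringOfSetsType mu) _ _ _ Du) => t ut tl.
  by apply: has_derivZ; exact: ut.
- exact: L2_segmentZ.
Qed.

Lemma H1_segment_smooth l u v : 0 <= l ->
  (forall t, 0 <= t <= l -> has_deriv l u t (v t)) ->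
  {within `[0, l], continuous v} -> H1_segment l u v.
Proof.
move=> l0 Du cv; split.
- have [M _ HM] := within_continuous_bounded l0 cv.
  exact/abs_continuous_lipschitz/(has_deriv_lipschitz Du HM).
- by apply/aeW => t /andP[t0 tl]; apply: Du; rewrite !ltW.
- exact: L2_segment_continuous.
Qed.

(** A product of absolutely continuous functions is absolutely continuous, so the fundamental
    theorem applies to [u * w]. The free upper end [x] serves the pointwise bound below; integration
    by parts on an edge takes [x = l]. *)
Lemma H1_segment_parts l u v w z : 0 <= l -> H1_segment l u v -> H1_segment l w z ->
  forall x, 0 <= x <= l ->
  \int[mu]_(t in `[0, x]) (v t * w t + u t * z t) = u x * w x - u 0 * w 0.
Proof.
move=> l0 Hu Hw.
have Lu := H1_segment_L2 Hu; have Lw := H1_segment_L2 Hw.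
case: Hu Hw => Au Du Lv [Aw Dw Lz] x xl.
have m0 := measurable_itvR `[0, l].
apply: (@ftc_abs_continuous R l (fun t => u t * w t)) => //.
- exact: abs_continuousM.
- apply: (@filterS2 _ _ (ae_filter_ringOfSetsType mu) _ _ _ _ Du Dw) => t ut wt tl.
  have tl' : 0 <= (t : R) <= l by case/andP: tl => /ltW -> /ltW ->.
  by apply: has_derivM => //; [exact: ut | exact: wt].
- by apply: integrable_addr => //; exact: L2_segment_mul.
Qed.

Lemma ftc_H1_segment l u v x : 0 <= l -> H1_segment l u v -> 0 <= x <= l ->
  \int[mu]_(t in `[0, x]) v t = u x - u 0.
Proof.
move=> l0 Hu xl.
have H1 : H1_segment l (fun=> 1) (fun=> 0).
  apply: H1_segment_smooth => //; first by move=> t _; exact: has_deriv_cst.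
  by apply: continuous_subspaceT => t; exact: cvg_cst.
rewrite -[u x]mulr1 -[u 0]mulr1 -(H1_segment_parts l0 Hu H1 xl).
by apply: eq_Rintegral => t _; rewrite mulr1 mulr0 addr0.
Qed.

Lemma Rintegral_increment l (f h : R -> R) x y : 0 <= x -> x <= y -> y <= l ->
  mu.-integrable `[0, l] (EFin \o f) -> mu.-integrable `[0, l] (EFin \o h) ->
  (forall t, `|f t| <= h t) ->
  `|\int[mu]_(t in `[0, y]) f t - \int[mu]_(t in `[0, x]) f t| <=
  \int[mu]_(t in `]x, y]) h t.
Proof.
move=> x0 xy yl fi hi fh.
have mi := @measurable_itvR R.
have iS (g : R -> R) (i : interval R) : mu.-integrable `[0, l] (EFin \o g) ->
    [set` i] `<=` `[0, l] -> mu.-integrable [set` i] (EFin \o g).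
  by move=> gi il; apply: integrableS gi.
have s1 : `[0, y] `<=` `[0, l] by apply: subset_itvl; rewrite bnd_simp.
have s2 : `]x, y] `<=` `[0, l] by apply: subset_itv; rewrite bnd_simp.
rewrite (Rintegral_itvB (iS _ _ fi s1)) ?bnd_simp//.
rewrite (le_trans (le_normr_Rintegral _ _))//; first exact: iS.
apply: le_Rintegral => //; [|exact: iS].
exact: (integrable_normr (iS _ _ fi s2)).
Qed.

(** The derivative [f] of [u ^+ 2] satisfies [|f| <= c u^2 + v^2 / c]. Hence [u x ^+ 2] exceeds
    [u y ^+ 2] by at most the integral [B] of the right-hand side, for every [y]; averaging over [y]
    gives the bound. The free [c] allows the derivative term to be made small. *)
Lemma H1_segment_sup l u v c x : 0 < l -> H1_segment l u v -> 0 < c -> 0 <= x <= l ->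
  u x ^+ 2 <= (l^-1 + c) * \int[mu]_(t in `[0, l]) (u t ^+ 2) +
              c^-1 * \int[mu]_(t in `[0, l]) (v t ^+ 2).
Proof.
move=> l0 Hu c0 xl; have l0' := ltW l0.
have [mu_ u2] := H1_segment_L2 Hu; have [_ _ [mv v2]] := Hu.
have uv := L2_segment_mul (H1_segment_L2 Hu) (let: And3 _ _ L := Hu in L).
have mi := @measurable_itvR R.
pose h t := c * u t ^+ 2 + c^-1 * v t ^+ 2.
pose f t := v t * u t + u t * v t.
have hi1 : mu.-integrable `[0, l] (EFin \o (fun t => c * u t ^+ 2)).
  exact: (integrable_mulr (mi `[0, l]) c u2).
have hi2 : mu.-integrable `[0, l] (EFin \o (fun t => c^-1 * v t ^+ 2)).
  exact: (integrable_mulr (mi `[0, l]) c^-1 v2).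
have hi : mu.-integrable `[0, l] (EFin \o h) by exact: (integrable_addr (mi `[0, l]) hi1 hi2).
have fi : mu.-integrable `[0, l] (EFin \o f).
  have := integrable_addr (mi `[0, l]) uv uv; congr (mu.-integrable _ _).
  by apply/funext => t; rewrite /f /= [v t * _]mulrC.
have fh t : `|f t| <= h t.
  rewrite /f /h ler_norml.
  have e1 : 0 <= (c * u t - v t) ^+ 2 / c by rewrite divr_ge0 ?sqr_ge0// ltW.
  have e2 : 0 <= (c * u t + v t) ^+ 2 / c by rewrite divr_ge0 ?sqr_ge0// ltW.
  have -> : c * u t ^+ 2 + c^-1 * v t ^+ 2 = (c * u t - v t) ^+ 2 / c + 2 * (v t * u t).
    by field; rewrite gt_eqF.
  have E : (c * u t - v t) ^+ 2 / c + 2 * (v t * u t) = (c * u t + v t) ^+ 2 / c - 2 * (v t * u t).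
    by field; rewrite gt_eqF.
  by apply/andP; split; [rewrite E|]; lra.
set B := \int[mu]_(t in `[0, l]) h t.
have hS y1 y2 : 0 <= y1 -> y1 <= y2 -> y2 <= l -> \int[mu]_(t in `]y1, y2]) h t <= B.
  move=> y10 y12 y2l; rewrite /B.
  apply: Rintegral_ge0_subset => //; first by apply: subset_itv; rewrite bnd_simp.
  by move=> t; apply: le_trans (fh t).
have key y : 0 <= y <= l -> u x ^+ 2 - B <= u y ^+ 2.
  move=> yl.
  have Ex := H1_segment_parts l0' Hu Hu xl; have Ey := H1_segment_parts l0' Hu Hu yl.
  rewrite !expr2; suff : `|u x * u x - u y * u y| <= B by rewrite ler_norml; lra.
  rewrite (_ : _ - _ = \int[mu]_(t in `[0, x]) f t - \int[mu]_(t in `[0, y]) f t); last lra.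
  have [xy|/ltW xy] := leP y x; last rewrite distrC.
    apply: le_trans (Rintegral_increment (l := l) _ xy _ fi hi fh) (hS _ _ _ xy _); lra.
  apply: le_trans (Rintegral_increment (l := l) _ xy _ fi hi fh) (hS _ _ _ xy _); lra.
have EB : B = c * \int[mu]_(t in `[0, l]) (u t ^+ 2) + c^-1 * \int[mu]_(t in `[0, l]) (v t ^+ 2).
  by rewrite /B RintegralD// !RintegralZl.
have : \int[mu]_(t in `[0, l]) (u x ^+ 2 - B) <= \int[mu]_(t in `[0, l]) (u t ^+ 2).
  apply: le_Rintegral => //.
    exact: segment_integrable_cst.
rewrite Rintegral_cst// [fine _](_ : _ = l); last first.
  by rewrite [X in fine X]lebesgue_measure_itv/= lte_fin l0 /= subr0.
rewrite -ler_pdivlMr// EB; lra.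
Qed.

(** Integrates [2 |v| <= 1 + v^2] between the two points. No square root appears, which suits the
    later case where the increment of [u] also bounds the integral of [v ^+ 2]. *)
Lemma H1_segment_diff l u v x y : 0 <= l -> H1_segment l u v ->
  0 <= x <= l -> 0 <= y <= l ->
  2 * `|u x - u y| <= `|x - y| + \int[mu]_(t in `[0, l]) (v t ^+ 2).
Proof.
move=> l0 Hu; wlog yx : x y / y <= x.
  move=> W xl yl; have [yx|/ltW xy] := leP y x; first exact: W.
  by rewrite distrC (distrC x); exact: W.
move=> xl yl.
have mi := @measurable_itvR R.
have [_ _ [mv v2]] := Hu.
have vi := L2_segment_integrable (let: And3 _ _ L := Hu in L).
have ci := segment_integrable_cst l 2^-1.
have v2' := integrable_mulr (mi `[0, l]) 2^-1 v2.
have hi := integrable_addr (mi `[0, l]) ci v2'.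
have s2 : `]y, x] `<=` `[0, l] by apply: subset_itv; rewrite bnd_simp; lra.
have := @Rintegral_increment l v _ y x _ yx _ vi hi _.
rewrite (ftc_H1_segment l0 Hu xl) (ftc_H1_segment l0 Hu yl).
rewrite (_ : u x - u 0 - (u y - u 0) = u x - u y); last by ring.
rewrite RintegralD//; last 2 first.
- exact: integrableS ci.
- exact: integrableS v2'.
rewrite RintegralZl//; last exact: integrableS v2.
rewrite Rintegral_cst// [X in _ * X]fine_lebesgue_oc//.
move=> /(_ ltac:(lra) ltac:(lra)) H.
have {}H := H (fun t => _).
have := Rintegral_ge0_subset (mi `[0, l]) (mi `]y, x]) s2 v2 (fun t => sqr_ge0 (v t)).
rewrite (ger0_norm (_ : 0 <= x - y)) ?subr_ge0//.
have : `|u x - u y| <= 2^-1 * (x - y) + 2^-1 * \int[mu]_(t in `]y, x]) v t ^+ 2.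
  apply: H => t; have := sqr_ge0 (v t - 1); have := sqr_ge0 (v t + 1).
  by rewrite sqrrB sqrrD ler_norml !mulr1 expr1n; lra.
lra.
Qed.

(** Near [x], the integral of [v - v x] over a short interval is at most [e] times its length. The
    derivative is obtained on the closed segment, ends included, where the Kirchhoff conditions read
    it. *)
Lemma has_deriv_primitive l u v : 0 <= l -> {within `[0, l], continuous v} ->
  (forall x, 0 <= x <= l -> \int[mu]_(t in `[0, x]) v t = u x - u 0) ->
  forall x, 0 <= x <= l -> has_deriv l u x (v x).
Proof.
move=> l0 cv uv x xl; apply/has_derivP => e e0.
have vi := L2_segment_integrable (L2_segment_continuous cv).
have mi := @measurable_itvR R.
have [d d0 Hd] := (within_continuousP l v).1 cv x xl e e0.
exists d => // s sl sd.
have key a b : 0 <= a -> a <= b -> b <= l ->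
    (forall t, a < t <= b -> `|v t - v x| <= e) ->
    `|u b - u a - v x * (b - a)| <= e * (b - a).
  move=> a0 ab bl abx.
  have mab := fine_lebesgue_oc ab.
  have s1 : `[0, b] `<=` `[0, l] by apply: subset_itvl; rewrite bnd_simp.
  have s2 : `]a, b] `<=` `[0, l] by apply: subset_itv; rewrite bnd_simp.
  have ci k : mu.-integrable `]a, b] (EFin \o (fun=> k)).
    exact: integrableS (segment_integrable_cst l k).
  have vi2 : mu.-integrable `]a, b] (EFin \o v) by exact: integrableS vi.
  have -> : u b - u a = \int[mu]_(t in `]a, b]) v t.
    have vb : mu.-integrable `[0, b] (EFin \o v) by exact: integrableS vi.
    by rewrite -(Rintegral_itvB vb) ?bnd_simp// !uv; lra.
  rewrite -mab -Rintegral_cst// -RintegralB//.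
  rewrite (le_trans (le_normr_Rintegral _ _))//.
    exact: (integrable_subr (mi `]a, b]) vi2 (ci (v x))).
  rewrite -Rintegral_cst//; apply: le_Rintegral => //.
    exact: (integrable_normr (integrable_subr (mi `]a, b]) vi2 (ci (v x)))).
have [xs|sx] := leP x s.
  rewrite (ger0_norm (_ : 0 <= s - x)) ?subr_ge0//; apply: key; [lra|lra|lra|].
  move=> t txs; apply/ltW/Hd; [lra|move: sd; rewrite !ltr_norml; lra].
rewrite (ltr0_norm (_ : s - x < 0)) ?subr_lt0// opprB -normrN.
rewrite (_ : - (_ - _ - _) = u x - u s - v x * (x - s)); last by ring.
apply: key; [lra|lra|lra|].
by move=> t txs; apply/ltW/Hd; [lra|move: sd; rewrite !ltr_norml; lra].
Qed.

Lemma nderiv_inS l i u : nderiv_in l i.+1 u = deriv_in l (nderiv_in l i u).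
Proof. by []. Qed.

Lemma Cm_segment_continuous l m u i : 0 < l -> Cm_segment l m u -> (i <= m)%N ->
  {within `[0, l], continuous (nderiv_in l i u)}.
Proof.
move=> l0 [Du cu]; rewrite leq_eqVlt => /orP[/eqP ->//|im].
apply: (@has_deriv_within_continuous R l _ (nderiv_in l i.+1 u)) => t tl.
by rewrite nderiv_inS; apply: derivable_in_has_deriv; apply: Du; rewrite ?in_itv.
Qed.

(** Only the last pair, [i = p.-1], draws on absolute continuity and almost everywhere derivability;
    below it each derivative has a continuous derivative everywhere. *)
Lemma sobolev_H1_segment l p u i : 0 < l -> sobolev_segment l p u -> (i < p)%N ->
  H1_segment l (nderiv_in l i u) (nderiv_in l i.+1 u).
Proof.
case: p => // p l0 [/= Cu Au Du Lu]; rewrite ltnS leq_eqVlt => /orP[/eqP ->|ip].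
  split=> //; apply: (@filterS _ _ (ae_filter_ringOfSetsType mu) _ _ _ Du) => t ut tl.
  apply: derivable_in_has_deriv; apply: ut.
  by case/andP: tl => /ltW t0 /ltW tl; rewrite in_itv/= t0 tl.
apply: H1_segment_smooth; first exact: ltW.
  move=> t tl; apply: derivable_in_has_deriv.
  by case: Cu => H _; apply: H; rewrite ?in_itv.
exact: (@Cm_segment_continuous l p u i.+1).
Qed.

(** Regularity from the equation: [u'] has derivative [- lam * u] almost everywhere, so it is a
    primitive of this continuous function and has it as derivative at every point. *)
Lemma eigen_has_deriv l lam u : 0 < l -> sobolev_segment l 2 u ->
  {ae mu, forall t, t \in `[0, l] -> - nderiv_in l 2 u t = lam * u t} ->
  forall t, 0 <= t <= l -> has_deriv l u t (deriv_in l u t) /\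
    has_deriv l (deriv_in l u) t (- lam * u t).
Proof.
move=> l0 Su Eu.
have [[Du _] _ _ _] := Su.
have Hu t : 0 <= t <= l -> has_deriv l u t (deriv_in l u t).
  by move=> tl; apply: derivable_in_has_deriv; apply: (Du 0%N); rewrite ?in_itv.
have cu := has_deriv_within_continuous Hu.
have l0' := ltW l0.
have cv : {within `[0, l], continuous (fun t => - lam * u t)}.
  apply: (@has_deriv_within_continuous R l _ (fun t => - lam * deriv_in l u t)) => t tl.
  exact/has_derivZ/Hu.
have H2 : H1_segment l (deriv_in l u) (fun t => - lam * u t).
  have [A D L] := sobolev_H1_segment l0 Su (isT : (1 < 2)%N).
  split=> //; last exact: L2_segment_continuous.
  apply: (@filterS2 _ _ (ae_filter_ringOfSetsType mu) _ _ _ _ D Eu) => t Dt Et tl.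
  have tl' : (t : R) \in `[0, l] by case/andP: tl => /ltW t0 /ltW tl; rewrite in_itv/= t0.
  by rewrite mulNr -(Et tl') opprK; exact: Dt.
move=> t tl; split; first exact: Hu.
apply: (has_deriv_primitive l0' cv _ tl) => x xl.
exact: (ftc_H1_segment l0' H2 xl).
Qed.
End sobolev_pairs.

(** * Kirchhoff conditions and integration by parts *)

Variant odd_or_even_spec (i : nat) : Prop :=
| IsEven j of i = j.*2 | IsOdd j of i = j.*2.+1.

Lemma odd_or_evenP i : odd_or_even_spec i.
Proof.
rewrite -(odd_double_half i); case: (odd i); last by apply: IsEven.
exact: (@IsOdd _ i./2).
Qed.

(** * Smooth functions and the eigenvalue equation on one edge *)

Section smooth_chains.
Context {R : realType}.
Local Notation mu := (@lebesgue_measure R).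
Implicit Types (l t lam c : R) (u v : R -> R) (i j m p : nat).

Definition smooth_segment l u : Prop := forall i t, 0 <= t <= l ->
  has_deriv l (nderiv_in l i u) t (nderiv_in l i.+1 u t).

Lemma smooth_continuous l u i : smooth_segment l u ->
  {within `[0, l], continuous (nderiv_in l i u)}.
Proof. by move=> Su; exact: has_deriv_within_continuous (Su i). Qed.

Lemma smooth_H1_segment l u i : 0 <= l -> smooth_segment l u ->
  H1_segment l (nderiv_in l i u) (nderiv_in l i.+1 u).
Proof.
by move=> l0 Su; apply: H1_segment_smooth => //; [exact: Su|exact: smooth_continuous].
Qed.

Lemma smooth_Cm_segment l u m : smooth_segment l u -> Cm_segment l m u.
Proof.
move=> Su; split; last exact: smooth_continuous.
by move=> i t _; rewrite in_itv/= => tl; exact: has_deriv_derivable_in (Su i t tl).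
Qed.

Lemma smooth_sobolev_segment l u p : 0 <= l -> (0 < p)%N -> smooth_segment l u ->
  sobolev_segment l p u.
Proof.
case: p => // p l0 _ Su; have [A _ L] := smooth_H1_segment p l0 Su.
split => //; first exact: smooth_Cm_segment.
apply/aeW => t; rewrite in_itv/= => tl.
exact: has_deriv_derivable_in (Su p t tl).
Qed.

(** Phrased for any solution of [u' = v], [v' = - lam * u], so that it covers an eigenfunction read
    from either end of an edge. *)
Lemma nderiv_eigen l lam u v : 0 < l ->
  (forall t, 0 <= t <= l -> has_deriv l u t (v t) /\ has_deriv l v t (- lam * u t)) ->
  forall j t, 0 <= t <= l ->
    nderiv_in l j.*2 u t = (- lam) ^+ j * u t /\
    nderiv_in l j.*2.+1 u t = (- lam) ^+ j * v t.
Proof.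
move=> l0 H; elim=> [|j IH] t tl.
  by rewrite expr0 !mul1r; split=> //; apply: deriv_inE => //; case: (H t tl).
have E s : 0 <= s <= l -> nderiv_in l j.+1.*2 u s = (- lam) ^+ j.+1 * u s.
  move=> sl; rewrite doubleS nderiv_inS; apply: deriv_inE => //.
  rewrite exprSr -mulrA.
  apply: (@has_deriv_ext _ l (fun t => (- lam) ^+ j * v t)) => //.
    by move=> r rl; case: (IH r rl).
  by apply: has_derivZ; case: (H s sl).
split; first exact: E.
rewrite nderiv_inS; apply: deriv_inE => //.
apply: (@has_deriv_ext _ l (fun t => (- lam) ^+ j.+1 * u t)) => //.
  by move=> r rl; rewrite E.
by apply: has_derivZ; case: (H t tl).
Qed.

Lemma smooth_eigen l lam u v : 0 < l ->
  (forall t, 0 <= t <= l -> has_deriv l u t (v t) /\ has_deriv l v t (- lam * u t)) ->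
  smooth_segment l u.
Proof.
move=> l0 H i t tl; have E := nderiv_eigen l0 H.
have [j ->|j ->] : odd_or_even_spec i by exact: odd_or_evenP.
  rewrite (E _ _ tl).2.
  apply: (@has_deriv_ext _ l (fun t => (- lam) ^+ j * u t)) => //.
    by move=> s sl; rewrite (E _ _ sl).1.
  by apply: has_derivZ; case: (H t tl).
rewrite -[j.*2.+2]/(j.+1.*2) (E _ _ tl).1 exprSr -mulrA.
apply: (@has_deriv_ext _ l (fun t => (- lam) ^+ j * v t)) => //.
  by move=> s sl; rewrite (E _ _ sl).2.
by apply: has_derivZ; case: (H t tl).
Qed.

(** The difference quotients are equal, so the two functions agree everywhere, default values
    included. *)
Lemma deriv_in_subr_cst l u c : deriv_in l (fun t => u t - c) = deriv_in l u.
Proof.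
apply/funext => t; rewrite /deriv_in; suff -> : diff_quot (fun t => u t - c) t = diff_quot u t by [].
by apply/funext => s; rewrite /diff_quot opprB addrA subrK.
Qed.

Lemma nderiv_in_subr_cst l u c i :
  nderiv_in l i.+1 (fun t => u t - c) = nderiv_in l i.+1 u.
Proof. by rewrite /nderiv_in !iterSr deriv_in_subr_cst. Qed.

Lemma smooth_subr_cst l u c : smooth_segment l u ->
  smooth_segment l (fun t => u t - c).
Proof.
move=> Su [|i] t tl; last by rewrite !nderiv_in_subr_cst; exact: Su.
rewrite nderiv_in_subr_cst -[nderiv_in l 1 u t]addr0.
by apply: has_derivD; [exact: (Su 0%N t tl) | exact: has_deriv_cst].
Qed.

(** Each differentiation contributes a sign. Derivability below order [i] lets every limit be
    computed, so that no default value enters. *)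
Lemma nderiv_in_reflect l u i : 0 < l ->
  (forall j t, (j < i)%N -> 0 <= t <= l -> derivable_in l (nderiv_in l j u) t) ->
  forall t, 0 <= t <= l ->
  nderiv_in l i (fun s => u (l - s)) t = (-1) ^+ i * nderiv_in l i u (l - t).
Proof.
move=> l0; elim: i => [|i IH] D t tl; first by rewrite expr0 mul1r.
rewrite nderiv_inS; apply: deriv_inE => //.
apply: (@has_deriv_ext _ l (fun t => (-1) ^+ i * nderiv_in l i u (l - t))) => //.
  by move=> s sl; rewrite IH// => j r ji rl; apply: D => //; exact: ltnW.
rewrite exprSr -mulrA mulN1r; apply: has_derivZ; apply: has_deriv_reflect.
by apply: derivable_in_has_deriv; apply: D => //; lra.
Qed.
End smooth_chains.

(** * Points of the graph, exit derivatives and boundary terms *)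

Section graph_points.
Context {R : realType} (G : metric_graph R).
Implicit Types (f g : gpoint G -> R) (e : edge G) (v : vertex G) (x y : gpoint G).

Lemma edge_point_le0 e (t : R) : t <= 0 -> edge_point e t = inl (src e).
Proof. by move=> t0; rewrite /edge_point insubF ?t0// ltNge t0. Qed.

Lemma edge_point_ge e (t : R) : len e <= t -> edge_point e t = inl (tgt e).
Proof.
move=> t0; rewrite /edge_point insubF; last by rewrite [X in _ && X]ltNge t0 andbF.
by rewrite leNgt (lt_le_trans (len_gt0 e) t0).
Qed.

Lemma edge_point_in e (u : {t : R | 0 < t < len e}) :
  edge_point e (val u) = inr (existT _ e u).
Proof. by rewrite /edge_point valK. Qed.

Lemma shift_pointE f v e : incident e v ->
  f \o shift_point v e =
  if v == src e then edge_fun f e else fun h => edge_fun f e (len e - h).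
Proof. by move=> _; rewrite /shift_point; case: eqP. Qed.

Lemma shift_point0 v e : incident e v -> shift_point v e 0 = inl v.
Proof.
rewrite /shift_point => /orP[/eqP ->|/eqP ->]; first by rewrite eqxx edge_point_le0.
by rewrite eq_sym (negbTE (no_loop e)) subr0 edge_point_ge.
Qed.

(** Edges are glued in [gpoint], so all exit values at [v] are the value of [f] at one and the same
    point. *)
Lemma kirchhoff0 f v : kirchhoff 0 f v.
Proof. by move=> e e' ev ev'; rewrite /exit_deriv /= !shift_point0. Qed.

(** The first edge of a path from [v] to an end of [e0] is incident to [v]. An edge has to be given,
    since a single vertex without edges is a metric graph. *)
Lemma vertex_incident (e0 : edge G) v : exists e, incident e v.
Proof.
have [->|vs] := eqVneq v (src e0); first by exists e0; rewrite /incident eqxx.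
have /connectP[[|w s] /= ps ls] := graph_connected v (src e0).
  by rewrite ls eqxx in vs.
move: ps => /andP[/existsP[e /eqP E] _]; exists e.
have : v \in [set src e; tgt e]%SET by rewrite E !inE eqxx.
by rewrite !inE.
Qed.

Lemma gpoint_edge (e0 : edge G) x :
  exists e (t : R), 0 <= t <= len e /\ x = edge_point e t.
Proof.
case: x => [v|[e u]].
  have [e /orP[/eqP ->|/eqP ->]] := vertex_incident e0 v; exists e.
    by exists 0; rewrite lexx ltW ?len_gt0// edge_point_le0.
  by exists (len e); rewrite lexx ltW ?len_gt0// edge_point_ge.
exists e, (val u); rewrite edge_point_in; split=> //.
by have /andP[/ltW -> /ltW ->] := valP u.
Qed.

(** Double counting: without loops the two ends of an edge are distinct vertices, so each edge is
    met exactly twice. *)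
Lemma sum_incident (Z : vertex G -> edge G -> R) :
  \sum_v \sum_(e | incident e v) Z v e = \sum_e (Z (src e) e + Z (tgt e) e).
Proof.
rewrite (exchange_big_dep xpredT)//=; apply: eq_bigr => e _.
rewrite (bigD1 (src e)) ?/incident ?eqxx//=; congr (_ + _).
rewrite (bigD1 (tgt e)) ?eqxx ?orbT//=; last by rewrite eq_sym no_loop.
rewrite big1 ?addr0// => v /andP[/andP[/orP[/eqP ->|/eqP ->]]]; rewrite ?eqxx//.
Qed.

Lemma exit_deriv_src f e i : exit_deriv i f (src e) e = nderiv_graph i f e 0.
Proof. by rewrite /exit_deriv shift_pointE ?/incident ?eqxx. Qed.

Lemma exit_deriv_tgt f e i :
  (forall j t, (j < i)%N -> 0 <= t <= len e ->
    derivable_in (len e) (nderiv_in (len e) j (edge_fun f e)) t) ->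
  exit_deriv i f (tgt e) e = (-1) ^+ i * nderiv_graph i f e (len e).
Proof.
move=> D; have l0 := len_gt0 e.
rewrite /exit_deriv shift_pointE ?/incident ?eqxx ?orbT//.
rewrite eq_sym (negbTE (no_loop e)) nderiv_in_reflect ?subr0//.
by rewrite lexx ltW.
Qed.

(* At each vertex one of the two exit derivatives is constant over the incident
   edges and the other one sums to zero. *)
Lemma kirchhoff_boundary i j f g : odd (i + j) ->
  (forall e, Cm_segment (len e) i (edge_fun f e)) ->
  (forall e, Cm_segment (len e) j (edge_fun g e)) ->
  (forall v, kirchhoff i f v) -> (forall v, kirchhoff j g v) ->
  \sum_(e : edge G) (nderiv_graph i f e (len e) * nderiv_graph j g e (len e) -
     nderiv_graph i f e 0 * nderiv_graph j g e 0) = 0.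
Proof.
move=> oij Cf Cg.
wlog oi : i j f g oij Cf Cg / odd i = false.
  move=> W kf kg; case oi : (odd i); last exact: W.
  have oj : odd j = false by move: oij; rewrite oddD oi; case: (odd j).
  rewrite -[RHS](W j i g f) 1?addnC//; apply: eq_bigr => e _.
  by rewrite ![nderiv_graph j g e _ * _]mulrC.
move=> kf kg; have oj : odd j by move: oij; rewrite oddD oi.
(* At the target the exit derivatives carry the signs [(-1)^i] and [(-1)^j], whose product is -1
   because [i + j] is odd. The difference between the ends becomes minus a sum over the ends, which
   can be regrouped by vertices. *)
rewrite (eq_bigr (fun e => - (exit_deriv i f (src e) e * exit_deriv j g (src e) e +
    exit_deriv i f (tgt e) e * exit_deriv j g (tgt e) e))); last first.
  move=> e _; rewrite !exit_deriv_src !exit_deriv_tgt.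
  - by rewrite -(signr_odd _ i) -(signr_odd _ j) oi oj expr0 expr1; ring.
  - by move=> k t kj tl; case: (Cg e) => H _; apply: H; rewrite ?in_itv.
  - by move=> k t kj tl; case: (Cf e) => H _; apply: H; rewrite ?in_itv.
rewrite sumrN -(sum_incident (fun v e => exit_deriv i f v e * exit_deriv j g v e)).
rewrite big1 ?oppr0// => v _.
have := kf v; have := kg v; rewrite /kirchhoff oi oj => kgv kfv.
have [e ev|noe] := pickP (fun e => incident e v); last by rewrite big_pred0.
rewrite (eq_bigr (fun e' => exit_deriv i f v e * exit_deriv j g v e')).
  by rewrite -mulr_sumr kgv mulr0.
by move=> e' ev'; rewrite (kfv e e').
Qed.
End graph_points.

(** * L2 pairings on the graph and integration by parts against eigenfunctions *)

Section graph_inner_product.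
Context {R : realType} (G : metric_graph R).
Local Notation mu := (@lebesgue_measure R).
Implicit Types (F H K : edge G -> R -> R) (f g : gpoint G -> R) (e : edge G).

(** The arguments are families over the edges, because a derivative has no common value at a vertex.
    Both [inner_L2] and [inner_F] are instances. *)
Definition edge_ip F H : R := integral_graph (fun e t => F e t * H e t).
Definition edge_L2 F : Prop := forall e, L2_segment (len e) (F e).
Definition edge_H1 F H : Prop := forall e, H1_segment (len e) (F e) (H e).

Lemma edge_ipC F H : edge_ip F H = edge_ip H F.
Proof.
by apply: eq_bigr => e _; apply: eq_Rintegral => t _; rewrite mulrC.
Qed.

Lemma eq_edge_ip F F' H H' :
  (forall e (t : R), 0 <= t <= len e -> F e t = F' e t) ->
  (forall e (t : R), 0 <= t <= len e -> H e t = H' e t) ->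
  edge_ip F H = edge_ip F' H'.
Proof.
move=> FF HH; apply: eq_bigr => e _; apply: eq_Rintegral => t; rewrite inE/= in_itv/=.
by move=> te; rewrite FF ?HH.
Qed.

Lemma edge_ipD F H K : edge_L2 F -> edge_L2 H -> edge_L2 K ->
  edge_ip (fun e t => F e t + H e t) K = edge_ip F K + edge_ip H K.
Proof.
move=> LF LH LK; rewrite -big_split/=; apply: eq_bigr => e _.
have m := measurable_itvR `[0, len e].
rewrite -(RintegralD m (L2_segment_mul (LF e) (LK e)) (L2_segment_mul (LH e) (LK e))).
by apply: eq_Rintegral => t _; rewrite mulrDl.
Qed.

Lemma edge_ipZ (c : R) F K : edge_L2 F -> edge_L2 K ->
  edge_ip (fun e t => c * F e t) K = c * edge_ip F K.
Proof.
move=> LF LK; rewrite /edge_ip /integral_graph mulr_sumr; apply: eq_bigr => e _.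
have m := measurable_itvR `[0, len e].
rewrite -(RintegralZl _ m (L2_segment_mul (LF e) (LK e))).
by apply: eq_Rintegral => t _; rewrite mulrA.
Qed.

Lemma edge_L2_cst (c : R) : edge_L2 (fun _ _ => c).
Proof.
move=> e; apply: L2_segment_continuous.
by apply: continuous_subspaceT => t; exact: cvg_cst.
Qed.

Lemma edge_L2D F H : edge_L2 F -> edge_L2 H -> edge_L2 (fun e t => F e t + H e t).
Proof. by move=> LF LH e; exact: L2_segmentD. Qed.

Lemma edge_L2Z (c : R) F : edge_L2 F -> edge_L2 (fun e t => c * F e t).
Proof. by move=> LF e; exact: L2_segmentZ. Qed.

Lemma edge_L2_sum N (a : nat -> R) (F : nat -> edge G -> R -> R) :
  (forall k, edge_L2 (F k)) -> edge_L2 (fun e t => \sum_(k < N) a k * F k e t).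
Proof.
move=> LF; elim: N => [|N IH].
  rewrite (_ : (fun _ _ => _) = fun _ _ => 0); first exact: edge_L2_cst.
  by apply/funext => e; apply/funext => t; rewrite big_ord0.
rewrite (_ : (fun _ _ => _) =
    fun e t => \sum_(k < N) a k * F k e t + a N * F N e t).
  by apply: edge_L2D => //; exact: edge_L2Z.
by apply/funext => e; apply/funext => t; rewrite big_ord_recr.
Qed.

Lemma edge_H1_L2 F H : edge_H1 F H -> edge_L2 F.
Proof. by move=> FH e; exact: H1_segment_L2 (FH e). Qed.

Lemma edge_H1_L2d F H : edge_H1 F H -> edge_L2 H.
Proof. by move=> FH e; case: (FH e). Qed.

Lemma edge_H1_sum N (a : nat -> R) (F H : nat -> edge G -> R -> R) :
  (forall k, edge_H1 (F k) (H k)) ->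
  edge_H1 (fun e t => \sum_(k < N) a k * F k e t) (fun e t => \sum_(k < N) a k * H k e t).
Proof.
move=> FH e; elim: N => [|N IH].
  rewrite (_ : (fun t => _) = fun=> 0); last by apply/funext => t; rewrite big_ord0.
  rewrite (_ : (fun t => \sum_(k < 0) _) = fun=> 0); last by apply/funext => t; rewrite big_ord0.
  apply: H1_segment_smooth; first exact/ltW/len_gt0.
    by move=> t _; exact: has_deriv_cst.
  by apply: continuous_subspaceT => t; exact: cvg_cst.
rewrite (_ : (fun t => _) = fun t => \sum_(k < N) a k * F k e t + a N * F N e t); last first.
  by apply/funext => t; rewrite big_ord_recr.
rewrite (_ : (fun t => \sum_(k < N.+1) _) = fun t => \sum_(k < N) a k * H k e t + a N * H N e t); last first.
  by apply/funext => t; rewrite big_ord_recr.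
by apply: H1_segmentD => //; apply: H1_segmentZ; [exact/ltW/len_gt0 | exact: FH].
Qed.

Lemma edge_ip_sum N (a : nat -> R) (F : nat -> edge G -> R -> R) K :
  (forall k, edge_L2 (F k)) -> edge_L2 K ->
  edge_ip (fun e t => \sum_(k < N) a k * F k e t) K = \sum_(k < N) a k * edge_ip (F k) K.
Proof.
move=> LF LK; elim: N => [|N IH].
  rewrite big_ord0 /edge_ip /integral_graph big1// => e _.
  under eq_Rintegral do rewrite big_ord0 mul0r.
  by rewrite Rintegral_cst ?mul0r//; exact: measurable_itvR.
rewrite big_ord_recr/= -IH -edge_ipZ// -edge_ipD//; last 2 first.
- exact: edge_L2_sum.
- exact: edge_L2Z.
by apply: eq_edge_ip => // e t _; rewrite big_ord_recr.
Qed.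

Lemma edge_ip_ge0 F : 0 <= edge_ip F F.
Proof.
by apply: sumr_ge0 => e _; apply: Rintegral_ge0 => t _; rewrite -expr2 sqr_ge0.
Qed.

Lemma edge_ip_edge F e : \int[mu]_(t in `[0, len e]) (F e t ^+ 2) <= edge_ip F F.
Proof.
rewrite /edge_ip /integral_graph (bigD1 e)//= lerDl.
by apply: sumr_ge0 => e' _; apply: Rintegral_ge0 => t _; rewrite -expr2 sqr_ge0.
Qed.

Lemma eigen_smooth lam f : laplace_eigen lam f ->
  forall e, smooth_segment (len e) (edge_fun f e).
Proof.
move=> [[Sf _ _] Ef] e; have l0 := len_gt0 e.
exact: (smooth_eigen l0 (eigen_has_deriv l0 (Sf e) (Ef e))).
Qed.

Lemma nderiv_eigen_even lam f e j (t : R) : laplace_eigen lam f -> 0 <= t <= len e ->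
  nderiv_graph j.*2 f e t = (- lam) ^+ j * edge_fun f e t.
Proof.
move=> [[Sf _ _] Ef] tl; have l0 := len_gt0 e.
by have [] := nderiv_eigen l0 (eigen_has_deriv l0 (Sf e) (Ef e)) j tl.
Qed.

Lemma eigen_edge_H1 lam f : laplace_eigen lam f ->
  edge_H1 (edge_fun f) (nderiv_graph 1 f).
Proof.
move=> Ef e; have := smooth_H1_segment 0 (ltW (len_gt0 e)) (eigen_smooth Ef (e := e)).
by [].
Qed.

(** Exit derivatives of orders [2j] and [2j + 1] are [(- lam)^j] times those of orders 0 and 1, so
    the conditions of every order follow from the gluing and from the first-order condition in
    [laplace_dom]. *)
Lemma eigen_kirchhoff lam f i v : laplace_eigen lam f -> kirchhoff i f v.
Proof.
move=> Ef.
pose u e := f \o shift_point v e.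
have E j e : incident e v ->
    exit_deriv j.*2 f v e = (- lam) ^+ j * f (inl v) /\
    exit_deriv j.*2.+1 f v e = (- lam) ^+ j * exit_deriv 1 f v e.
  move=> ev; have l0 := len_gt0 e.
  have H0 : (0 : R) <= 0 <= len e by rewrite lexx ltW.
  have [[Sf _ _] Af] := Ef.
  have D := eigen_has_deriv l0 (Sf e) (Af e).
  (* [w] is the derivative along the edge as read from [v]; from the target end it is reflected and
     changes sign. *)
  suff [w Hw] : exists w, forall t, 0 <= t <= len e -> has_deriv (len e) (u e) t (w t) /\
      has_deriv (len e) w t (- lam * u e t).
    have [E1 E2] := nderiv_eigen l0 Hw j H0.
    have [_ E3] := nderiv_eigen l0 Hw 0 H0.
    rewrite /exit_deriv E1 E2 (_ : 1%N = (0 : nat).*2.+1)// E3 expr0 mul1r.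
    by rewrite /u /= shift_point0.
  rewrite /u (shift_pointE _ ev); case: ifP => _.
    by exists (deriv_in (len e) (edge_fun f e)).
  exists (fun t => - deriv_in (len e) (edge_fun f e) (len e - t)) => t tl.
  have tl' : 0 <= len e - t <= len e by lra.
  have [D1 D2] := D _ tl'; split; first exact: has_deriv_reflect.
  have := @has_derivZ R _ (-1) _ _ _ (has_deriv_reflect D2).
  rewrite mulN1r opprK => H; apply: has_deriv_ext H => //.
  by move=> s _; rewrite mulN1r.
have [j ->|j ->] : odd_or_even_spec i by exact: odd_or_evenP.
  rewrite /kirchhoff odd_double => e e' ev ev'.
  by rewrite (E j e ev).1 (E j e' ev').1.
rewrite /kirchhoff /= odd_double /=.
rewrite (eq_bigr (fun e => (- lam) ^+ j * exit_deriv 1 f v e)).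
  rewrite -mulr_sumr; have [[_ _ k1] _] := Ef.
  by have := k1 v; rewrite /kirchhoff /= => ->; rewrite mulr0.
by move=> e ev; rewrite (E j e ev).2.
Qed.

(** The weak form of the eigenvalue equation, with a single derivative on [f]. Boundary terms pair
    the values of [f], common to the edges at a vertex, with first exit derivatives of [phi], which
    sum to zero there. *)
Lemma eigen_parts lam f (phi : gpoint G -> R) (g : edge G -> R -> R) : laplace_eigen lam phi ->
  edge_H1 (edge_fun f) g ->
  edge_ip g (nderiv_graph 1 phi) = lam * inner_L2 f phi.
Proof.
move=> Ep Hf.
have S := eigen_smooth Ep.
have H2 : edge_H1 (nderiv_graph 1 phi) (fun e t => - lam * edge_fun phi e t).
  move=> e; apply: H1_segment_smooth; first exact/ltW/len_gt0.
    move=> t tl; have := S e 1%N t tl.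
    by rewrite -[nderiv_in _ 2 _ _]/(nderiv_graph 1.*2 phi e t) (nderiv_eigen_even _ Ep tl) expr1.
  apply: (@has_deriv_within_continuous R _ _ (fun t => - lam * nderiv_graph 1 phi e t)) => t tl.
  exact: (@has_derivZ R _ (- lam) _ _ _ (S e 0%N t tl)).
have LN : edge_L2 (fun e t => - lam * edge_fun phi e t) := edge_H1_L2d H2.
have : \sum_e \int[mu]_(t in `[0, len e])
   (g e t * nderiv_graph 1 phi e t + edge_fun f e t * (- lam * edge_fun phi e t)) = 0.
  rewrite -[RHS](@kirchhoff_boundary R G 0 1 f phi)//.
  - apply: eq_bigr => e _; have l0 := ltW (len_gt0 e).
    by rewrite (H1_segment_parts l0 (Hf e) (H2 e)) ?l0 ?lexx.
  - by move=> e; split=> //; case: (Hf e) => /abs_continuous_continuous.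
  - by move=> e; exact: smooth_Cm_segment.
  - by move=> v; exact: kirchhoff0.
  - by move=> v; exact: eigen_kirchhoff Ep.
have Lf := edge_H1_L2 Hf; have Lg := edge_H1_L2d Hf.
have Lp := edge_H1_L2 (eigen_edge_H1 Ep); have Lp' := edge_H1_L2d (eigen_edge_H1 Ep).
rewrite (eq_bigr (fun e => \int[mu]_(t in `[0, len e]) (g e t * nderiv_graph 1 phi e t) +
   \int[mu]_(t in `[0, len e]) (edge_fun f e t * (- lam * edge_fun phi e t)))); last first.
  move=> e _; apply: RintegralD; first exact: measurable_itvR.
  - exact: L2_segment_mul.
  - exact: L2_segment_mul.
rewrite big_split/= -[X in X + _]/(edge_ip g (nderiv_graph 1 phi)).
rewrite -[X in _ + X]/(edge_ip (edge_fun f) (fun e t => - lam * edge_fun phi e t)).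
rewrite edge_ipC (edge_ipC (edge_fun f)) edge_ipZ// mulNr edge_ipC => /eqP.
by rewrite subr_eq0 => /eqP ->; rewrite edge_ipC.
Qed.

(** All [p] derivatives move from [f] to the smooth [phi], one at a time. In the end [phi] carries
    [2p] of them, and [(-1)^p (- lam)^p = lam^p]. *)
Lemma in_F_parts p lam f (phi : gpoint G -> R) : laplace_eigen lam phi -> (1 <= p)%N ->
  Cm_graph p.-1 f -> (forall e, sobolev_segment (len e) p (edge_fun f e)) ->
  inner_F p f phi = lam ^+ p * inner_L2 f phi.
Proof.
move=> Ep p0 [Cf Kf] Sf.
have S := eigen_smooth Ep.
have Hf i : (i < p)%N -> edge_H1 (nderiv_graph i f) (nderiv_graph i.+1 f).
  by move=> ip e; exact: sobolev_H1_segment (len_gt0 e) (Sf e) ip.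
have Hp i : edge_H1 (nderiv_graph i phi) (nderiv_graph i.+1 phi).
  by move=> e; exact: smooth_H1_segment i (ltW (len_gt0 e)) (S e).
have step j : (j <= p)%N ->
   edge_ip (nderiv_graph p f) (nderiv_graph p phi) =
   (-1) ^+ j * edge_ip (nderiv_graph (p - j) f) (nderiv_graph (p + j) phi).
  elim: j => [|j IH] jp; first by rewrite subn0 addn0 expr0 mul1r.
  rewrite (IH (ltnW jp)) exprSr -mulrA mulN1r; congr (_ * _).
  set i := (p - j.+1)%N.
  have Ei : (p - j = i.+1)%N by rewrite /i subnSK.
  have ip : (i < p)%N by rewrite /i ltn_subrL.
  rewrite Ei addnS; apply/eqP; rewrite -addr_eq0; apply/eqP.
  rewrite /edge_ip /integral_graph -big_split/=.
  (* Order [p - j - 1] of [f], at most [p.-1] and so covered by its Kirchhoff conditions, meets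
     order [p + j] of [phi]; the total [2p - 1] is odd. *)
  rewrite -[RHS](@kirchhoff_boundary R G i (p + j) f phi).
  - apply: eq_bigr => e _; have l0 := ltW (len_gt0 e).
    rewrite -RintegralD.
    + by rewrite (H1_segment_parts l0 (Hf i ip e) (Hp _ e)) ?l0 ?lexx.
    + exact: measurable_itvR.
    + exact: L2_segment_mul (edge_H1_L2d (Hf i ip) e) (edge_H1_L2 (Hp _) e).
    + exact: L2_segment_mul (edge_H1_L2 (Hf i ip) e) (edge_H1_L2d (Hp _) e).
  - rewrite /i; have -> : (p - j.+1 + (p + j) = (p + (p - 1)))%N by lia.
    have -> : (p + (p - 1) = p.-1.*2.+1)%N by lia.
    by rewrite /= odd_double.
  - move=> e; have [C1 C2] := Cf e.
    have ip1 : (i <= p.-1)%N by rewrite -ltnS prednK.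
    split; last exact: Cm_segment_continuous (len_gt0 e) (Cf e) ip1.
    by move=> k t ki; apply: C1; exact: leq_trans ki ip1.
  - by move=> e; exact: smooth_Cm_segment.
  - by move=> v; apply: Kf; rewrite -ltnS prednK.
  - by move=> v; exact: eigen_kirchhoff Ep.
rewrite -[LHS]/(edge_ip (nderiv_graph p f) (nderiv_graph p phi)) (step p (leqnn p)).
rewrite subnn addnn.
rewrite (@eq_edge_ip _ (edge_fun f) _ (fun e t => (- lam) ^+ p * edge_fun phi e t))//; last first.
  by move=> e t tl; exact: nderiv_eigen_even Ep tl.
rewrite edge_ipC edge_ipZ; last 2 first.
- exact: edge_H1_L2 (eigen_edge_H1 Ep).
- exact: edge_H1_L2 (Hf 0%N p0).
by rewrite mulrA -exprMn mulN1r opprK edge_ipC.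
Qed.
End graph_inner_product.

(** * Eigenfunction expansion of the reproducing kernel *)

Section real_sequences.
Context {R : realType}.
Implicit Types (u v : nat -> R) (l : R).

Lemma eventually_eq_cvg n0 u v l : (forall n, (n0 <= n)%N -> u n = v n) ->
  u n @[n --> \oo] --> l -> v n @[n --> \oo] --> l.
Proof.
by move=> uv; apply: cvg_trans; apply: near_eq_cvg; exists n0 => // n /= /uv.
Qed.

Lemma cvg_sumr (I : Type) (s : seq I) (F : I -> nat -> R) (L : I -> R) :
  (forall i, F i n @[n --> \oo] --> L i) ->
  \sum_(i <- s) F i n @[n --> \oo] --> \sum_(i <- s) L i.
Proof.
move=> FL; elim: s => [|i s IH].
  rewrite big_nil; apply: (@eventually_eq_cvg 0%N (fun=> 0)); last exact: cvg_cst.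
  by move=> n _; rewrite big_nil.
rewrite big_cons; apply: (@eventually_eq_cvg 0%N (fun n => F i n + \sum_(i <- s) F i n)).
  by move=> n _; rewrite big_cons.
by apply: cvgD => //; exact: FL.
Qed.

Lemma squeeze_norm_cvg (u v : nat -> R) l : (forall n, `|u n - l| <= v n) ->
  v n @[n --> \oo] --> (0 : R) -> u n @[n --> \oo] --> l.
Proof.
move=> uv /cvgrPdist_le v0; apply/cvgrPdist_le => e e0.
have [n0 _ H] := v0 e e0; exists n0 => // n n0n.
rewrite distrC (le_trans (uv n))// (le_trans (ler_norm _))//.
by have := H n n0n; rewrite sub0r normrN.
Qed.
End real_sequences.

(** * Eigenbases: pointwise expansion, centring and kernel coefficients *)

Section eigenfunction_expansion.
Context {R : realType} (G : metric_graph R).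
Variables (phi : nat -> gpoint G -> R) (lam : nat -> R).
Hypothesis hphi : laplace_eigenbasis phi lam.
Local Notation mu := (@lebesgue_measure R).
Local Notation D k := (nderiv_graph 1 (phi k)).
Implicit Types (f : gpoint G -> R) (g : edge G -> R -> R) (x y : gpoint G).

Lemma edge_ip_sq_addZ (F H : edge G -> R -> R) (c : R) : edge_L2 F -> edge_L2 H ->
  edge_ip (fun e t => F e t + c * H e t) (fun e t => F e t + c * H e t) =
  edge_ip F F + 2 * c * edge_ip F H + c ^+ 2 * edge_ip H H.
Proof.
move=> LF LH; have LcH := edge_L2Z c LH; have L := edge_L2D LF LcH.
rewrite edge_ipD// (edge_ipZ _ LH)// (edge_ipC F) (edge_ipC H) !edge_ipD// !edge_ipZ//.
by rewrite (edge_ipC H F); ring.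
Qed.

Lemma basis_eigen k : laplace_eigen (lam k) (phi k).
Proof. by case: hphi. Qed.

Lemma basis_ip j k : edge_ip (edge_fun (phi j)) (edge_fun (phi k)) = (j == k)%:R.
Proof. by case: hphi => [[_ H _] _ _ _ _]; exact: H. Qed.

Lemma lam_gt0 k : (0 < k)%N -> 0 < lam k.
Proof. by case: hphi => _ _ [_ l1] Hl _ k0; apply: lt_le_trans l1 _; exact: Hl. Qed.

Lemma lam_ge0 k : 0 <= lam k.
Proof. by case: k => [|k]; [case: hphi => _ _ [-> _] | rewrite ltW// lam_gt0]. Qed.

Lemma basis_edge_H1 k : edge_H1 (edge_fun (phi k)) (D k).
Proof. exact: eigen_edge_H1 (basis_eigen k). Qed.

Lemma basis_deriv_ip j k : edge_ip (D j) (D k) = lam k * (j == k)%:R.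
Proof.
by rewrite (eigen_parts (basis_eigen k) (basis_edge_H1 j)) -basis_ip.
Qed.

Lemma basis_sum_ip (F : nat -> edge G -> R -> R) (w a b : nat -> R) N :
  (forall k, edge_L2 (F k)) ->
  (forall j k, edge_ip (F j) (F k) = w k * (j == k)%:R) ->
  edge_ip (fun e t => \sum_(k < N) a k * F k e t)
          (fun e t => \sum_(k < N) b k * F k e t) = \sum_(k < N) a k * b k * w k.
Proof.
move=> LF HF; rewrite edge_ip_sum//; last exact: edge_L2_sum.
apply: eq_bigr => k _; rewrite edge_ipC edge_ip_sum// -mulrA; congr (_ * _).
rewrite (bigD1 k)//= HF eqxx mulr1 big1 ?addr0// => j jk.
by rewrite HF (_ : (j == k :> nat) = false) ?mulr0 ?mulr0//; exact/negbTE.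
Qed.

(** Bessel's inequality for derivatives: the derivatives of the [phi k] are orthogonal with squared
    norms [lam k], and [g] has pairing [lam k * inner_L2 f (phi k)] with them. *)
Lemma remainder_deriv_le f g N : edge_H1 (edge_fun f) g ->
  let r e t := g e t + (-1) * \sum_(k < N) inner_L2 f (phi k) * D k e t in
  edge_ip r r <= edge_ip g g.
Proof.
move=> Hf; cbv zeta; have Lg := edge_H1_L2d Hf.
have LD k : edge_L2 (D k) := edge_H1_L2d (basis_edge_H1 k).
have LS := edge_L2_sum N (fun k => inner_L2 f (phi k)) LD.
have E := basis_sum_ip (fun k => inner_L2 f (phi k)) (fun k => inner_L2 f (phi k)) N LD
  basis_deriv_ip.
cbv beta in E; rewrite (edge_ip_sq_addZ (-1) Lg LS) E.
have E2 := @edge_ip_sum R G N (fun k => inner_L2 f (phi k)) (fun k => D k) g LD Lg.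
cbv beta in E2; rewrite (edge_ipC g) E2.
rewrite (eq_bigr (fun k : 'I_N => inner_L2 f (phi k) * inner_L2 f (phi k) * lam k)); last first.
  by move=> k _; rewrite edge_ipC (eigen_parts (basis_eigen k) Hf); ring.
have : 0 <= \sum_(k < N) inner_L2 f (phi k) * inner_L2 f (phi k) * lam k.
  by apply: sumr_ge0 => k _; rewrite mulr_ge0 ?lam_ge0// -expr2 sqr_ge0.
lra.
Qed.

(** Without edges every [inner_L2] would be an empty sum, against the unit norm of [phi 0]. *)
Lemma edge_exists : exists e : edge G, True.
Proof.
apply: contrapT => H; have := basis_ip 0 0.
rewrite /edge_ip /integral_graph big1 ?eqxx; first by move/esym/eqP; rewrite oner_eq0.
by move=> e; case: H; exists e.
Qed.

(* On an edge, [u x ^+ 2 <= (1/l + c) * ||u|| ^+ 2 + (1/c) * ||u'|| ^+ 2] for every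
   [c > 0]; here [u] is the remainder, [||u||] tends to 0 and [||u'||] is bounded. *)
Lemma expansion_cvg f g x : edge_H1 (edge_fun f) g ->
  (\sum_(k < N) inner_L2 f (phi k) * phi k x) @[N --> \oo] --> f x.
Proof.
move=> Hf; have [e0 _] := edge_exists; have [e [t [te ->]]] := gpoint_edge e0 x.
have l0 := len_gt0 e.
pose r N (y : gpoint G) := f y - \sum_(k < N) inner_L2 f (phi k) * phi k y.
have rcvg : inner_L2 (r N) (r N) @[N --> \oo] --> (0 : R).
  by case: hphi => [[_ _ H]] _ _ _ _; exact: (H f (edge_H1_L2 Hf)).
pose B := edge_ip g g; have B0 : 0 <= B := edge_ip_ge0 g.
have key (c : R) N : 0 < c ->
    r N (edge_point e t) ^+ 2 <= ((len e)^-1 + c) * inner_L2 (r N) (r N) + c^-1 * B.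
  move=> c0.
  have HS := edge_H1_sum N (fun k => inner_L2 f (phi k)) basis_edge_H1.
  have Hr := H1_segmentD (Hf e) (H1_segmentZ (-1) (ltW l0) (HS e)).
  have := H1_segment_sup l0 Hr c0 te; rewrite mulN1r -[_ - _]/(r N (edge_point e t)).
  move=> /le_trans; apply; apply: lerD.
    apply: ler_wpM2l; first by rewrite addr_ge0 ?invr_ge0// ltW.
    have := edge_ip_edge (edge_fun (r N)) e; apply: le_trans; rewrite le_eqVlt; apply/orP; left.
    by apply/eqP; apply: eq_Rintegral => s _; rewrite mulN1r.
  apply: ler_wpM2l; first by rewrite invr_ge0 ltW.
  apply: le_trans (remainder_deriv_le N Hf).
  exact: (edge_ip_edge (fun e t => g e t + (-1) * \sum_(k < N) inner_L2 f (phi k) * D k e t)).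
apply/cvgrPdist_le => /= eps eps0.
(* Makes [c^-1 * B] at most half of [eps ^+ 2]. Once [c] is fixed, the L2 norm of the remainder
   takes care of the other half. The [+ 1] keeps [c] positive when [B = 0]. *)
pose c := 2 * (B + 1) / eps ^+ 2.
have c0 : 0 < c by rewrite divr_gt0 ?exprn_gt0// mulr_gt0// ltr_wpDl.
have C0 : 0 < (len e)^-1 + c by rewrite addr_gt0// invr_gt0.
have d0 : 0 < eps ^+ 2 / 2 / ((len e)^-1 + c) by rewrite !divr_gt0// exprn_gt0.
move/cvgrPdist_le: rcvg => /(_ _ d0) [N0 _ HN]; exists N0 => // N /= N0N.
have := HN N N0N; rewrite sub0r normrN ger0_norm; last exact: (edge_ip_ge0 (edge_fun (r N))).
rewrite ler_pdivlMr// mulrC => h1; have h2 := key c N c0.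
rewrite -[leRHS](ger0_norm (ltW eps0)) -ler_sqr ?nnegrE// !real_normK ?num_real//.
apply: le_trans h2 _.
have : c^-1 * B <= eps ^+ 2 / 2.
  rewrite /c invf_div mulrAC ler_pdivrMr ?mulr_gt0 ?ltr_wpDl//.
  have e2 : 0 < eps ^+ 2 by rewrite exprn_gt0.
  rewrite (_ : eps ^+ 2 / 2 * (2 * (B + 1)) = eps ^+ 2 * B + eps ^+ 2); last by field.
  by rewrite lerDl ltW.
lra.
Qed.

Lemma cst_edge_H1 (c : R) : edge_H1 (edge_fun (fun _ : gpoint G => c)) (fun _ _ => 0).
Proof.
move=> e; apply: H1_segment_smooth; first exact/ltW/len_gt0.
  by move=> t _; exact: has_deriv_cst.
by apply: continuous_subspaceT => t; exact: cvg_cst.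
Qed.

(** The weak eigenvalue equation tested on a constant: the derivative vanishes while [lam k > 0]. *)
Lemma cst_ip_basis (c : R) k : (0 < k)%N -> inner_L2 (fun=> c) (phi k) = 0.
Proof.
move=> k0; have := eigen_parts (basis_eigen k) (cst_edge_H1 c).
rewrite {1}/edge_ip /integral_graph big1 => [/esym/eqP|e _].
  by rewrite mulf_eq0 gt_eqF ?lam_gt0//= => /eqP.
under eq_Rintegral do rewrite mul0r.
by rewrite Rintegral_cst ?mul0r//; exact: measurable_itvR.
Qed.

(** By [cst_ip_basis] the pointwise expansion of the function 1 has its only nonzero coefficient at
    index 0, so a multiple of [phi 0] equals 1 everywhere. *)
Lemma basis0_cst x y : phi 0%N x = phi 0%N y.
Proof.
pose a := inner_L2 (fun=> 1) (phi 0%N).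
have E z : a * phi 0%N z = 1.
  have := expansion_cvg (x := z) (cst_edge_H1 1).
  move=> /(cvg_lim (@Rhausdorff R)) <-; apply/esym/cvg_lim; first exact: Rhausdorff.
  apply: (@eventually_eq_cvg R 1 (fun=> a * phi 0%N z)); last exact: cvg_cst.
  move=> N N1; apply/esym.
  rewrite -(prednK N1) big_ord_recl big1 ?addr0// => i _.
  by rewrite cst_ip_basis ?mul0r.
have a0 : a != 0.
  by apply: contra_eqN (E x) => /eqP ->; rewrite mul0r eq_sym oner_eq0.
by apply: (mulfI a0); rewrite !E.
Qed.

Definition centred k x := phi k x - vertex_mean (phi k).

Lemma vertex_mean_sum f : vertex_mean f * #|vertex G|%:R = \sum_v f (inl v).
Proof.
rewrite /vertex_mean mulrC mulVKf// pnatr_eq0 -lt0n.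
exact: vertex_nonempty.
Qed.

(** Makes sums over [k >= 0] agree with sums over [k >= 1] once the eigenfunctions are centred. *)
Lemma centred0 x : centred 0 x = 0.
Proof.
apply/eqP; rewrite subr_eq0; apply/eqP.
have n0 : (#|vertex G|%:R : R) != 0 by rewrite pnatr_eq0 -lt0n; exact: vertex_nonempty.
apply: (mulIf n0); rewrite vertex_mean_sum.
by rewrite (eq_bigr (fun=> phi 0%N x)) ?sumr_const ?mulr_natr// => v _; exact: basis0_cst.
Qed.

Lemma sum_centred k : \sum_v centred k (inl v) = 0.
Proof.
rewrite sumrB sumr_const -mulr_natr vertex_mean_sum subrr//.
Qed.

Lemma inner_centred j k : (0 < k)%N -> inner_L2 (centred j) (phi k) = (j == k)%:R.
Proof.
move=> k0; rewrite -basis_ip -[RHS]addr0 -(mulr0 (-1)) -(cst_ip_basis (vertex_mean (phi j)) k0).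
have Lk := edge_H1_L2 (basis_edge_H1 k).
have Lc := edge_H1_L2 (cst_edge_H1 (vertex_mean (phi j))).
rewrite -[inner_L2 (fun=> _) _]/(edge_ip _ _) -edge_ipZ// -edge_ipD//.
- by apply: eq_edge_ip => // e t _; rewrite mulN1r.
- exact: edge_H1_L2 (basis_edge_H1 j).
- exact: edge_L2Z.
Qed.

Lemma nderiv_centred k i e :
  nderiv_graph i.+1 (centred k) e = nderiv_graph i.+1 (phi k) e.
Proof. exact: nderiv_in_subr_cst. Qed.

Lemma centred_smooth k e : smooth_segment (len e) (edge_fun (centred k) e).
Proof. exact: smooth_subr_cst (eigen_smooth (basis_eigen k) (e := e)). Qed.

Lemma centred_in_F p k : (1 <= p)%N -> in_F p (centred k).
Proof.
move=> p1; split; last exact: sum_centred.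
- split=> [e|i v _]; first exact/smooth_Cm_segment/centred_smooth.
  case: i => [|i]; first exact: kirchhoff0.
  have E e : incident e v -> exit_deriv i.+1 (centred k) v e = exit_deriv i.+1 (phi k) v e.
    move=> _; exact: (congr1 (fun h => h 0) (nderiv_in_subr_cst (len e)
      (phi k \o shift_point v e) (vertex_mean (phi k)) i)).
  have := eigen_kirchhoff i.+1 v (basis_eigen k); rewrite /kirchhoff.
  case: ifP => _ H; first by rewrite (eq_bigr _ E).
  by move=> e e' ev ev'; rewrite !E//; exact: H.
- move=> e; apply: smooth_sobolev_segment => //; first exact/ltW/len_gt0.
  exact: centred_smooth.
Qed.

Lemma inner_FC p f h : inner_F p f h = inner_F p h f.
Proof. exact: edge_ipC. Qed.

(** Since [p >= 1], derivatives of order [p] do not see constants: [K x] has the same [inner_F] with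
    [phi k] as with [centred k], which the reproducing property evaluates at [x]. [in_F_parts] turns
    this pairing into an L2 one. *)
Lemma kernel_coeff p K x k : (1 <= p)%N -> reproducing_kernel p K -> (0 < k)%N ->
  inner_L2 (K x) (phi k) = centred k x / lam k ^+ p.
Proof.
move=> p1 [FK RK] k0.
have lk : lam k ^+ p != 0 by rewrite expf_eq0 p1/= gt_eqF// lam_gt0.
have [CK SK _] := FK x.
apply: (mulIf lk); rewrite divfK// mulrC -(in_F_parts (basis_eigen k) p1 CK SK).
rewrite -(RK _ x (centred_in_F k p1)) inner_FC /inner_F.
apply: eq_bigr => e _; apply: eq_Rintegral => t _.
by case: p p1 {lk FK RK CK SK} => // p _; rewrite nderiv_centred mulrC.
Qed.

Lemma in_F_edge_H1 p f : (1 <= p)%N -> in_F p f -> edge_H1 (edge_fun f) (nderiv_graph 1 f).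
Proof.
move=> p1 [_ Sf _] e.
exact: (sobolev_H1_segment (len_gt0 e) (Sf e) (p1 : (0 < p)%N)).
Qed.

(** The pointwise expansion of [K x] involves [phi k y] and not its centred version. Subtracting the
    vertex mean of the partial sums centres every term and leaves the limit unchanged, because [K x]
    sums to zero over the vertices. *)
Theorem kernel_expansion p K x y : (1 <= p)%N -> reproducing_kernel p K ->
  covariance_sum p phi lam x y N @[N --> \oo] --> K x y.
Proof.
move=> p1 rK; have HK := in_F_edge_H1 p1 (rK.1 x).
pose a k := inner_L2 (K x) (phi k).
have E z : (\sum_(k < N) a k * phi k z) @[N --> \oo] --> K x z := expansion_cvg (x := z) HK.
have EV : (\sum_v \sum_(k < N) a k * phi k (inl v)) @[N --> \oo] --> \sum_v K x (inl v).
  by apply: cvg_sumr => v; exact: E.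
have [_ _ K0] := rK.1 x; rewrite K0 in EV.
have H : (\sum_(k < N) a k * phi k y -
    (#|vertex G|%:R)^-1 * \sum_v \sum_(k < N) a k * phi k (inl v)) @[N --> \oo] --> K x y.
  rewrite -[X in _ --> X]subr0 -[X in _ - X](mulr0 ((#|vertex G|%:R)^-1 : R)).
  by apply: cvgB; [exact: E | apply: cvgM; [exact: cvg_cst | exact: EV]].
apply: (eventually_eq_cvg (n0 := 1%N) _ H) => N N1.
rewrite /covariance_sum.
rewrite exchange_big/= mulr_sumr -sumrB.
rewrite (eq_bigr (fun k : 'I_N => a k * centred k y)); last first.
  by move=> k _; rewrite -mulr_sumr /centred /vertex_mean; ring.
rewrite -(big_mkord xpredT (fun k => a k * centred k y)) (big_ltn N1) centred0 mulr0 add0r.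
apply: eq_big_nat => k /andP[k1 _].
rewrite /a (kernel_coeff x p1 rK k1) -!/(centred k _); ring.
Qed.

Lemma variogram_sumE p x y N :
  variogram_sum p phi lam x y N = covariance_sum p phi lam x x N +
    covariance_sum p phi lam y y N - 2 * covariance_sum p phi lam x y N.
Proof.
rewrite /variogram_sum /covariance_sum mulr_sumr -big_split -sumrB/=.
by apply: eq_bigr => k _; ring.
Qed.

(* For [f := \sum_k (d_k / lam_k) phi_k] with [d_k := phi_k x - phi_k y], both
   [f x - f y] and the integral of [f' ^+ 2] equal the variogram sum. *)
Lemma variogram1_le e (t s : R) N : 0 <= t <= len e -> 0 <= s <= len e ->
  variogram_sum 1 phi lam (edge_point e t) (edge_point e s) N <= `|t - s|.
Proof.
move=> te se; set S := variogram_sum _ _ _ _ _ _.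
pose d k := phi k (edge_point e t) - phi k (edge_point e s).
(* Index 0 is set apart because [lam 0 = 0]; the variogram sum also starts at 1. *)
pose a k := if k == 0%N then 0 else d k / lam k.
have HS := edge_H1_sum N a basis_edge_H1.
have LD k : edge_L2 (D k) := edge_H1_L2d (basis_edge_H1 k).
have ES : S = \sum_(k < N) a k * d k.
  rewrite /S /variogram_sum; case: N {HS} @S => [|N]; first by rewrite big_geq ?big_ord0.
  rewrite -(big_mkord xpredT (fun k => a k * d k)) big_ltn//= [X in X + _]mul0r add0r.
  apply: eq_big_nat => -[|k] // _; rewrite /a /= -/(d k.+1) expr1 expr2; ring.
have E1 : edge_ip (fun e t => \sum_(k < N) a k * D k e t)
     (fun e t => \sum_(k < N) a k * D k e t) = S.
  have E := basis_sum_ip a a N LD basis_deriv_ip.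
  cbv beta in E; rewrite E ES; apply: eq_bigr => -[[|k] kN] _ /=.
    by rewrite /a eqxx !mul0r.
  by rewrite /a /=; field; rewrite gt_eqF// lam_gt0.
have := H1_segment_diff (ltW (len_gt0 e)) (HS e) te se.
rewrite -sumrB (eq_bigr (fun k : 'I_N => a k * d k)); last first.
  by move=> k _; rewrite /d /edge_fun; ring.
rewrite -ES; have := edge_ip_edge (fun e t => \sum_(k < N) a k * D k e t) e; rewrite E1.
(* At this point [2 * |S| <= |t - s| + S], which solves to [S <= |t - s|]. *)
have := ler_norm S; lra.
Qed.

(** Reduces to [p = 1], because [lam k >= lam 1] gives [lam k ^- p <= (lam 1 ^+ p.-1)^-1 / lam k].
    The bound is uniform in [N] and so survives the limit. *)
Lemma variogram_le p e (t s : R) N : (1 <= p)%N -> 0 <= t <= len e -> 0 <= s <= len e ->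
  variogram_sum p phi lam (edge_point e t) (edge_point e s) N <=
    (lam 1 ^+ p.-1)^-1 * `|t - s|.
Proof.
move=> p1 te se; have l1 : 0 < lam 1 by exact: lam_gt0.
apply: le_trans (ler_wpM2l _ (variogram1_le N te se)); last by rewrite invr_ge0 exprn_ge0// ltW.
rewrite mulr_sumr; apply: ler_sum_nat => k /andP[k1 _].
have lk := lam_gt0 k1.
rewrite mulrCA ler_wpM2l ?sqr_ge0// expr1 -invfM lef_pV2 ?posrE ?mulr_gt0 ?exprn_gt0//.
rewrite -{2}(prednK p1) exprS mulrC ler_pM2l//.
by apply: lerXn2r; rewrite ?nnegrE ?(ltW l1) ?(ltW lk)//; case: hphi => _ _ _ H _; exact: H.
Qed.
End eigenfunction_expansion.

(** * Characteristic functions determine laws *)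

Lemma cvg_norm_le {R : realType} (u : nat -> R) (l M : R) : (forall n, `|u n| <= M) ->
  u n @[n --> \oo] --> l -> `|l| <= M.
Proof.
move=> uM ul; have c : `|u n| @[n --> \oo] --> `|l| by exact: cvg_norm.
rewrite -(cvg_lim (@Rhausdorff R) c); apply: limr_le; last exact: nearW.
by apply/cvg_ex; exists `|l|.
Qed.

Section weighted_expectation.
Context {d : measure_display} {T : measurableType d} {R : realType}.
Variable P : probability T R.
Implicit Types (W X : T -> R) (g h : R -> R).

Lemma bounded_integrable (f : T -> R) : measurable_fun setT f ->
  (exists M : R, forall w, `|f w| <= M) -> P.-integrable setT (EFin \o f).
Proof.
move=> mf [M fM]; apply: measurable_bounded_integrable => //.
  by apply: le_lt_trans (probability_le1 P measurableT) _; rewrite ltry.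
by exists M; split; [exact: num_real | move=> x Mx w _ /=; apply: le_trans (fM w) (ltW Mx)].
Qed.

Definition weighted W X : Prop :=
  [/\ measurable_fun setT W, exists M : R, forall w, `|W w| <= M & measurable_fun setT X].

Definition bounded_measurable g : Prop :=
  measurable_fun setT g /\ exists M : R, forall x, `|g x| <= M.

(** Integration of [g] against the image under [X] of the signed measure with density [W]. The
    independence proof feeds in weights that are products of indicators with a cosine or sine of
    other variables. *)
Definition wexp W X g : R := \int[P]_w (W w * g (X w)).

Lemma weighted_integrable W X g : weighted W X -> bounded_measurable g ->
  P.-integrable setT (EFin \o (fun w => W w * g (X w))).
Proof.
move=> [mW [M WM] mX] [mg [N gN]]; apply: bounded_integrable.
  by apply: measurable_funM => //; exact: measurableT_comp.
by exists (M * N) => w; rewrite normrM ler_pM.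
Qed.

Lemma wexpD W X g h : weighted W X -> bounded_measurable g -> bounded_measurable h ->
  wexp W X (fun x => g x + h x) = wexp W X g + wexp W X h.
Proof.
move=> WX bg bh; rewrite -RintegralD//; try exact: weighted_integrable.
by apply: eq_Rintegral => w _; rewrite mulrDr.
Qed.

Lemma wexpZ W X (c : R) g : weighted W X -> bounded_measurable g ->
  wexp W X (fun x => c * g x) = c * wexp W X g.
Proof.
move=> WX bg; rewrite -RintegralZl//; last exact: weighted_integrable.
by apply: eq_Rintegral => w _; rewrite mulrCA.
Qed.

Lemma Rintegral_bounded_cvg (f_ : nat -> T -> R) (f : T -> R) (M : R) :
  (forall n, measurable_fun setT (f_ n)) -> (forall n w, `|f_ n w| <= M) ->
  (forall w, f_ n w @[n --> \oo] --> f w) ->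
  \int[P]_w f_ n w @[n --> \oo] --> \int[P]_w f w.
Proof.
move=> mf fM ff.
have mlim : measurable_fun setT f by exact: (@measurable_fun_cvg _ _ _ setT f_ f mf (fun w _ => ff w)).
have fM' w : `|f w| <= M by exact: cvg_norm_le (fM^~ w) (ff w).
apply: fine_cvg; rewrite fineK; last first.
  by apply: integrable_fin_num => //; apply: bounded_integrable => //; exists M.
apply: (@dominated_cvg _ _ _ P setT measurableT (fun n w => (f_ n w)%:E) _ (fun=> M%:E)) => //.
- by move=> n; exact/measurable_EFinP.
- by move=> w _; apply: cvg_EFin; [exact: nearW | exact: ff].
- by apply: (@bounded_integrable (fun=> M)) => //; exists `|M|.
- by move=> n w _; rewrite /= lee_fin.
Qed.

Lemma wexp_cvg W X (g_ : nat -> R -> R) g (M : R) : weighted W X ->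
  (forall n, measurable_fun setT (g_ n)) -> (forall n x, `|g_ n x| <= M) ->
  (forall x, g_ n x @[n --> \oo] --> g x) ->
  wexp W X (g_ n) @[n --> \oo] --> wexp W X g.
Proof.
move=> [mW [N WN] mX] mg gM gg.
apply: (@Rintegral_bounded_cvg (fun n w => W w * g_ n (X w)) _ (N * M)).
- by move=> n; apply: measurable_funM => //; exact: measurableT_comp.
- by move=> n w; rewrite normrM ler_pM.
- by move=> w; apply: cvgM; [exact: cvg_cst | exact: gg].
Qed.
End weighted_expectation.

(** * Trigonometric polynomials approximating the sign function *)

Section trigonometric_functions.
Context {R : realType}.
Implicit Types (f g : R -> R) (a b c t x : R).

(** The linear span of all cosines and sines, with arbitrary real frequencies: the functions whose
    expectations a characteristic function determines by linearity alone. *)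
Inductive trig : (R -> R) -> Prop :=
| trig_cos a : trig (fun x => cos (a * x))
| trig_sin a : trig (fun x => sin (a * x))
| trigD f g : trig f -> trig g -> trig (fun x => f x + g x)
| trigZ c f : trig f -> trig (fun x => c * f x).

Lemma trig_bounded_measurable f : trig f -> bounded_measurable f.
Proof.
have mc (h : R -> R) a : continuous h -> measurable_fun setT (fun x => h (a * x)).
  move=> ch; apply: continuous_measurable_fun => x.
  by apply: (@continuous_comp _ _ _ ( *%R a) h); [exact: mulrl_continuous | exact: ch].
elim=> {f} [a|a|f g _ [mf [M fM]] _ [mg [N gN]]|c f _ [mf [M fM]]]; split.
- exact: (mc cos a (@continuous_cos R)).
- by exists 1 => x; rewrite norm_cos_le1.
- exact: (mc sin a (@continuous_sin R)).
- by exists 1 => x; rewrite norm_sin_le1.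
- exact: measurable_funD.
- by exists (M + N) => x; rewrite (le_trans (ler_normD _ _))// lerD.
- exact: measurable_funM.
- by exists (`|c| * M) => x; rewrite normrM ler_wpM2l.
Qed.

(** The product-to-sum formulas make the span an algebra, hence stable under polynomial maps such as
    [sgn_step]. *)
Lemma trigM f g : trig f -> trig g -> trig (fun x => f x * g x).
Proof.
have cc a b : (fun x : R => cos (a * x) * cos (b * x)) =
    (fun x => 2^-1 * (cos ((a + b) * x) + cos ((a - b) * x))).
  by apply/funext => x; rewrite [(a + b) * x]mulrDl [(a - b) * x]mulrBl (cosD (a * x) (b * x)) (cosB (a * x) (b * x)); lra.
have ss a b : (fun x : R => sin (a * x) * sin (b * x)) =
    (fun x => 2^-1 * (cos ((a - b) * x) + (-1) * cos ((a + b) * x))).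
  by apply/funext => x; rewrite [(a + b) * x]mulrDl [(a - b) * x]mulrBl (cosD (a * x) (b * x)) (cosB (a * x) (b * x)); lra.
have sc a b : (fun x : R => sin (a * x) * cos (b * x)) =
    (fun x => 2^-1 * (sin ((a + b) * x) + sin ((a - b) * x))).
  by apply/funext => x; rewrite [(a + b) * x]mulrDl [(a - b) * x]mulrBl (sinD (a * x) (b * x)) (sinB (a * x) (b * x)); lra.
move=> tf; elim: tf g => {f} [a|a|f h _ IHf _ IHh|c f _ IH] g tg; last 2 first.
- rewrite (_ : (fun x => _) = (fun x => f x * g x + h x * g x)).
    by apply: trigD; [exact: IHf | exact: IHh].
  by apply/funext => x; rewrite mulrDl.
- rewrite (_ : (fun x => _) = (fun x => c * (f x * g x))); first exact/trigZ/IH.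
  by apply/funext => x; rewrite mulrA.
- elim: tg => {g} [b|b|g h _ IHg _ IHh|c g _ IH].
  + by rewrite cc; do 2 constructor; constructor.
  + rewrite (_ : (fun x => _) = (fun x : R => sin (b * x) * cos (a * x))).
      by rewrite sc; do 2 constructor; constructor.
    by apply/funext => x; rewrite mulrC.
  + rewrite (_ : (fun x => _) = (fun x => cos (a * x) * g x + cos (a * x) * h x)).
      by constructor.
    by apply/funext => x; rewrite mulrDr.
  + rewrite (_ : (fun x => _) = (fun x => c * (cos (a * x) * g x))); first by constructor.
    by apply/funext => x; rewrite mulrCA.
- elim: tg => {g} [b|b|g h _ IHg _ IHh|c g _ IH].
  + by rewrite sc; do 2 constructor; constructor.
  + by rewrite ss; do 2 constructor; [|constructor]; constructor.
  + rewrite (_ : (fun x => _) = (fun x => sin (a * x) * g x + sin (a * x) * h x)).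
      by constructor.
    by apply/funext => x; rewrite mulrDr.
  + rewrite (_ : (fun x => _) = (fun x => c * (sin (a * x) * g x))); first by constructor.
    by apply/funext => x; rewrite mulrCA.
Qed.

Lemma trig_cst c : trig (fun=> c).
Proof.
rewrite (_ : (fun=> c) = (fun x => c * cos (0 * x))); first by do 2 constructor.
by apply/funext => x; rewrite mul0r cos0 mulr1.
Qed.

Lemma trig_sin_shift a b : trig (fun x => sin (a * (x - b))).
Proof.
rewrite (_ : (fun x => _) = (fun x => cos (a * b) * sin (a * x) +
   (- sin (a * b)) * cos (a * x))).
  by constructor; constructor; constructor.
by apply/funext => x; rewrite mulrBr sinB; ring.
Qed.

(* The odd map [u |-> (3u - u^3)/2] preserves [-1, 1], and its iterates converge
   to the sign there. *)
Definition sgn_step (u : R) : R := 2^-1 * (u * (3 + (-1) * (u * u))).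

Lemma trig_sgn_iter n f : trig f -> trig (fun x => iter n sgn_step (f x)).
Proof.
move=> tf; elim: n => [//|n IH] /=.
apply: trigZ; apply: trigM => //; apply: trigD; first exact: trig_cst.
by apply: trigZ; exact: trigM.
Qed.

Lemma sgn_iterN n (u : R) : iter n sgn_step (- u) = - iter n sgn_step u.
Proof. by elim: n => //= n ->; rewrite /sgn_step; ring. Qed.

Lemma sgn_iter0 n : iter n sgn_step 0 = 0.
Proof. by elim: n => //= n ->; rewrite /sgn_step mul0r mulr0. Qed.

(** On ]0, 1] a step increases [v] and multiplies its gap to 1 by
    [(1 - v) (2 + v) / 2 <= 1 - v / 2]. As the iterates stay above [u], this factor is at most
    [1 - u / 2]. *)
Lemma sgn_iter_bound n (u : R) : 0 < u <= 1 ->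
  u <= iter n sgn_step u <= 1 /\ 1 - iter n sgn_step u <= (1 - u / 2) ^+ n.
Proof.
move=> /andP[u0 u1]; elim: n => [|n [/andP[un n1] IH]] /=.
  by rewrite lexx u1 expr0; split=> //; lra.
set v := iter n sgn_step u in un n1 IH *.
have v0 : 0 < v by exact: lt_le_trans un.
have E : 1 - sgn_step v = (1 - v) * ((1 - v) * (2 + v) / 2) by rewrite /sgn_step; field.
have E2 : sgn_step v - v = v * (1 - v) * (1 + v) / 2 by rewrite /sgn_step; field.
have h1 : 0 <= sgn_step v - v by rewrite E2 divr_ge0// !mulr_ge0//; lra.
have h2 : 0 <= 1 - sgn_step v by rewrite E !mulr_ge0//; lra.
split; first by lra.
rewrite exprSr E ler_pM//; first lra; first by rewrite !mulr_ge0//; lra.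
by nra.
Qed.

Lemma sgn_iter_norm n (u : R) : `|u| <= 1 -> `|iter n sgn_step u| <= 1.
Proof.
move=> u1; have [u0|u0|u0] := ltgtP 0 u.
- have u01 : 0 < u <= 1 by rewrite u0 -(ger0_norm (ltW u0)).
  have [/andP[h1 h2] _] := sgn_iter_bound n u01.
  by rewrite ger0_norm// (le_trans _ h1)// ltW.
- have u01 : 0 < - u <= 1 by rewrite oppr_gt0 u0 -(ler0_norm (ltW u0)).
  have [/andP[h1 h2] _] := sgn_iter_bound n u01.
  rewrite -normrN -sgn_iterN ger0_norm// (le_trans _ h1)//; lra.
- by rewrite -u0 sgn_iter0 normr0.
Qed.

Lemma sgn_iter_cvg (u : R) : `|u| <= 1 -> iter n sgn_step u @[n --> \oo] --> Num.sg u.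
Proof.
have pos (v : R) : 0 < v <= 1 -> iter n sgn_step v @[n --> \oo] --> (1 : R).
  move=> v01; have := v01 => /andP[v0 v1].
  apply: (@squeeze_cvgr _ _ _ _ (fun n => 1 - (1 - v / 2) ^+ n) (fun=> 1)).
  - by apply: nearW => n; have [/andP[_ ->] h] := sgn_iter_bound n v01; rewrite andbT; lra.
  - rewrite -[X in _ --> X]subr0; apply: cvgB; first exact: cvg_cst.
    by apply: cvg_expr; rewrite ger0_norm; lra.
  - exact: cvg_cst.
move=> u1; have [u0|u0|u0] := ltgtP 0 u.
- by rewrite gtr0_sg//; apply: pos; rewrite u0 -(ger0_norm (ltW u0)).
- rewrite ltr0_sg// -[u]opprK; under eq_fun do rewrite sgn_iterN.
  by apply: cvgN; apply: pos; rewrite oppr_gt0 u0 -(ler0_norm (ltW u0)).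
- rewrite -u0 sgr0; under eq_fun do rewrite sgn_iter0; exact: cvg_cst.
Qed.
End trigonometric_functions.

(** * Agreement of weighted laws with equal characteristic functions *)

Section uniqueness.
Context {d1 d2 : measure_display} {T1 : measurableType d1} {T2 : measurableType d2}.
Context {R : realType} (P1 : probability T1 R) (P2 : probability T2 R).
Variables (W1 X1 : T1 -> R) (W2 X2 : T2 -> R).
Hypotheses (WX1 : weighted W1 X1) (WX2 : weighted W2 X2).
Implicit Types (g h : R -> R) (b c x : R).

Definition wexp_agree g : Prop :=
  bounded_measurable g /\ wexp P1 W1 X1 g = wexp P2 W2 X2 g.

Lemma wexp_agreeD g h : wexp_agree g -> wexp_agree h -> wexp_agree (fun x => g x + h x).
Proof.
move=> [bg Eg] [bh Eh]; split; last by rewrite !wexpD// Eg Eh.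
case: bg bh => mg [M gM] [mh [N hN]]; split; first exact: measurable_funD.
by exists (M + N) => x; rewrite (le_trans (ler_normD _ _))// lerD.
Qed.

Lemma wexp_agreeZ c g : wexp_agree g -> wexp_agree (fun x => c * g x).
Proof.
move=> [bg Eg]; split; last by rewrite !wexpZ// Eg.
case: bg => mg [M gM]; split; first exact: measurable_funM.
by exists (`|c| * M) => x; rewrite normrM ler_wpM2l.
Qed.

Lemma wexp_agree_cvg (g_ : nat -> R -> R) g (M : R) : (forall n, wexp_agree (g_ n)) ->
  (forall n x, `|g_ n x| <= M) -> (forall x, g_ n x @[n --> \oo] --> g x) -> wexp_agree g.
Proof.
move=> ag gM gg.
have mg n : measurable_fun setT (g_ n) by have [[]] := ag n.
split.
  split; first exact: (@measurable_fun_cvg _ _ _ setT g_ g mg (fun x _ => gg x)).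
  by exists M => x; exact: cvg_norm_le (gM^~ x) (gg x).
have c1 : wexp P1 W1 X1 (g_ n) @[n --> \oo] --> wexp P1 W1 X1 g by exact: wexp_cvg WX1 mg gM gg.
have c2 : wexp P2 W2 X2 (g_ n) @[n --> \oo] --> wexp P2 W2 X2 g by exact: wexp_cvg WX2 mg gM gg.
rewrite -(cvg_lim (@Rhausdorff R) c1) -(cvg_lim (@Rhausdorff R) c2).
by under eq_fun do rewrite (ag _).2.
Qed.

Hypothesis eq_cos : forall t, wexp P1 W1 X1 (fun x => cos (t * x)) =
  wexp P2 W2 X2 (fun x => cos (t * x)).
Hypothesis eq_sin : forall t, wexp P1 W1 X1 (fun x => sin (t * x)) =
  wexp P2 W2 X2 (fun x => sin (t * x)).

Let agree_trig g : trig g -> wexp_agree g.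
Proof.
move=> tg; split; first exact: trig_bounded_measurable.
elim: tg => {g} [a|a|g h tg IHg th IHh|c g tg IH]; [exact: eq_cos|exact: eq_sin| |].
  by rewrite !wexpD ?IHg ?IHh//; exact: trig_bounded_measurable.
by rewrite !wexpZ ?IH//; exact: trig_bounded_measurable.
Qed.

Let norm_sg_le1 x : `|Num.sg x| <= 1.
Proof. by rewrite normr_sg lern1; case: (_ != 0). Qed.

Let agree_sg_sin (a b : R) : wexp_agree (fun x => Num.sg (sin (a * (x - b)))).
Proof.
have sin1 x : `|sin (a * (x - b))| <= 1 by exact: norm_sin_le1.
apply: (@wexp_agree_cvg (fun n x => iter n sgn_step (sin (a * (x - b)))) _ 1).
- by move=> n; apply: agree_trig; apply: trig_sgn_iter; exact: trig_sin_shift.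
- by move=> n x; exact: sgn_iter_norm.
- by move=> x; exact: sgn_iter_cvg.
Qed.

(** A square wave stretched to infinity: for each [x], once n is large the argument of the sine is
    smaller than pi in absolute value, so the sine has the sign of [x - b]. *)
Let agree_sg b : wexp_agree (fun x => Num.sg (x - b)).
Proof.
apply: (@wexp_agree_cvg (fun n x => Num.sg (sin (n.+1%:R^-1 * (x - b)))) _ 1).
- by move=> n; exact: agree_sg_sin.
- by move=> n x; exact: norm_sg_le1.
move=> x.
have [n0 Hn0] : exists n0 : nat, `|x - b| < n0%:R.
  by exists (Num.trunc `|x - b|).+1; rewrite truncnS_gt.
apply: (@cvg_trans _ ((fun=> Num.sg (x - b)) @ \oo)); last exact: cvg_cst.
apply: near_eq_cvg; exists n0 => // n /= n0n.
have n1 : 0 < n.+1%:R^-1 :> R by rewrite invr_gt0.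
have small : n.+1%:R^-1 * `|x - b| < pi.
  apply: (@lt_trans _ _ 1); last by apply: lt_le_trans (pi_ge2 R); lra.
  rewrite mulrC ltr_pdivrMr// mul1r (lt_le_trans Hn0)// ler_nat.
  exact: leq_trans n0n _.
have [xb|xb|xb] := ltgtP 0 (x - b).
- rewrite !gtr0_sg//; apply: sin_gt0_pi; rewrite mulr_gt0//=.
  by move: small; rewrite (gtr0_norm xb).
- rewrite !ltr0_sg// -oppr_gt0 -sinN -mulrN; apply: sin_gt0_pi.
  by rewrite mulr_gt0 ?oppr_gt0//=; move: small; rewrite (ltr0_norm xb).
- by rewrite -xb mulr0 sin0.
Qed.

(** Shifting the jump slightly to the right of [b] settles the tie at [x = b]: the signs tend to 1
    for [x > b] and to -1 otherwise, and the indicator is an affine image of this limit. *)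
Let agree_ray b : wexp_agree \1_`]b, +oo[.
Proof.
have H : wexp_agree (fun x => if b < x then 1 else -1).
  apply: (@wexp_agree_cvg (fun n x => Num.sg (x - (b + n.+1%:R^-1))) _ 1).
  - by move=> n; exact: agree_sg.
  - by move=> n x; exact: norm_sg_le1.
  move=> x; case: ltP => bx; last first.
    apply: (@cvg_trans _ ((fun=> -1 : R) @ \oo)); last exact: cvg_cst.
    apply: near_eq_cvg; apply: nearW => n; rewrite ltr0_sg//.
    by rewrite subr_lt0 ltr_pwDr// invr_gt0.
  have xb : 0 < x - b by rewrite subr_gt0.
  have [n0 Hn0] : exists n0 : nat, (x - b)^-1 < n0%:R.
    by exists (Num.trunc (x - b)^-1).+1; rewrite truncnS_gt.
  apply: (@cvg_trans _ ((fun=> 1 : R) @ \oo)); last exact: cvg_cst.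
  apply: near_eq_cvg; exists n0 => // n /= n0n; rewrite gtr0_sg//.
  rewrite subr_gt0 -ltrBrDl.
  rewrite invf_plt ?posrE// (lt_le_trans Hn0)// ler_nat.
  exact: leq_trans n0n _.
rewrite (_ : \1_ _ = (fun x => 2^-1 * ((if b < x then 1 else -1) + 1))).
  by apply: wexp_agreeZ; apply: wexp_agreeD => //; apply: agree_trig; exact: trig_cst.
apply/funext => x; rewrite indicE mem_setE in_itv/= andbT.
by case: (b < x) => /=; lra.
Qed.

(** Open rays form a pi-system generating the Borel sets, and the sets whose indicators have equal
    weighted expectations form a Dynkin class; countable disjoint unions are reached by bounded
    convergence. *)
Theorem wexp_indic_unique (A : set R) : measurable A ->
  wexp P1 W1 X1 \1_A = wexp P2 W2 X2 \1_A.
Proof.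
suff H (B : set R) : (@RGenOInfty.G R).-sigma.-measurable B -> wexp_agree \1_B.
  move=> mA; apply: (H A _).2.
  by rewrite -RGenOInfty.measurableE.
apply: (@dynkin_induction _ (measurableTypeR R) (@RGenOInfty.G R) (fun B => wexp_agree \1_B)).
- exact: RGenOInfty.measurableE.
- move=> _ _ [a ->] [b ->]; exists (Num.max a b).
  by apply/seteqP; split => x /=; rewrite !in_itv/= !andbT gt_max;
    [by case=> -> -> | by move=> /andP].
- rewrite (_ : \1_ _ = fun=> 1 : R); first exact/agree_trig/trig_cst.
  by apply/funext => x; rewrite indicE in_setT.
- by move=> _ [b ->]; exact: agree_ray.
- move=> S _ HS; rewrite (_ : \1_ _ = fun x => 1 + (-1) * \1_S x).
    by apply: wexp_agreeD; [exact/agree_trig/trig_cst | exact: wexp_agreeZ].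
  by apply/funext => x; rewrite !indicE in_setC; case: (x \in S) => /=; lra.
- move=> F _ tF HF.
  have HU n : wexp_agree \1_(\big[setU/set0]_(k < n) F k).
    elim: n => [|n IH].
      rewrite big_ord0 (_ : \1_ _ = fun=> 0 : R); first exact/agree_trig/trig_cst.
      by apply/funext => x; rewrite indicE in_set0.
    rewrite big_ord_recr/= (_ : \1_ _ =
        fun x => \1_(\big[setU/set0]_(k < n) F k) x + \1_(F n) x); first exact: wexp_agreeD.
    apply/funext => x; rewrite !indicE in_setU.
    case: (boolP (x \in F n)) => [/set_mem xn|_]; last by rewrite orbF addr0.
    case: (boolP (x \in _)) => [/set_mem|_]; last by rewrite orbT add0r.
    rewrite -bigcup_mkord => -[k /= kn xk].
    have := tF k n I I; rewrite (_ : k = n) ?ltnn in kn *; last by apply: tF => //; exists x.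
    by [].
  apply: (@wexp_agree_cvg _ _ 1 HU).
    by move=> n x; rewrite indicE; case: (_ \in _); rewrite ?normr0 ?normr1 ?ler01.
  move=> x; apply: (@cvg_trans _ ((fun=> \1_(\bigcup_k F k) x : R) @ \oo)); last exact: cvg_cst.
  apply: near_eq_cvg.
  have [[k _ xk]|nx] := pselect ((\bigcup_k F k) x).
    exists k.+1 => // n /= kn; rewrite !indicE !mem_set//; last by exists k.
    by rewrite -bigcup_mkord; exists k.
  apply: nearW => n; rewrite !indicE (memNset nx) memNset//.
  by rewrite -bigcup_mkord => -[k _ xk]; apply: nx; exists k.
Qed.
End uniqueness.

(** * The normal law *)

Section integral_of_derivative.
Context {R : realType}.
Local Notation mu := (@lebesgue_measure R).

Lemma is_derive_val (f : R -> R) (x a b : R) :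
  is_derive x (1 : R) f a -> a = b -> is_derive x (1 : R) f b.
Proof. by move=> H <-. Qed.

Lemma integral_derivative_eq0 (h h' : R -> R) :
  (forall x : R, is_derive x (1 : R) h (h' x)) -> continuous h' ->
  mu.-integrable setT (EFin \o h') ->
  h n%:R @[n --> \oo] --> (0 : R) -> h (- n%:R) @[n --> \oo] --> (0 : R) ->
  \int[mu]_x h' x = 0.
Proof.
move=> dh ch' ih' hp hn.
have mh' : measurable_fun setT h' by exact: continuous_measurable_fun.
have c1 : \int[mu]_(x in `[- n%:R, n%:R]) h' x @[n --> \oo] --> (0 : R).
  have : (h n%:R - h (- n%:R)) @[n --> \oo] --> (0 - 0 : R) by exact: cvgB.
  rewrite subr0; apply: cvg_trans; apply: near_eq_cvg; exists 1%N => // n /= n1.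
  have n0 : (0 : R) < n%:R by rewrite ltr0n.
  rewrite /Rintegral (@continuous_FTC2 R h' h (- n%:R) n%:R)//.
  - by rewrite (lt_trans _ n0)// oppr_lt0.
  - exact: continuous_subspaceT.
  - have ch : continuous h.
      move=> x; apply: differentiable_continuous; apply/derivable1_diffP.
      by apply: ex_derive.
    split; first by move=> x _; apply: ex_derive.
    + by apply: cvg_at_right_filter; exact: ch.
    + by apply: cvg_at_left_filter; exact: ch.
  - by move=> x _; rewrite derive1E; apply: derive_val.
have c2 : \int[mu]_(x in `[- n%:R, n%:R]) h' x @[n --> \oo] --> \int[mu]_x h' x.
  under eq_fun do rewrite Rintegral_mkcond.
  apply: fine_cvg; rewrite fineK; last exact: integrable_fin_num.
  apply: (@dominated_cvg _ _ _ mu setT measurableT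
    (fun n x => ((h' \_ `[- n%:R, n%:R]) x)%:E) _ (fun x => `|h' x|%:E)) => //.
  - move=> n; apply/measurable_EFinP; apply/(measurable_restrictT h') => //.
    exact: measurable_funTS.
  - move=> x _; apply: cvg_EFin; first exact: nearW.
    apply: (@cvg_trans _ ((fun=> h' x) @ \oo)); last exact: cvg_cst.
    apply: near_eq_cvg; exists (Num.trunc `|x|).+1 => // n /= xn.
    rewrite patchE mem_set//= in_itv/= -ler_norml ltW//.
    by rewrite (lt_le_trans (truncnS_gt _))// ler_nat.
  - exact: (integrable_normr ih').
  - move=> n x _; rewrite /= lee_fin patchE; case: ifP => _ //.
    by rewrite normr0.
by rewrite -(cvg_lim (@Rhausdorff R) c2) (cvg_lim (@Rhausdorff R) c1).
Qed.
End integral_of_derivative.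

(** * The normal density: Stein's identity, moments, characteristic function *)

Section normal_density.
Context {R : realType} (m s : R).
Hypothesis s0 : 0 < s.
Local Notation mu := (@lebesgue_measure R).
Local Notation k := (normal_pdf m s).
Implicit Types (x t : R) (g : R -> R).

Let s_neq0 : s != 0. Proof. by rewrite gt_eqF. Qed.

Lemma normal_pdf_expR x : k x = normal_peak s * expR (- (x - m) ^+ 2 / (s ^+ 2 *+ 2)).
Proof. by rewrite normal_pdfE. Qed.

Lemma is_derive_normal_pdf x : is_derive x (1 : R) k (- ((x - m) / s ^+ 2) * k x).
Proof.
rewrite (_ : k = fun x => normal_peak s * expR (- (x - m) ^+ 2 / (s ^+ 2 *+ 2))); last first.
  by apply/funext => y; exact: normal_pdf_expR.
apply: is_derive_eq; rewrite /GRing.scale/=; field.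
by rewrite s_neq0.
Qed.

(* With [u = (x - m)^2 / (8 s^2)] the bound reads [u * exp (- 3 u) <= 1]. *)
Lemma normal_pdf_sqr_bound : exists2 C, 0 < C &
  forall x, (x - m) ^+ 2 * k x <= C * normal_pdf m (2 * s) x.
Proof.
have p1 : 0 < normal_peak s by exact: normal_peak_gt0.
have s2 : 2 * s != 0 by rewrite mulf_neq0.
have p2 : 0 < normal_peak (2 * s) by exact: normal_peak_gt0.
exists (8 * s ^+ 2 * normal_peak s / normal_peak (2 * s)).
  by rewrite divr_gt0// !mulr_gt0// exprn_gt0.
move=> x.
have -> : normal_pdf m (2 * s) x =
    normal_peak (2 * s) * expR (- (x - m) ^+ 2 / ((2 * s) ^+ 2 *+ 2)) by rewrite normal_pdfE.
rewrite normal_pdf_expR.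
set u := (x - m) ^+ 2 / (8 * s ^+ 2).
have u0 : 0 <= u by rewrite divr_ge0 ?sqr_ge0// mulr_ge0 ?sqr_ge0.
have -> : - (x - m) ^+ 2 / (s ^+ 2 *+ 2) = - u + - (3 * u) by rewrite /u; field.
have -> : - (x - m) ^+ 2 / ((2 * s) ^+ 2 *+ 2) = - u by rewrite /u; field.
have -> : (x - m) ^+ 2 = 8 * s ^+ 2 * u by rewrite /u; field.
rewrite expRD.
rewrite (_ : 8 * s ^+ 2 * normal_peak s / normal_peak (2 * s) * (normal_peak (2 * s) * expR (- u))
  = 8 * s ^+ 2 * normal_peak s * expR (- u)); last by field; rewrite gt_eqF.
rewrite (_ : 8 * s ^+ 2 * u * _ = 8 * s ^+ 2 * normal_peak s * expR (- u) *
   (u * expR (- (3 * u)))); last by ring.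
rewrite -[leRHS]mulr1; apply: ler_wpM2l.
  by rewrite !mulr_ge0 ?expR_ge0 ?sqr_ge0// ltW.
rewrite expRN -ler_pdivlMr ?invr_gt0 ?expR_gt0// invrK mul1r.
by apply: le_trans (expR_ge1Dx _); lra.
Qed.

Lemma integrable_normal_sqr : mu.-integrable setT (EFin \o (fun x => (x - m) ^+ 2 * k x)).
Proof.
have [C C0 HC] := normal_pdf_sqr_bound.
have mT := @measurable_setR R.
apply: (integrable_dominated mT _ _ (integrable_mulr mT C (integrable_normal_pdf m (2 * s)))).
  apply: measurable_funM; last exact: measurable_normal_pdf.
  by apply: measurable_funX; exact: measurable_funB.
move=> x _; rewrite ger0_norm; first exact: HC.
by rewrite mulr_ge0 ?sqr_ge0// normal_pdf_ge0.
Qed.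

Lemma integrable_normal_growth g (C : R) : measurable_fun setT g ->
  (forall x, `|g x| <= C * (1 + (x - m) ^+ 2)) ->
  mu.-integrable setT (EFin \o (fun x => g x * k x)).
Proof.
move=> mg gC.
have mT := @measurable_setR R.
have I := integrable_mulr mT C (integrable_addr mT (integrable_normal_pdf m s) integrable_normal_sqr).
apply: (integrable_dominated mT _ _ I).
  by apply: measurable_funM => //; exact: measurable_normal_pdf.
move=> x _; rewrite normrM (ger0_norm (normal_pdf_ge0 m s x)).
rewrite (_ : C * _ = C * (1 + (x - m) ^+ 2) * k x); last by ring.
by apply: ler_wpM2r; [exact: normal_pdf_ge0 | exact: gC].
Qed.

(** Since [(x - m)^2 k x] is bounded, a function of linear growth times [k] is of order
    [1 / |x - m|]. *)
Lemma normal_growth_cvg0 g (C : R) (u : nat -> R) : 0 < C ->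
  (forall x, `|g x| <= C * (1 + `|x - m|)) ->
  (forall n, n%:R - `|m| <= `|u n - m|) ->
  g (u n) * k (u n) @[n --> \oo] --> (0 : R).
Proof.
move=> C0 gC um; have [D D0 HD] := normal_pdf_sqr_bound.
have s2 : 2 * s != 0 by rewrite mulf_neq0.
pose B := 2 * C * (D * normal_peak (2 * s)).
have B0 : 0 < B by rewrite !mulr_gt0// normal_peak_gt0.
apply/cvgrPdist_le => e e0.
(* Forces [y > 1 + B / e] below: the 1 gives [1 + y <= 2 * y], the rest gives [B / y < e]. *)
exists (Num.trunc (1 + `|m| + B / e)).+1 => // n /= nN.
have hn : 1 + `|m| + B / e < n%:R.
  by rewrite (lt_le_trans (truncnS_gt _))// ler_nat.
have Be : 0 < B / e by rewrite divr_gt0.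
set y := `|u n - m|; have hy : 1 + B / e < y by have := um n; rewrite -/y; lra.
have k0 := normal_pdf_ge0 m s (u n).
rewrite sub0r normrN normrM (ger0_norm k0).
have h1 : `|g (u n)| <= 2 * C * y.
  by apply: le_trans (gC _) _; rewrite -/y -mulrA mulrCA ler_pM2l//; lra.
have h2 : y * (y * k (u n)) <= D * normal_peak (2 * s).
  have := HD (u n); rewrite -(real_normK (num_real (u n - m))) -/y expr2 -mulrA.
  move/le_trans; apply; rewrite ler_pM2l//; exact: normal_pdf_ub.
have y0 : 0 < y by lra.
have : `|g (u n)| * k (u n) <= 2 * C * (y * k (u n)).
  by rewrite mulrA ler_wpM2r.
move/le_trans; apply.
rewrite -(ler_pM2l y0) mulrCA.
apply: (@le_trans _ _ B); first by rewrite /B ler_pM2l// mulr_gt0.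
by rewrite mulrC -ler_pdivrMl// mulrC; lra.
Qed.

(** The derivative of [g * k] is [g' k - g (x - m) k / s^2], and its integral is zero because
    [g * k] vanishes at both infinities. *)
Lemma stein_identity g (g' : R -> R) (C : R) : 0 < C ->
  (forall x : R, is_derive x (1 : R) g (g' x)) -> continuous g' ->
  (forall x, `|g x| <= C * (1 + `|x - m|)) -> (forall x, `|g' x| <= C) ->
  \int[mu]_x (g' x * k x) = \int[mu]_x (g x * (x - m) * k x) / s ^+ 2.
Proof.
move=> C0 dg cg' gC g'C.
have mT := @measurable_setR R.
have cg : continuous g.
  move=> x; apply: differentiable_continuous; apply/derivable1_diffP.
  by apply: ex_derive.
have ck : continuous k by exact: continuous_normal_pdf.
have cxm : continuous (fun x : R => x - m).
  by move=> x; apply: cvgB; [exact: cvg_id | exact: cvg_cst].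
have mg' : measurable_fun setT g' by exact: continuous_measurable_fun.
have mgx : measurable_fun setT (fun x => g x * (x - m)).
  by apply: continuous_measurable_fun => x; apply: cvgM; [exact: cg | exact: cxm].
have i1 : mu.-integrable setT (EFin \o (fun x => g' x * k x)).
  apply: (integrable_normal_growth (C := C)) => // x; rewrite (le_trans (g'C x))//.
  by rewrite ler_peMr ?(ltW C0)// lerDl sqr_ge0.
have i2 : mu.-integrable setT (EFin \o (fun x => g x * (x - m) * k x)).
  apply: (integrable_normal_growth (C := 2 * C)) => // x; rewrite normrM.
  apply: le_trans (ler_wpM2r (normr_ge0 _) (gC x)) _.
  rewrite -(real_normK (num_real (x - m))); set y := `|x - m|.
  rewrite (_ : C * _ * y = C * ((1 + y) * y)); last by ring.
  rewrite (_ : 2 * C * _ = C * (2 * (1 + y ^+ 2))); last by ring.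
  by rewrite ler_pM2l//; have := sqr_ge0 (y - 1); nra.
have i2' := integrable_mulr mT (s ^+ 2)^-1 i2.
have dh (x : R) : is_derive x (1 : R) (fun x => g x * k x)
    (g' x * k x - (s ^+ 2)^-1 * (g x * (x - m) * k x)).
  have := is_derive_normal_pdf x; have := dg x => d1 d2.
  by apply: is_derive_eq; rewrite /GRing.scale/=; field; rewrite s_neq0.
have ch : continuous (fun x => g' x * k x - (s ^+ 2)^-1 * (g x * (x - m) * k x)).
  move=> x; apply: cvgB; first by apply: cvgM; [exact: cg' | exact: ck].
  apply: cvgM; first exact: cvg_cst.
  by apply: cvgM; [apply: cvgM; [exact: cg | exact: cxm] | exact: ck].
have cp : g n%:R * k n%:R @[n --> \oo] --> (0 : R).
  apply: (@normal_growth_cvg0 g C (fun n => n%:R) C0 gC) => n.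
  by apply: (le_trans _ (lerB_dist _ _)); rewrite (ger0_norm (ler0n R n)).
have cn : g (- n%:R) * k (- n%:R) @[n --> \oo] --> (0 : R).
  apply: (@normal_growth_cvg0 g C (fun n => - n%:R) C0 gC) => n.
  by apply: (le_trans _ (lerB_dist _ _)); rewrite normrN (ger0_norm (ler0n R n)).
have := integral_derivative_eq0 dh ch (integrable_subr mT i1 i2') cp cn.
by rewrite RintegralB// RintegralZl// => /eqP; rewrite subr_eq0 => /eqP ->; rewrite mulrC.
Qed.

Lemma Rintegral_normal_pdf : \int[mu]_x k x = 1.
Proof. by rewrite /Rintegral integral_normal_pdf. Qed.

Lemma normal_moment1 : \int[mu]_x ((x - m) * k x) = 0.
Proof.
have : \int[mu]_x (0 * k x) = \int[mu]_x (1 * (x - m) * k x) / s ^+ 2.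
  apply: (@stein_identity (fun=> 1) (fun=> 0) 1) => //.
  - by move=> x; exact: cvg_cst.
  - by move=> x; rewrite normr1 mul1r lerDl.
  - by move=> x; rewrite normr0 ler01.
have -> : \int[mu]_x (0 * k x) = 0.
  under eq_Rintegral do rewrite mul0r.
  by rewrite Rintegral_cst ?mul0r//; exact: measurableT.
have -> : \int[mu]_x (1 * (x - m) * k x) = \int[mu]_x ((x - m) * k x).
  by apply: eq_Rintegral => x _; rewrite mul1r.
by move/esym/eqP; rewrite mulf_eq0 invr_eq0 expf_eq0/= (negbTE s_neq0) orbF => /eqP.
Qed.

(** Stein's identity for [x - m], whose derivative is 1. *)
Lemma normal_moment2 : \int[mu]_x ((x - m) ^+ 2 * k x) = s ^+ 2.
Proof.
have d1 (x : R) : is_derive x (1 : R) (fun x : R => x - m) 1.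
  by apply: is_derive_eq; rewrite subr0.
have : \int[mu]_x (1 * k x) = \int[mu]_x ((x - m) * (x - m) * k x) / s ^+ 2.
  apply: (@stein_identity (fun x => x - m) (fun=> 1) 1) => //.
  - by move=> x; exact: cvg_cst.
  - by move=> x; rewrite mul1r lerDr.
  - by move=> x; rewrite normr1.
have -> : \int[mu]_x (1 * k x) = 1.
  by rewrite -[RHS]Rintegral_normal_pdf; apply: eq_Rintegral => x _; rewrite mul1r.
have -> : \int[mu]_x ((x - m) * (x - m) * k x) = \int[mu]_x ((x - m) ^+ 2 * k x).
  by apply: eq_Rintegral => x _; rewrite expr2.
by move=> E; rewrite -[LHS](divfK (_ : s ^+ 2 != 0)) ?expf_neq0// -E mul1r.
Qed.

Lemma integrable_bounded_normal g : measurable_fun setT g -> (forall x, `|g x| <= 1) ->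
  mu.-integrable setT (EFin \o (fun x => g x * k x)).
Proof.
move=> mg g1; apply: (integrable_normal_growth (C := 1)) => // x.
by rewrite mul1r (le_trans (g1 x))// lerDl sqr_ge0.
Qed.

Let ode_solution (f : R -> R) : (forall t : R, is_derive t (1 : R) f (- (s ^+ 2 * t) * f t)) ->
  forall t, f t = f 0 * expR (- (t ^+ 2 * s ^+ 2) / 2).
Proof.
move=> df t.
(* With this integrating factor the equation says that [h] has derivative zero. *)
pose h u := f u * expR (u ^+ 2 * s ^+ 2 / 2).
have dh (u : R) : is_derive u (1 : R) h 0.
  have d1 := df u.
  have d2 : is_derive u (1 : R) (fun u : R => u ^+ 2 * s ^+ 2 / 2) (u * s ^+ 2).
    by apply: is_derive_eq; rewrite /GRing.scale/=; field.
  have d3 := @is_derive1_comp R expR (fun u => u ^+ 2 * s ^+ 2 / 2) u _ _ (is_derive_expR _) d2.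
  by apply: (is_derive_val (is_deriveM d1 d3)); rewrite /GRing.scale/=; ring.
have E : h t = h 0 by exact: is_derive_0_is_cst.
have -> : f t = h t * expR (- (t ^+ 2 * s ^+ 2) / 2).
  by rewrite /h mulNr -mulrA -expRD subrr expR0 mulr1.
by rewrite E /h expr0n/= !mul0r expR0 mulr1.
Qed.

Let integrable_abs : mu.-integrable setT (EFin \o (fun x => `|x - m| * k x)).
Proof.
apply: (integrable_normal_growth (C := 1)).
  by apply: measurableT_comp => //; exact: measurable_funB.
move=> x; rewrite normr_id mul1r -(real_normK (num_real (x - m))).
by have := sqr_ge0 (`|x - m| - 1); have := normr_ge0 (x - m); nra.
Qed.

(* Differentiating under the integral sign and applying Stein's identity shows that
   [F u := \int f (u (x - m)) k x dx] solves [F' u = - s^2 u F u]. *)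
Lemma normal_trig f (f' : R -> R) : (forall x : R, is_derive x (1 : R) f (f' x)) ->
  (forall x : R, is_derive x (1 : R) f' (- f x)) ->
  (forall x, `|f x| <= 1) -> (forall x, `|f' x| <= 1) -> forall t,
  \int[mu]_x (f (t * (x - m)) * k x) = f 0 * expR (- (t ^+ 2 * s ^+ 2) / 2).
Proof.
move=> df df' f1 f'1 t; have mT := @measurable_setR R.
have dx (u x : R) : is_derive x (1 : R) (fun x : R => u * (x - m)) u.
  by apply: is_derive_eq; rewrite /GRing.scale/= subr0 mulr1 ?mul0r ?addr0.
have du (x u : R) : is_derive u (1 : R) (fun u : R => u * (x - m)) (x - m).
  by apply: is_derive_eq; rewrite /GRing.scale/= mulr1 ?mulr0 ?add0r ?addr0.
have cont g (g' : R -> R) : (forall x : R, is_derive x (1 : R) g (g' x)) -> continuous g.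
  move=> dg x; apply: differentiable_continuous; apply/derivable1_diffP.
  by apply: (@ex_derive _ _ _ _ _ _ _ (dg x)).
have cf u : continuous (fun x => f (u * (x - m))).
  exact: cont (fun x => @is_derive1_comp R f (fun x => u * (x - m)) x _ _ (df _) (dx u x)).
have bf u : mu.-integrable setT (EFin \o (fun x => f (u * (x - m)) * k x)).
  by apply: integrable_bounded_normal => [|x]; [exact: continuous_measurable_fun | exact: f1].
have stein u : \int[mu]_x (f' (u * (x - m)) * (x - m) * k x) =
    - (s ^+ 2 * u) * \int[mu]_x (f (u * (x - m)) * k x).
  have C0 : 0 < `|u| + 1 by rewrite ltr_wpDl.
  have /(@stein_identity _ _ _ C0) H : forall x : R, is_derive x (1 : R)
      (fun x => f' (u * (x - m))) (- f (u * (x - m)) * u).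
    by move=> x; exact: (@is_derive1_comp R f' (fun x => u * (x - m)) x _ _ (df' _) (dx u x)).
  have {H} : \int[mu]_x (- f (u * (x - m)) * u * k x) =
     \int[mu]_x (f' (u * (x - m)) * (x - m) * k x) / s ^+ 2.
    apply: H.
    - by move=> x; apply: cvgM; [apply: cvgN; exact: cf | exact: cvg_cst].
    - move=> x; apply: le_trans (f'1 _) _.
      by rewrite mulrDr mulr1; have := normr_ge0 u; have := mulr_ge0 (ltW C0) (normr_ge0 (x - m)); lra.
    - move=> x; rewrite normrM normrN (@le_trans _ _ (1 * `|u|))//; last by rewrite mul1r lerDl.
      by rewrite ler_wpM2r.
  have -> : \int[mu]_x (- f (u * (x - m)) * u * k x) =
      \int[mu]_x (- u * (f (u * (x - m)) * k x)) by apply: eq_Rintegral => x _; ring.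
  rewrite RintegralZl// => E.
  by rewrite -mulrN -mulrA E mulrC divfK// expf_neq0.
have dt (x u : R) : is_derive u (1 : R) (fun u => f (u * (x - m)) * k x)
    (f' (u * (x - m)) * (x - m) * k x).
  have d1 := @is_derive1_comp R f (fun u => u * (x - m)) u _ _ (df _) (du x u).
  by apply: (is_derive_val (is_deriveM d1 (is_derive_cst (k x) u 1))); rewrite /GRing.scale/=; ring.
have G0 (y : R) : 0 <= `|y - m| * k y by rewrite mulr_ge0// normal_pdf_ge0.
have It (u : R) : `]u - 1, u + 1[%classic u by rewrite /= in_itv/=; lra.
(* As [|f'| <= 1], the derivative in [v] has an integrable bound independent of [v], which justifies
   differentiating under the integral. *)
have bnd (v y : R) : `|partial1of2 (fun u x => f (u * (x - m)) * k x) v y| <= `|y - m| * k y.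
  rewrite partial1of2E (derive_val (is_derive := dt y v)) !normrM.
  by rewrite (ger0_norm (normal_pdf_ge0 m s y)) ler_wpM2r ?normal_pdf_ge0// ler_piMl.
have der (v y : R) : derivable (fun v : R => f (v * (y - m)) * k y) v (1 : R).
  by apply: (@ex_derive _ _ _ _ _ _ _ (dt y v)).
have F' (u : R) : is_derive u (1 : R) (fun u => \int[mu]_x (f (u * (x - m)) * k x))
    (- (s ^+ 2 * u) * \int[mu]_x (f (u * (x - m)) * k x)).
  apply: DeriveDef.
    exact: (derivable_under_integral mT (It u) (fun v _ => bf v) (fun v y _ _ => der v y)
       G0 integrable_abs (fun v y _ _ => bnd v y)).
  rewrite -derive1E (differentiation_under_integral mT (It u) (fun v _ => bf v)
     (fun v y _ _ => der v y) G0 integrable_abs (fun v y _ _ => bnd v y)) -stein.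
  by apply: eq_Rintegral => x _; rewrite partial1of2E (derive_val (is_derive := dt x u)).
rewrite (ode_solution F'); have -> : \int[mu]_x (f (0 * (x - m)) * k x) = \int[mu]_x (f 0 * k x).
  by apply: eq_Rintegral => x _; rewrite mul0r.
by rewrite RintegralZl ?Rintegral_normal_pdf ?mulr1//; exact: integrable_normal_pdf.
Qed.

Lemma normal_cos_sin t :
  \int[mu]_x (cos (t * (x - m)) * k x) = expR (- (t ^+ 2 * s ^+ 2) / 2) /\
  \int[mu]_x (sin (t * (x - m)) * k x) = 0.
Proof.
have ns x : `|- sin x : R| <= 1 by rewrite normrN norm_sin_le1.
rewrite (normal_trig (@is_derive_cos R) (fun x => is_deriveN (is_derive_sin x)) norm_cos_le1 ns).
rewrite (normal_trig (@is_derive_sin R) (@is_derive_cos R) norm_sin_le1 norm_cos_le1).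
by rewrite cos0 sin0 mul1r mul0r.
Qed.
End normal_density.

Section normal_expectation.
Context {R : realType} (m s : R).
Local Notation mu := (@lebesgue_measure R).
Local Notation k := (normal_pdf m s).

Let m_pdf : measurable_fun setT (fun x : R => (k x)%:E).
Proof. by apply/measurable_EFinP; exact: measurable_normal_pdf. Qed.

(** The density [k] and the Radon-Nikodym derivative of [normal_prob m s] have the same integral
    over every measurable set, hence agree almost everywhere. *)
Lemma ge0_integral_normal_prob (f : R -> \bar R) : measurable_fun setT f ->
  (forall x, 0 <= f x)%E ->
  (\int[normal_prob m s]_x f x = \int[mu]_x (f x * (k x)%:E))%E.
Proof.
move=> mf f0.
have dom := @normal_prob_dominates R m s.
rewrite -(Radon_Nikodym_SigmaFinite.change_of_variables dom f0 measurableT mf).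
have if_ := Radon_Nikodym_SigmaFinite.f_integrable dom.
apply: ae_eq_integral => //.
- by apply: emeasurable_funM => //; exact: measurable_int if_.
- exact: emeasurable_funM.
- apply: ae_eqe_mul2l; apply: integral_ae_eq => //.
  by move=> E _ mE; rewrite -(Radon_Nikodym_SigmaFinite.f_integral dom).
Qed.

Lemma Rintegral_normal_prob (g : R -> R) : measurable_fun setT g ->
  mu.-integrable setT (EFin \o (fun x => g x * k x)) ->
  (normal_prob m s).-integrable setT (EFin \o g) /\
  \int[normal_prob m s]_x g x = \int[mu]_x (g x * k x).
Proof.
move=> mg ig.
have mg' : measurable_fun setT (EFin \o g) by exact/measurable_EFinP.
have k0 x : (0 <= (k x)%:E)%E by rewrite lee_fin normal_pdf_ge0.
have ig' : (normal_prob m s).-integrable setT (EFin \o g).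
  apply/integrableP; split=> //.
  rewrite ge0_integral_normal_prob//; last exact: measurableT_comp.
  move/integrableP : ig => [_]; apply: le_lt_trans.
  apply: ge0_le_integral => //.
  - by move=> x _; rewrite mule_ge0.
  - by apply: emeasurable_funM => //; exact: measurableT_comp.
  - apply: measurableT_comp => //; apply/measurable_EFinP.
    by apply: measurable_funM => //; exact: measurable_normal_pdf.
  - by move=> x _; rewrite /= normrM EFinM (ger0_norm (normal_pdf_ge0 m s x)).
split=> //; rewrite /Rintegral; congr fine.
have igk : mu.-integrable setT (fun x => (g x)%:E * (k x)%:E)%E by exact: ig.
rewrite integralE ge0_integral_normal_prob//; last exact: measurable_funepos.
rewrite ge0_integral_normal_prob//; last exact: measurable_funeneg.
rewrite [RHS]integralE; congr (_ - _)%E; apply: eq_integral => x _ /=.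
  by rewrite !funeposE EFinM maxe_pMl// mul0e.
by rewrite !funenegE EFinM maxe_pMl// mul0e mulNe.
Qed.
End normal_expectation.

(** * Normal random variables through their characteristic functions *)

Section normal_law.
Context {R : realType} {d : measure_display} {T : measurableType d} (P : probability T R).
Local Notation mu := (@lebesgue_measure R).
Implicit Types (X : T -> R) (g : R -> R).

Lemma Rintegral_prob_cst (c : R) : \int[P]_w c = c.
Proof.
rewrite Rintegral_cst// -[RHS]mulr1; congr (_ * _).
exact: (congr1 fine (probability_setT P)).
Qed.

Lemma eq_law_integral (Q : {measure set (measurableTypeR R) -> \bar R}) X (f : R -> \bar R) :
  measurable_fun setT X -> (forall A, measurable A -> P (X @^-1` A) = Q A) ->
  (\int[pushforward P (X : T -> measurableTypeR R)]_x f x = \int[Q]_x f x)%E.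
Proof.
move=> mX E.
pose mX' := @isMeasurableFun.Build _ _ _ (measurableTypeR R) X mX.
pose Xm : {mfun T >-> measurableTypeR R} := HB.pack X mX'.
by apply: (@eq_measure_integral _ _ _ _ Q (pushforward P Xm)) => A mA _; exact: E.
Qed.

Lemma normal_law_integral X m v g : measurable_fun setT X -> 0 < v ->
  has_normal_law P X m v -> measurable_fun setT g ->
  mu.-integrable setT (EFin \o (fun x => g x * normal_pdf m (Num.sqrt v) x)) ->
  P.-integrable setT (EFin \o (g \o X)) /\
  \int[P]_w g (X w) = \int[mu]_x (g x * normal_pdf m (Num.sqrt v) x).
Proof.
move=> mX v0 nX mg ig.
have s0 : 0 < Num.sqrt v by rewrite sqrtr_gt0.
have [ig' <-] := Rintegral_normal_prob mg ig.
have E A : measurable A -> P (X @^-1` A) = normal_prob m (Num.sqrt v) A.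
  by move=> mA; rewrite nX// /normal_law gt_eqF.
have mg' : measurable_fun setT (EFin \o g) by exact/measurable_EFinP.
have mX2 : @measurable_fun _ _ T (measurableTypeR R) setT X := mX.
have igX : P.-integrable setT (EFin \o (g \o X)).
  apply/integrableP; split; first by apply/measurable_EFinP; exact: measurableT_comp.
  have mag : measurable_fun setT (fun x => `|(EFin \o g) x|)%E by exact: measurableT_comp.
  move/integrableP : ig' => [_]; rewrite -(eq_law_integral _ mX E).
  by rewrite (ge0_integral_pushforward mX2)// preimage_setT.
split=> //; rewrite /Rintegral; congr fine.
rewrite -(eq_law_integral _ mX E) (integral_pushforward mX2 mg')//.
Qed.

Lemma normal_law0_integral X m g : measurable_fun setT X ->
  has_normal_law P X m 0 -> measurable_fun setT g ->
  P.-integrable setT (EFin \o (g \o X)) /\ \int[P]_w g (X w) = g m.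
Proof.
move=> mX nX mg.
have E A : measurable A -> P (X @^-1` A) = \d_m A.
  by move=> mA; rewrite nX// /normal_law eqxx.
have mg' : measurable_fun setT (EFin \o g) by exact/measurable_EFinP.
have mX2 : @measurable_fun _ _ T (measurableTypeR R) setT X := mX.
have igX : P.-integrable setT (EFin \o (g \o X)).
  apply/integrableP; split; first by apply/measurable_EFinP; exact: measurableT_comp.
  have mag : measurable_fun setT (fun x => `|(EFin \o g) x|)%E by exact: measurableT_comp.
  rewrite (_ : (\int[P]_x _)%E = (\int[pushforward P (X : T -> measurableTypeR R)]_x `|(EFin \o g) x|)%E); last first.
    by rewrite (ge0_integral_pushforward mX2)// preimage_setT.
  by rewrite (eq_law_integral (Q := \d_(m : measurableTypeR R)) _ mX E) integral_dirac// diracT mul1e ltry.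
split=> //; rewrite /Rintegral.
rewrite (_ : (\int[P]_x _)%E = (\int[pushforward P (X : T -> measurableTypeR R)]_x (EFin \o g) x)%E).
  by rewrite (eq_law_integral (Q := \d_(m : measurableTypeR R)) _ mX E) integral_dirac// diracT mul1e.
by rewrite (integral_pushforward mX2 mg')// preimage_setT.
Qed.

(* [X] is centred normal with variance [v], in terms of its characteristic function. *)
Definition cgauss X (v : R) : Prop :=
  forall t, \int[P]_w cos (t * X w) = expR (- (t ^+ 2 * v) / 2) /\
            \int[P]_w sin (t * X w) = 0.

Let measurable_scale (t : R) : measurable_fun setT (fun x : R => t * x).
Proof. exact: measurable_funM. Qed.

Lemma measurable_cos_scale (t : R) : measurable_fun setT (fun x : R => cos (t * x)).
Proof.
by apply: measurableT_comp; [apply: continuous_measurable_fun; exact: continuous_cos | exact: measurable_scale].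
Qed.

Lemma measurable_sin_scale (t : R) : measurable_fun setT (fun x : R => sin (t * x)).
Proof.
by apply: measurableT_comp; [apply: continuous_measurable_fun; exact: continuous_sin | exact: measurable_scale].
Qed.

Lemma normal_law_moments X m v : measurable_fun setT X -> 0 <= v -> has_normal_law P X m v ->
  [/\ P.-integrable setT (EFin \o X), P.-integrable setT (EFin \o (fun w => X w ^+ 2)),
      \int[P]_w X w = m & \int[P]_w X w ^+ 2 = v + m ^+ 2].
Proof.
move=> mX; rewrite le_eqVlt => /predU1P[<-|v0] nX.
  have [i1 e1] := normal_law0_integral mX nX (@measurable_id _ _ setT).
  have mq : measurable_fun setT (fun x : R => x ^+ 2) by exact: measurable_funX.
  have [i2 e2] := normal_law0_integral mX nX mq.
  by split=> //; rewrite e2 add0r.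
have s0 : 0 < Num.sqrt v by rewrite sqrtr_gt0.
have mT := @measurable_setR R.
have m1 : measurable_fun setT (fun x : R => x - m) by exact: measurable_funB.
have m2 : measurable_fun setT (fun x : R => (x - m) ^+ 2) by exact: measurable_funX.
have i1 : mu.-integrable setT (EFin \o (fun x => (x - m) * normal_pdf m (Num.sqrt v) x)).
  apply: (integrable_normal_growth s0 (C := 1)) => // x.
  rewrite mul1r -(real_normK (num_real (x - m))).
  by have := sqr_ge0 (`|x - m| - 1); nra.
have [I1 E1] := normal_law_integral mX v0 nX m1 i1.
have [I2 E2] := normal_law_integral mX v0 nX m2 (integrable_normal_sqr m s0).
rewrite (normal_moment1 m s0) in E1; rewrite (normal_moment2 m s0) sqr_sqrtr ?(ltW v0)// in E2.
have Pc (c : R) : P.-integrable setT (EFin \o (fun=> c)).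
  by apply: bounded_integrable => //; exists `|c|.
have IX : P.-integrable setT (EFin \o X).
  apply: (integrable_dominated measurableT mX _ (integrable_addr measurableT (integrable_normr I1) (Pc `|m|))).
  by move=> w _ /=; rewrite -{1}(subrK m (X w)) ler_normD.
have EX : \int[P]_w X w = m.
  have : \int[P]_w (X w - m) = \int[P]_w X w - \int[P]_w m by exact: RintegralB.
  by rewrite E1 Rintegral_prob_cst => /esym/eqP; rewrite subr_eq0 => /eqP.
have IX2 : P.-integrable setT (EFin \o (fun w => X w ^+ 2)).
  apply: (integrable_dominated measurableT _ _ (integrable_addr measurableT I2
     (integrable_addr measurableT (integrable_mulr measurableT (2 * m) IX) (Pc (m ^+ 2))))).
    exact: measurable_funX.
  move=> w _ /=; rewrite ger0_norm ?sqr_ge0//.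
  by have := sqr_ge0 m; nra.
split=> //.
have -> : \int[P]_w X w ^+ 2 = \int[P]_w ((X w - m) ^+ 2 + (2 * m * X w + - m ^+ 2)).
  by apply: eq_Rintegral => w _; ring.
have I3 := integrable_mulr measurableT (2 * m) IX.
rewrite RintegralD//; last exact: (integrable_addr measurableT I3 (Pc (- m ^+ 2))).
rewrite E2 RintegralD// RintegralZl// EX Rintegral_prob_cst; ring.
Qed.

Lemma normal_law_cgauss X v : measurable_fun setT X -> 0 <= v -> has_normal_law P X 0 v ->
  cgauss X v.
Proof.
move=> mX; rewrite le_eqVlt => /predU1P[<-|v0] nX t.
  have [_ ->] := normal_law0_integral mX nX (measurable_cos_scale t).
  have [_ ->] := normal_law0_integral mX nX (measurable_sin_scale t).
  by rewrite !mulr0 oppr0 mul0r expR0 cos0 sin0.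
have s0 : 0 < Num.sqrt v by rewrite sqrtr_gt0.
have bc (x : R) : `|cos (t * x)| <= 1 by exact: norm_cos_le1.
have bs (x : R) : `|sin (t * x)| <= 1 by exact: norm_sin_le1.
have [_ ->] := normal_law_integral mX v0 nX (measurable_cos_scale t)
  (integrable_bounded_normal 0 s0 (measurable_cos_scale t) bc).
have [_ ->] := normal_law_integral mX v0 nX (measurable_sin_scale t)
  (integrable_bounded_normal 0 s0 (measurable_sin_scale t) bs).
have [Ec Es] := normal_cos_sin 0 s0 t.
rewrite sqr_sqrtr ?(ltW v0)// in Ec; split.
  by rewrite -Ec; apply: eq_Rintegral => x _; rewrite subr0.
by apply: etrans Es; apply: eq_Rintegral => x _; rewrite subr0.
Qed.

(** Uniqueness with constant weight 1 compares [X] under [P] with the identity under the target law,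
    a Dirac mass when [v = 0]. *)
Lemma cgauss_normal_law X v : measurable_fun setT X -> 0 <= v -> cgauss X v ->
  has_normal_law P X 0 v.
Proof.
move=> mX v0 gX A mA.
have W1 : weighted (fun _ : T => 1 : R) X by split=> //; exists 1 => w; rewrite normr1.
have W2 : weighted (fun _ : R => 1 : R) (@id R) by split=> //; exists 1 => w; rewrite normr1.
have indE (D : measure_display) (S : measurableType D) (Q : probability S R) (Y : S -> R) :
    measurable_fun setT Y -> wexp Q (fun=> 1) Y (\1_A) = fine (Q (Y @^-1` A)).
  move=> mY; rewrite /wexp /Rintegral; congr fine.
  rewrite -[Y @^-1` A]setIT -integral_indic//; last by rewrite -[X in measurable X]setTI; exact: mY.
  by apply: eq_integral => x _; rewrite mul1r.
have wE (D : measure_display) (S : measurableType D) (Q : probability S R) (Y : S -> R) g :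
    wexp Q (fun=> 1) Y g = \int[Q]_w g (Y w).
  by apply: eq_Rintegral => w _; rewrite mul1r.
have fin (D : measure_display) (S : measurableType D) (Q : probability S R) (Y : S -> R) :
   measurable_fun setT Y -> Q (Y @^-1` A) \is a fin_num.
  by move=> mY; apply: fin_num_measure; rewrite -[X in measurable X]setTI; exact: mY.
have key (Q : probability (measurableTypeR R) R) :
   (forall t : R, \int[Q]_x cos (t * x) = expR (- (t ^+ 2 * v) / 2) /\
      \int[Q]_x sin (t * x) = 0) -> P (X @^-1` A) = Q A.
  move=> HQ.
  have : wexp P (fun=> 1) X \1_A = wexp Q (fun=> 1) (@id R) \1_A.
    apply: wexp_indic_unique => // t; rewrite !wE.
      by rewrite (gX t).1 (HQ t).1.
    by rewrite (gX t).2 (HQ t).2.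
  rewrite indE// indE// => E.
  by rewrite -(fineK (fin _ _ _ _ mX)) E fineK//; exact: (fin _ _ Q id).
move: v0; rewrite le_eqVlt => /predU1P[v0|v0].
  rewrite -v0 in key *; rewrite /normal_law eqxx.
  refine (key (\d_(0 : measurableTypeR R)) _) => t; rewrite mulr0 oppr0 mul0r expR0.
  split; rewrite /Rintegral integral_dirac// ?diracT ?mul1e/= ?mulr0 ?cos0 ?sin0//.
    by apply/measurable_EFinP; exact: measurable_cos_scale.
  by apply/measurable_EFinP; exact: measurable_sin_scale.
have s0 : 0 < Num.sqrt v by rewrite sqrtr_gt0.
rewrite /normal_law gt_eqF//; apply: (key (normal_prob 0 (Num.sqrt v))) => t.
have bc (x : R) : `|cos (t * x)| <= 1 by exact: norm_cos_le1.
have bs (x : R) : `|sin (t * x)| <= 1 by exact: norm_sin_le1.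
have [_ ->] := Rintegral_normal_prob (measurable_cos_scale t)
  (integrable_bounded_normal 0 s0 (measurable_cos_scale t) bc).
have [_ ->] := Rintegral_normal_prob (measurable_sin_scale t)
  (integrable_bounded_normal 0 s0 (measurable_sin_scale t) bs).
have [Ec Es] := normal_cos_sin 0 s0 t.
rewrite sqr_sqrtr ?(ltW v0)// in Ec; split.
  by rewrite -Ec; apply: eq_Rintegral => x _; rewrite subr0.
by apply: etrans Es; apply: eq_Rintegral => x _; rewrite subr0.
Qed.
End normal_law.

(** * Square-integrable random variables *)

Section real_inequalities.
Context {R : realType}.
Implicit Types (x y : R).

Lemma derive_le1_sqr (f df : R -> R) x y : (forall z : R, is_derive z (1 : R) f (df z)) ->
  (forall z, `|df z| <= 1) -> (f x - f y) ^+ 2 <= (x - y) ^+ 2.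
Proof.
move=> fd df1.
wlog xy : x y / y <= x.
  by move=> H; have [/H//|/ltW /H] := leP y x; rewrite -sqrrN opprB -[leRHS]sqrrN opprB.
have cf : {within `[y, x], continuous f}.
  apply: continuous_subspaceT => z; apply: differentiable_continuous; apply/derivable1_diffP.
  by apply: (@ex_derive _ _ _ _ _ _ _ (fd z)).
have [c _ ->] := MVT_segment xy (fun z _ => fd z) cf.
rewrite exprMn -[leRHS]mul1r ler_wpM2r ?sqr_ge0//.
by rewrite -(real_normK (num_real (df c))) expr_le1.
Qed.

Lemma cos_sub_sqr_le x y : (cos x - cos y) ^+ 2 <= (x - y) ^+ 2.
Proof.
apply: (@derive_le1_sqr cos (fun z => - sin z)) => z.
by rewrite normrN norm_sin_le1.
Qed.

Lemma sin_sub_sqr_le x y : (sin x - sin y) ^+ 2 <= (x - y) ^+ 2.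
Proof.
by apply: (@derive_le1_sqr sin cos) => z; rewrite norm_cos_le1.
Qed.

(** Cauchy-Schwarz with the weights [(3/4)^k], which sum to at most 4. The induction step is
    [(x + S)^2 <= 4 x^2 + (4/3) S^2], that is [(3 x - S)^2 >= 0]. *)
Lemma sqr_sum_geometric (D : nat -> R) m :
  (\sum_(k < m) D k) ^+ 2 <= 4 * \sum_(k < m) (4 / 3) ^+ k * D k ^+ 2.
Proof.
elim: m D => [|m IH] D; first by rewrite !big_ord0 expr0n/= mulr0.
rewrite !big_ord_recl expr0 mul1r.
have := IH (fun k => D k.+1).
have -> : \sum_(i < m) (4 / 3) ^+ lift ord0 i * D (lift ord0 i) ^+ 2 =
    4 / 3 * \sum_(k < m) (4 / 3) ^+ k * D k.+1 ^+ 2.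
  by rewrite mulr_sumr; apply: eq_bigr => k _; rewrite lift0 exprS mulrA.
have -> : \sum_(i < m) D (lift ord0 i) = \sum_(k < m) D k.+1 by [].
set S := \sum_(k < m) D k.+1; set U := \sum_(k < m) _; set x := D _.
by have := sqr_ge0 (3 * x - S); nra.
Qed.

(** Cauchy-Schwarz for the weights [|c i|]. The bound depends on the total weight and not on the
    number of terms, as Riemann sums under refinement demand. *)
Lemma sqr_wsum_le (I : Type) (s : seq I) (c Y : I -> R) :
  (\sum_(i <- s) c i * Y i) ^+ 2 <=
  (\sum_(i <- s) `|c i|) * \sum_(i <- s) `|c i| * Y i ^+ 2.
Proof.
elim: s => [|i s IH]; first by rewrite !big_nil expr0n mul0r.
rewrite !big_cons.
set S := \sum_(j <- s) _ * _ in IH *; set a := \sum_(j <- s) `|_| in IH *.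
set b := \sum_(j <- s) _ in IH *.
have a0 : 0 <= a by rewrite sumr_ge0.
have b0 : 0 <= b by rewrite sumr_ge0// => j _; rewrite mulr_ge0 ?sqr_ge0.
have c2 : c i * c i = `|c i| * `|c i| by rewrite -!expr2 real_normK ?num_real.
set x := `|c i| in c2 *; have x0 : 0 <= x by exact: normr_ge0.
suff : 2 * (c i * Y i) * S <= x * b + a * (x * Y i ^+ 2).
  move=> H; rewrite sqrrD exprMn [c i ^+ 2]expr2 c2.
  by rewrite !mulrDl !mulrDr; move: H IH; rewrite -mulr_natl expr2; lra.
have /(le_trans (ler_norm _)) : `|2 * (c i * Y i) * S| <= x * (2 * `|Y i| * `|S|).
  by rewrite !normrM -/x normr_nat; lra.
move/le_trans; apply; rewrite [a * _]mulrCA -mulrDr ler_wpM2l//.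
have Sab : `|S| ^+ 2 <= a * b by rewrite real_normK ?num_real.
rewrite -(real_normK (num_real (Y i))).
set y := `|Y i|; set z := `|S| in Sab *.
have y0 : 0 <= y by exact: normr_ge0.
have z0 : 0 <= z by exact: normr_ge0.
(* If the earlier weights all vanish then so does [S]; otherwise multiply by [a] and use
   [(a * y - z)^2 >= 0]. *)
have [a1|a1] := eqVneq a 0.
  have z1 : z = 0 by apply/eqP; rewrite -sqrf_eq0 eq_le sqr_ge0 andbT; move: Sab; rewrite a1 mul0r.
  by rewrite z1 a1 mulr0 mul0r addr0.
have ap : 0 < a by rewrite lt_def a1.
rewrite -(ler_pM2l ap).
by have := sqr_ge0 (a * y - z); nra.
Qed.
End real_inequalities.

Section square_integrable.
Context {R : realType} {d : measure_display} {T : measurableType d} (P : probability T R).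
Implicit Types (X Y : T -> R).

Definition L2 X : Prop :=
  measurable_fun setT X /\ P.-integrable setT (EFin \o (fun w => X w ^+ 2)).

Definition ip X Y : R := \int[P]_w (X w * Y w).

Lemma L2_mul X Y : L2 X -> L2 Y -> P.-integrable setT (EFin \o (fun w => X w * Y w)).
Proof.
move=> [mX X2] [mY Y2].
apply: (integrable_dominated measurableT _ _ (integrable_addr measurableT X2 Y2)).
  exact: measurable_funM.
move=> t _; have := sqr_ge0 (X t - Y t); have := sqr_ge0 (X t + Y t).
have := sqr_ge0 (X t); have := sqr_ge0 (Y t).
by rewrite sqrrB sqrrD ler_norml; lra.
Qed.

Lemma L2_bounded X (M : R) : measurable_fun setT X -> (forall w, `|X w| <= M) -> L2 X.
Proof.
move=> mX XM; split=> //; apply: bounded_integrable; first exact: measurable_funX.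
exists (M ^+ 2) => w; rewrite normrX lerXn2r ?nnegrE ?normr_ge0//.
by rewrite (le_trans _ (XM w)).
Qed.

Lemma L2_cst (c : R) : L2 (fun=> c).
Proof. exact: (@L2_bounded _ `|c|). Qed.

Lemma L2_integrable X : L2 X -> P.-integrable setT (EFin \o X).
Proof.
move=> LX; have := L2_mul LX (L2_cst 1); congr (P.-integrable _ _).
by apply/funext => t; rewrite /= mulr1.
Qed.

Lemma L2Z (c : R) X : L2 X -> L2 (fun w => c * X w).
Proof.
move=> [mX X2]; split; first exact: measurable_funM.
have := integrable_mulr measurableT (c ^+ 2) X2; congr (P.-integrable _ _).
by apply/funext => t; rewrite /= exprMn.
Qed.

Lemma L2D X Y : L2 X -> L2 Y -> L2 (fun w => X w + Y w).
Proof.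
move=> LX LY; have LXY := L2_mul LX LY; case: (LX) (LY) => mX X2 [mY Y2].
split; first exact: measurable_funD.
have := integrable_addr measurableT (integrable_addr measurableT X2 Y2) (integrable_mulr measurableT 2 LXY).
congr (P.-integrable _ _); apply/funext => t /=; congr EFin; ring.
Qed.

Lemma L2B X Y : L2 X -> L2 Y -> L2 (fun w => X w - Y w).
Proof.
move=> LX LY; rewrite (_ : (fun w => _) = fun w => X w + (-1) * Y w).
  by apply: L2D => //; exact: L2Z.
by apply/funext => w; rewrite mulN1r.
Qed.

Lemma L2_sum (I : Type) (s : seq I) (F : I -> T -> R) : (forall i, L2 (F i)) ->
  L2 (fun w => \sum_(i <- s) F i w).
Proof.
move=> LF; elim: s => [|i s IH].
  rewrite (_ : (fun w => _) = fun=> 0); first exact: L2_cst.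
  by apply/funext => w; rewrite big_nil.
rewrite (_ : (fun w => _) = fun w => F i w + \sum_(i <- s) F i w); first exact: L2D.
by apply/funext => w; rewrite big_cons.
Qed.

Lemma L2_wsum (I : Type) (s : seq I) (c : I -> R) (F : I -> T -> R) : (forall i, L2 (F i)) ->
  L2 (fun w => \sum_(i <- s) c i * F i w).
Proof. by move=> LF; apply: (@L2_sum _ s (fun i w => c i * F i w)) => i; exact: L2Z. Qed.

Lemma ipC X Y : ip X Y = ip Y X.
Proof. by apply: eq_Rintegral => w _; rewrite mulrC. Qed.

Lemma ip_ge0 X : 0 <= ip X X.
Proof. by apply: Rintegral_ge0 => w _; rewrite -expr2 sqr_ge0. Qed.

Lemma ipZl (c : R) X Y : L2 X -> L2 Y -> ip (fun w => c * X w) Y = c * ip X Y.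
Proof.
move=> LX LY; rewrite -RintegralZl//; last exact: L2_mul.
by apply: eq_Rintegral => w _; rewrite mulrA.
Qed.

Lemma ipBl X Y W : L2 X -> L2 Y -> L2 W -> ip (fun w => X w - Y w) W = ip X W - ip Y W.
Proof.
move=> LX LY LW; rewrite -RintegralB//; try exact: L2_mul.
by apply: eq_Rintegral => w _; rewrite mulrBl.
Qed.

Lemma ip_suml (I : Type) (s : seq I) (c : I -> R) (F : I -> T -> R) Y :
  (forall i, L2 (F i)) -> L2 Y ->
  ip (fun w => \sum_(i <- s) c i * F i w) Y = \sum_(i <- s) c i * ip (F i) Y.
Proof.
move=> LF LY; transitivity (\int[P]_w \sum_(i <- s) (c i * F i w * Y w)).
  by apply: eq_Rintegral => w _; rewrite mulr_suml.
rewrite Rintegral_sum//; last by move=> i; apply: L2_mul => //; exact: L2Z.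
by apply: eq_bigr => i _; exact: ipZl.
Qed.

Lemma ip_wsum (I : Type) (s : seq I) (c : I -> R) (F : I -> T -> R) :
  (forall i, L2 (F i)) ->
  ip (fun w => \sum_(i <- s) c i * F i w) (fun w => \sum_(i <- s) c i * F i w) =
  \sum_(i <- s) \sum_(j <- s) c i * c j * ip (F i) (F j).
Proof.
move=> LF; have LS := L2_wsum s c LF.
rewrite ip_suml//; apply: eq_bigr => i _; rewrite ipC ip_suml// mulr_sumr.
by apply: eq_bigr => j _; rewrite mulrA ipC.
Qed.

Lemma ip_sqrB X Y : L2 X -> L2 Y ->
  ip (fun w => X w - Y w) (fun w => X w - Y w) = ip X X - 2 * ip X Y + ip Y Y.
Proof.
move=> LX LY; have LXY := L2B LX LY.
rewrite ipBl// ![ip _ (fun w => X w - Y w)]ipC !ipBl// [ip Y X]ipC; ring.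
Qed.

Lemma ip_cauchy_schwarz X Y : L2 X -> L2 Y -> ip X Y ^+ 2 <= ip X X * ip Y Y.
Proof.
move=> LX LY.
have H (t : R) : 0 <= ip X X - 2 * (t * ip X Y) + t ^+ 2 * ip Y Y.
  have LtY := L2Z t LY; have := ip_ge0 (fun w => X w - t * Y w).
  rewrite ip_sqrB// [ip X (fun w => t * Y w)]ipC ipZl// [ip Y X]ipC.
  by rewrite [ip _ (fun w => t * Y w)]ipZl// [ip Y _]ipC ipZl// expr2 -mulrA.
have [Y0|Y0] := eqVneq (ip Y Y) 0.
  have [->|n0] := eqVneq (ip X Y) 0; first by rewrite expr0n/= mulr_ge0 ?ip_ge0.
  (* With [ip Y Y = 0] the quadratic is affine in [t], and at this [t] it would equal -1. *)
  have := H ((ip X X + 1) / (2 * ip X Y)); rewrite Y0 mulr0 addr0.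
  have -> : 2 * ((ip X X + 1) / (2 * ip X Y) * ip X Y) = ip X X + 1 by field.
  by rewrite opprD addrA subrr sub0r oppr_ge0 ler10.
have Yp : 0 < ip Y Y by rewrite lt_def Y0 ip_ge0.
have := H (ip X Y / ip Y Y).
have -> : ip X X - 2 * (ip X Y / ip Y Y * ip X Y) + (ip X Y / ip Y Y) ^+ 2 * ip Y Y =
  (ip X X * ip Y Y - ip X Y ^+ 2) / ip Y Y by field.
by rewrite pmulr_lge0 ?invr_gt0// subr_ge0.
Qed.

Lemma Rintegral_sqr_le X : L2 X -> (\int[P]_w X w) ^+ 2 <= ip X X.
Proof.
move=> LX; have L1 := L2_cst 1; have := ip_cauchy_schwarz LX L1.
have -> : ip (fun=> 1) (fun=> 1) = 1.
  by rewrite -[RHS](Rintegral_prob_cst P); apply: eq_Rintegral => w _; rewrite mulr1.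
have -> : ip X (fun=> 1) = \int[P]_w X w.
  by apply: eq_Rintegral => w _; rewrite mulr1.
by rewrite mulr1.
Qed.

Lemma sqr_cvg0 (u : nat -> R) (v : nat -> R) l : (forall n, (u n - l) ^+ 2 <= v n) ->
  v n @[n --> \oo] --> (0 : R) -> u n @[n --> \oo] --> l.
Proof.
move=> uv v0; apply/cvgrPdist_le => e e0.
have e2 : 0 < e ^+ 2 by rewrite exprn_gt0.
move/cvgrPdist_le : v0 => /(_ _ e2)[n0 _ H]; exists n0 => // n n0n.
have := H n n0n; rewrite /= sub0r normrN => vn.
rewrite distrC -(ler_pXn2r (n := 2))// ?nnegrE ?normr_ge0 ?(ltW e0)//.
by rewrite real_normK ?num_real// (le_trans (uv n))// (le_trans _ vn)// ler_norm.
Qed.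

Variables (X_ : nat -> T -> R) (X : T -> R).
Hypotheses (LX_ : forall n, L2 (X_ n)) (LX : L2 X).
Hypothesis X_cvg : ip (fun w => X_ n w - X w) (fun w => X_ n w - X w) @[n --> \oo] --> (0 : R).

Lemma ip_cvgl Y : L2 Y -> ip (X_ n) Y @[n --> \oo] --> ip X Y.
Proof.
move=> LY; apply: (@sqr_cvg0 _ (fun n => ip (fun w => X_ n w - X w) (fun w => X_ n w - X w) * ip Y Y)).
  by move=> n; rewrite -ipBl//; apply: ip_cauchy_schwarz => //; exact: L2B.
by rewrite -[X in _ --> X](mul0r (ip Y Y)); apply: cvgM => //; exact: cvg_cst.
Qed.

(** For 1-Lipschitz [h] the expectations differ by at most [|t|] times the L2 distance of the
    variables; the estimate is kept squared throughout. *)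
Lemma Rintegral_lipschitz_cvg (h : R -> R) (t M : R) : (forall x y, (h x - h y) ^+ 2 <= (x - y) ^+ 2) ->
  measurable_fun setT (fun x => h (t * x)) -> (forall x, `|h x| <= M) ->
  \int[P]_w h (t * X_ n w) @[n --> \oo] --> \int[P]_w h (t * X w).
Proof.
move=> hl mh hM.
pose v n := t ^+ 2 * ip (fun w => X_ n w - X w) (fun w => X_ n w - X w).
have Lh Y : L2 Y -> L2 (fun w => h (t * Y w)).
  move=> [mY _]; apply: (@L2_bounded _ M) => //.
  exact: (measurableT_comp mh mY).
apply: (@sqr_cvg0 _ v); last first.
  by rewrite -[X in _ --> X](mulr0 (t ^+ 2)); apply: cvgM => //; exact: cvg_cst.
move=> n; rewrite -RintegralB//; try by apply: L2_integrable; exact: Lh.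
apply: le_trans (Rintegral_sqr_le (L2B (Lh _ (LX_ n)) (Lh _ LX))) _.
have LD := L2B (LX_ n) LX.
rewrite /v -RintegralZl//; last exact: L2_mul.
apply: le_Rintegral => //.
- by apply: L2_mul; apply: L2B; exact: Lh.
- by apply: integrable_mulr => //; exact: L2_mul.
- by move=> w _; rewrite -!expr2 (le_trans (hl _ _))// -mulrBr exprMn.
Qed.

Lemma cgauss_cvg (v : nat -> R) l : (forall n, cgauss P (X_ n) (v n)) ->
  v n @[n --> \oo] --> l -> cgauss P X l.
Proof.
move=> gX vl t; split.
- have H := @Rintegral_lipschitz_cvg cos t 1 (@cos_sub_sqr_le R) (measurable_cos_scale t)
    (@norm_cos_le1 R).
  rewrite -(cvg_lim (@Rhausdorff R) H); apply/cvg_lim => //.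
  under eq_fun do rewrite (gX _ t).1.
  apply: continuous_cvg; first exact: continuous_expR.
  apply: cvgM; last exact: cvg_cst.
  by apply: cvgN; apply: cvgM => //; exact: cvg_cst.
- have H := @Rintegral_lipschitz_cvg sin t 1 (@sin_sub_sqr_le R) (measurable_sin_scale t)
    (@norm_sin_le1 R).
  rewrite -(cvg_lim (@Rhausdorff R) H); apply/cvg_lim => //.
  under eq_fun do rewrite (gX _ t).2.
  exact: cvg_cst.
Qed.
End square_integrable.

(** * Mean-square completeness along geometric sequences *)

Section completeness.
Context {R : realType} {d : measure_display} {T : measurableType d} (P : probability T R).
Variables (X_ : nat -> T -> R) (C : R).
Hypothesis LX_ : forall n, L2 P (X_ n).
Let D n w := X_ n.+1 w - X_ n w.
Hypothesis ipD : forall n, ip P (D n) (D n) <= C * 2^-1 ^+ n.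

(** The weight 4/3 exceeds 1, so that squared increments control their sum through
    [sqr_sum_geometric], and is below 2, so that the expectations remain summable against the decay
    in [ipD]. *)
Let e n k w : \bar R := ((4 / 3) ^+ k * D (n + k) w ^+ 2)%:E.
Let S n w : \bar R := (\sum_(k <oo) e n k w)%E.

Let e_ge0 n k w : (0 <= e n k w)%E.
Proof. by rewrite lee_fin mulr_ge0 ?sqr_ge0// exprn_ge0. Qed.

Let LD n : L2 P (D n). Proof. exact: L2B. Qed.

Let m_e n k : measurable_fun setT (e n k).
Proof.
apply/measurable_EFinP; apply: measurable_funM => //.
by apply: measurable_funX; case: (LD (n + k)).
Qed.

Let S_ge0 n w : (0 <= S n w)%E.
Proof. by apply: nneseries_ge0 => k _ _; exact: e_ge0. Qed.

Let m_S n : measurable_fun setT (S n).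
Proof. by apply: ge0_emeasurable_sum => [k w _ _|k _]; [exact: e_ge0 | exact: m_e]. Qed.

Let C_ge0 : 0 <= C.
Proof. by have := le_trans (ip_ge0 P (D 0)) (ipD 0); rewrite expr0 mulr1. Qed.

(** The k-th expectation is at most [C 2^-n (2/3)^k], and the series of ratio 2/3 sums to 3. *)
Let integral_S n : (\int[P]_w S n w <= (3 * C * 2^-1 ^+ n)%:E)%E.
Proof.
rewrite integral_nneseries//.
apply: lime_le.
  by apply: is_cvg_nneseries => k _ _; apply: integral_ge0 => w _; exact: e_ge0.
apply: nearW => N.
apply: (@le_trans _ _ (\sum_(0 <= k < N) (C * 2^-1 ^+ n * (2 / 3) ^+ k)%:E)%E).
  apply: lee_sum => k _.
  have L := LD (n + k); have i2 := integrable_mulr measurableT ((4 / 3) ^+ k) L.2.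
  rewrite -(fineK (integrable_fin_num measurableT i2)) lee_fin.
  rewrite -/(Rintegral P setT (fun w => (4 / 3) ^+ k * D (n + k) w ^+ 2)).
  rewrite RintegralZl//; last by case: L.
  have -> : \int[P]_w D (n + k) w ^+ 2 = ip P (D (n + k)) (D (n + k)).
    by apply: eq_Rintegral => w _; rewrite expr2.
  apply: (@le_trans _ _ ((4 / 3) ^+ k * (C * 2^-1 ^+ (n + k)))).
    by rewrite ler_wpM2l ?exprn_ge0.
  rewrite exprD (_ : 2 / 3 = (4 / 3) * 2^-1 :> R); last by field.
  by rewrite [(4 / 3 / 2) ^+ k]exprMn le_eqVlt; apply/orP; left; apply/eqP; ring.
rewrite sumEFin lee_fin -mulr_sumr.
have -> : \sum_(0 <= k < N) (2 / 3 : R) ^+ k = 3 * (1 - (2 / 3) ^+ N).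
  elim: N => [|N IH]; first by rewrite big_nil expr0 subrr mulr0.
  by rewrite big_nat_recr//= IH exprS; field.
rewrite (_ : 3 * C * _ = C * 2^-1 ^+ n * 3); last by ring.
rewrite ler_wpM2l ?mulr_ge0 ?exprn_ge0//.
have : 0 <= (2 / 3 : R) ^+ N by rewrite exprn_ge0.
lra.
Qed.

Let sqr_increment n m w : (((X_ (n + m) w - X_ n w) ^+ 2)%:E <= 4%:E * S n w)%E.
Proof.
have -> : X_ (n + m) w - X_ n w = \sum_(k < m) D (n + k) w.
  elim: m => [|m IH]; first by rewrite big_ord0 addn0 subrr.
  by rewrite big_ord_recr/= -IH /D addnS; ring.
have : (((\sum_(k < m) D (n + k) w) ^+ 2)%:E <=
   4%:E * (\sum_(k < m) (4 / 3) ^+ k * D (n + k) w ^+ 2)%:E)%E.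
  by rewrite -EFinM lee_fin; exact: (sqr_sum_geometric (fun k => D (n + k) w)).
move/le_trans; apply; rewrite lee_pmul2l// -sumEFin -(big_mkord xpredT (fun k => e n k w)).
by apply: nneseries_lim_ge => k _ _; exact: e_ge0.
Qed.

Let S_geometric n w : (S n w <= ((3 / 4) ^+ n)%:E * S 0 w)%E.
Proof.
apply: lime_le; first by apply: is_cvg_nneseries => k _ _; exact: e_ge0.
apply: nearW => N.
have -> : (\sum_(0 <= k < N) e n k w = ((3 / 4) ^+ n)%:E * \sum_(0 + n <= k < n + N) e 0%N k w)%E.
  rewrite big_addn addKn ge0_sume_distrr; last by move=> k _; exact: e_ge0.
  apply: eq_bigr => k _; rewrite /e -EFinM add0n addnC; congr EFin.
  have q : (3 / 4) ^+ n * (4 / 3) ^+ n = 1 :> R.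
    by rewrite -exprMn (_ : 3 / 4 * (4 / 3) = 1 :> R) ?expr1n//; field.
  by rewrite exprD; move: ((3 / 4) ^+ n) ((4 / 3) ^+ n) q => a b ab; rewrite -[LHS]mul1r -ab; ring.
rewrite add0n lee_pmul2l ?lte_fin ?exprn_gt0//.
apply: le_trans (nneseries_lim_ge (n + N) (fun k _ _ => e_ge0 0 k w)).
rewrite [leRHS](big_cat_nat _ (n := n))//= ?leq_addr//.
by rewrite leeDr// sume_ge0// => k _; exact: e_ge0.
Qed.

(** [S 0] has finite expectation, so it is finite almost surely. Where it is, the sequence is Cauchy
    at a geometric rate, and [S n] bounds the squared distance to the limit up to a factor 4;
    integrating this bound gives the mean-square convergence. *)
Lemma L2_complete : exists2 X, L2 P X &
  ip P (fun w => X_ n w - X w) (fun w => X_ n w - X w) @[n --> \oo] --> (0 : R).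
Proof.
(* An upper limit is measurable on the whole space and equals the limit wherever the latter
   exists. *)
pose X w := fine (limn_esup (fun n => (X_ n w)%:E)).
have mX : measurable_fun setT X.
  apply: measurableT_comp => //; apply: measurable_fun_limn_esup => n.
  by apply/measurable_EFinP; case: (LX_ n).
have aeS : {ae P, forall w, S 0 w \is a fin_num}.
  have : P.-integrable setT (S 0).
    apply/integrableP; split=> //.
    rewrite (eq_integral (S 0)); last by move=> w _; rewrite gee0_abs.
    by apply: le_lt_trans (integral_S 0) _; rewrite ltry.
  move/(integrable_ae measurableT).
  by apply: (@filterS _ _ (ae_filter_ringOfSetsType P)) => w; apply.
have XS n w : S 0 w \is a fin_num -> (((X_ n w - X w) ^+ 2)%:E <= 4%:E * S n w)%E.
  move=> fS.
  have s0 : 0 <= fine (S 0 w) by rewrite fine_ge0.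
  set s := fine (S 0 w) in s0.
  have bnd m k : (X_ (m + k) w - X_ m w) ^+ 2 <= 4 * s * (3 / 4) ^+ m.
    rewrite -lee_fin (le_trans (sqr_increment m k w))// -mulrA EFinM lee_pmul2l//.
    by rewrite (le_trans (S_geometric m w))// [s * _]mulrC EFinM /s fineK ?lexx.
  have c : cvg (X_ m w @[m --> \oo]).
    apply/cauchy_cvgP; apply: cauchy_exP => eps eps0.
    have e2 : 0 < eps ^+ 2 by rewrite exprn_gt0.
    have : geometric (4 * s) (3 / 4) @ \oo --> (0 : R).
      by apply: cvg_geometric; rewrite ger0_norm//; lra.
    move/cvgrPdist_lt => /(_ _ e2)[m0 _ H].
    exists (X_ m0 w); exists m0 => // m m0m; rewrite /= -[in X_ m w](subnKC m0m) /ball/=.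
    rewrite distrC -(ltr_pXn2r (n := 2))// ?nnegrE ?normr_ge0 ?(ltW eps0)//.
    rewrite real_normK ?num_real// (le_lt_trans (bnd _ _))//.
    have := H m0 (leqnn m0); rewrite /= sub0r normrN ger0_norm//.
    by rewrite !mulr_ge0// exprn_ge0.
  have XE : X_ m w @[m --> \oo] --> X w.
    rewrite (_ : X w = lim (X_ m w @[m --> \oo])) => //.
    have ce : (X_ m w)%:E @[m --> \oo] --> (lim (X_ m w @[m --> \oo]))%:E.
      by apply: cvg_EFin; [exact: nearW | exact: c].
    by rewrite /X (cvg_limn_einf_sup ce).2.
  have SE : S n w \is a fin_num.
    rewrite ge0_fin_numE// (le_lt_trans (S_geometric n w))//.
    by rewrite -(fineK fS) -EFinM ltry.
  rewrite -(fineK SE) -EFinM lee_fin.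
  have cX : (X_ (k + n) w - X_ n w) ^+ 2 @[k --> \oo] --> (X w - X_ n w) ^+ 2.
    rewrite !expr2; have c1 : X_ (k + n) w - X_ n w @[k --> \oo] --> X w - X_ n w.
      by apply: cvgB; [rewrite (cvg_shiftn n (fun k => X_ k w)) | exact: cvg_cst].
    by under eq_fun do rewrite expr2; exact: cvgM.
  rewrite -sqrrN opprB -(cvg_lim (@Rhausdorff R) cX).
  apply: limr_le; first by apply/cvg_ex; eexists; exact: cX.
  by apply: nearW => k; rewrite -lee_fin [(4 * _)%:E]EFinM fineK// addnC; exact: sqr_increment.
have main n : (\int[P]_w ((X_ n w - X w) ^+ 2)%:E <= (4 * (3 * C * 2^-1 ^+ n))%:E)%E.
  rewrite EFinM; apply: le_trans (_ : _ <= 4%:E * \int[P]_w S n w)%E _; last first.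
    by rewrite lee_pmul2l.
  rewrite -ge0_integralZl//.
  apply: ae_ge0_le_integral => //.
  - by move=> w _; rewrite lee_fin sqr_ge0.
  - apply/measurable_EFinP; apply: measurable_funX; apply: measurable_funB => //.
    by case: (LX_ n).
  - by move=> w _; rewrite mule_ge0.
  - exact: emeasurable_funM.
  - by apply: (@filterS _ _ (ae_filter_ringOfSetsType P)) aeS => w Sw _; exact: XS.
have LXn n : L2 P (fun w => X_ n w - X w).
  have m1 : measurable_fun setT (fun w => X_ n w - X w).
    by apply: measurable_funB => //; case: (LX_ n).
  split=> //; apply/integrableP; split; first by apply/measurable_EFinP; exact: measurable_funX.
  rewrite (eq_integral (fun w => ((X_ n w - X w) ^+ 2)%:E)).
    by apply: le_lt_trans (main n) _; rewrite ltry.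
  by move=> w _; rewrite /= ger0_norm ?sqr_ge0.
exists X.
  have := L2B (LX_ 0) (LXn 0); congr (L2 P); apply/funext => w; ring.
apply: (@squeeze_norm_cvg _ _ (geometric (4 * (3 * C)) 2^-1)).
  move=> n; rewrite subr0 ger0_norm ?ip_ge0//.
  rewrite -lee_fin /ip /Rintegral fineK; last exact: integrable_fin_num (L2_mul (LXn n) (LXn n)).
  rewrite (_ : geometric _ _ n = 4 * (3 * C * 2^-1 ^+ n)); last by rewrite /geometric/=; ring.
  apply: le_trans (main n).
  by rewrite le_eqVlt; apply/orP; left; apply/eqP; apply: eq_integral => w _; rewrite expr2.
by apply: cvg_geometric; rewrite ger0_norm//; lra.
Qed.
End completeness.

(** * Independence of jointly normal variables *)

Section bounded_functions_from_indicators.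
Context {R : realType}.
Implicit Types (y : R) (n N : nat).

(** The sum is the integer part of [y], written as a sum of indicators of level sets so that
    linearity applies to it. *)
Lemma floor_count (y : R) N : 0 <= y <= N%:R ->
  y - 1 <= \sum_(k < N) (k.+1%:R <= y)%R%:R <= y.
Proof.
elim: N y => [|N IH] y /andP[y0 yN]; first by rewrite big_ord0; lra.
rewrite big_ord_recr/=; have [Ny|Ny] := leP N.+1%:R y.
  have -> : y = N.+1%:R by apply/eqP; rewrite eq_le yN Ny.
  rewrite (eq_bigr (fun=> 1)); last by move=> k _; rewrite ler_nat ltnS (ltnW (ltn_ord k)).
  by rewrite sumr_const card_ord -natr1 -[1 *+ N]/(N%:R : R); apply/andP; split=> /=; lra.
rewrite addr0; have [yN'|Ny'] := leP y N%:R; first by apply: IH; rewrite y0.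
rewrite (eq_bigr (fun=> 1)); last first.
  by move=> k _; rewrite (le_trans _ (ltW Ny'))// ler_nat ltn_ord.
by rewrite sumr_const card_ord (ltW Ny') andbT; rewrite -natr1 in Ny; lra.
Qed.

Variables (d1 d2 : measure_display) (T1 : measurableType d1) (T2 : measurableType d2).
Variables (P1 : probability T1 R) (P2 : probability T2 R).
Variables (W1 X1 : T1 -> R) (W2 X2 : T2 -> R).
Hypotheses (WX1 : weighted W1 X1) (WX2 : weighted W2 X2).
Hypothesis eq_indic : forall A : set R, measurable A ->
  wexp P1 W1 X1 \1_A = wexp P2 W2 X2 \1_A.

(** Uniform approximation by step functions. Independence speaks of sets, whereas joint
    characteristic functions need cosines and sines. *)
Lemma wexp_bounded_unique (g : R -> R) : bounded_measurable g ->
  wexp P1 W1 X1 g = wexp P2 W2 X2 g.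
Proof.
pose agree := wexp_agree P1 P2 W1 X1 W2 X2.
have agree_indic A : measurable A -> agree \1_A.
  move=> mA; split; last exact: eq_indic.
  by split=> //; exists 1 => x; rewrite indicE; case: (_ \in _); rewrite ?normr1 ?normr0.
have agree1 c : agree (fun=> c).
  have := wexp_agreeZ WX1 WX2 c (agree_indic setT measurableT).
  by congr (wexp_agree _ _ _ _ _ _ _); apply/funext => x; rewrite indicT mulr1.
move=> [mg [M gM]].
pose L := `|M| + 1; have L0 : 0 < L by rewrite ltr_wpDl.
have gL x : `|g x| <= L.
  by apply: le_trans (gM x) _; rewrite (le_trans (ler_norm M))// lerDl.
(* [y n x] ranges over [0, n], and [g_ n] rounds [g] down to a multiple of [2 L / n]. *)
pose y n (x : R) := n.+1%:R * ((g x + L) / (2 * L)).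
pose g_ n x := - L + 2 * L / n.+1%:R * \sum_(k < n.+1) (k.+1%:R <= y n x)%R%:R.
have y_range n x : 0 <= y n x <= n.+1%:R.
  have := gL x; rewrite ler_norml => /andP[g1 g2].
  rewrite mulr_ge0//=; last by rewrite divr_ge0 ?mulr_ge0 ?(ltW L0)//; lra.
  by rewrite ler_piMr// ler_pdivrMr ?mulr_gt0//; lra.
have gg n x : `|g_ n x - g x| <= 2 * L / n.+1%:R.
  have /andP[h1 h2] := floor_count (y_range n x).
  set s := \sum_(k < _) _ in h1 h2 *; rewrite /g_ -/s.
  have -> : g x = - L + 2 * L / n.+1%:R * y n x.
    rewrite /y; have : n.+1%:R != 0 :> R by rewrite pnatr_eq0.
    by move: (n.+1%:R) => c c0; field; rewrite (gt_eqF L0).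
  have c0 : 0 <= 2 * L / n.+1%:R by rewrite divr_ge0// mulr_ge0// ltW.
  rewrite (_ : - L + _ - _ = - (2 * L / n.+1%:R * (y n x - s))); last by ring.
  rewrite normrN normrM ger0_norm// -[leRHS]mulr1 ler_wpM2l// ger0_norm; lra.
have agree_g_ n : agree (g_ n).
  apply: (wexp_agreeD WX1 WX2 (agree1 _)); apply: (wexp_agreeZ WX1 WX2).
  have cnt N : agree (fun x => \sum_(k < N) (k.+1%:R <= y n x)%R%:R); last exact: cnt.
  elim: N => [|N IH]; first by under eq_fun do rewrite big_ord0.
  under eq_fun do rewrite big_ord_recr/=.
  apply: (wexp_agreeD WX1 WX2 IH).
  have -> : (fun x => (N.+1%:R <= y n x)%R%:R) = \1_[set x | N.+1%:R <= y n x] :> (R -> R).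
    by apply/funext => x; rewrite indicE; congr (_%:R); congr nat_of_bool; apply/idP/idP; rewrite inE.
  apply: (agree_indic); rewrite -[X in measurable X]setTI.
  apply: measurable_fun_le => //; apply: measurable_funM => //.
  by apply: measurable_funM => //; exact: measurable_funD.
have small : 2 * L / n.+1%:R @[n --> \oo] --> (0 : R).
  by rewrite -[X in _ --> X](mulr0 (2 * L)); apply: cvgM; [exact: cvg_cst | exact: cvg_harmonic].
have gcvg x : g_ n x @[n --> \oo] --> g x.
  apply/cvgrPdist_le => e e0; move/cvgrPdist_le : small => /(_ e e0)[n0 _ H].
  exists n0 => // n n0n; rewrite /= distrC (le_trans (gg n x))//.
  by apply: le_trans (H n n0n); rewrite /= sub0r normrN ler_norm.
have g_M n x : `|g_ n x| <= 3 * L.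
  have : `|g_ n x| <= `|g_ n x - g x| + `|g x|.
    by rewrite -{1}(subrK (g x) (g_ n x)) ler_normD.
  move/le_trans; apply; rewrite (_ : 3 * L = 2 * L + L); last by ring.
  apply: lerD (gL x); apply: le_trans (gg n x) _.
  by rewrite ler_piMr ?invf_le1 ?ler1n// mulr_ge0// ltW.
by have [] := wexp_agree_cvg WX1 WX2 agree_g_ g_M gcvg.
Qed.
End bounded_functions_from_indicators.

(** * Joint normality and independence of uncorrelated normal variables *)

Section independence.
Context {R : realType} {d : measure_display} {T : measurableType d} (P : probability T R).
Context {I : choiceType} (X : I -> {RV P >-> R}) (v : I -> R).
Implicit Types (s : seq I) (r : seq (I * R)) (A : I -> set R).

Definition lincomb r : T -> R := fun w => \sum_(q <- r) q.2 * X q.1 w.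
(** The variance of [lincomb r] when the indices in [r] are distinct and the [X i] are uncorrelated
    with variances [v i]. *)
Definition linvar r : R := \sum_(q <- r) q.2 ^+ 2 * v q.1.
Let ind s A : T -> R := fun w => \prod_(i <- s) \1_(A i) (X i w).
Let pr A i := fine (P (X i @^-1` A i)).
Let chf r := expR (- linvar r / 2).

Lemma lincomb_cons q r w : lincomb (q :: r) w = q.2 * X q.1 w + lincomb r w.
Proof. by rewrite /lincomb big_cons. Qed.

Let measurable_lincomb r : measurable_fun setT (lincomb r).
Proof. by apply: measurable_sum => q; exact: measurable_funM. Qed.

Let measurable_ind s A : (forall i, measurable (A i)) -> measurable_fun setT (ind s A).
Proof.
move=> mA; apply: measurable_prod => i _.
rewrite (_ : (fun w => _) = \1_(X i @^-1` A i)) //; apply: measurable_indic.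
exact: measurable_funPTI.
Qed.

Let ind_le1 s A w : `|ind s A w| <= 1.
Proof.
rewrite /ind; elim: s => [|i s IH]; first by rewrite big_nil normr1.
rewrite big_cons normrM mulr_ile1// indicE.
by case: (_ \in _); rewrite ?normr1 ?normr0.
Qed.

Let measurable_trig_lincomb r : measurable_fun setT (fun w => cos (lincomb r w)) /\
  measurable_fun setT (fun w => sin (lincomb r w)).
Proof.
split; apply: measurableT_comp => //; apply: continuous_measurable_fun.
  exact: continuous_cos.
exact: continuous_sin.
Qed.

Let weighted_trig s A r i : (forall i, measurable (A i)) ->
  weighted (fun w => ind s A w * cos (lincomb r w)) (X i) /\
  weighted (fun w => ind s A w * sin (lincomb r w)) (X i).
Proof.
move=> mA; have [mc ms] := measurable_trig_lincomb r; have mI := measurable_ind s mA.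
split; (split; [exact: measurable_funM| exists 1 => w | exact: measurable_funPT]);
  by rewrite normrM mulr_ile1 ?ind_le1 ?norm_cos_le1 ?norm_sin_le1.
Qed.

Let weighted_cst (c : R) i : weighted (fun=> c) (X i).
Proof. by split; [| exists `|c| | exact: measurable_funPT]. Qed.

Let bounded_cos (t : R) : bounded_measurable (fun x => cos (t * x)).
Proof. by split; [exact: measurable_cos_scale | exists 1 => x; rewrite norm_cos_le1]. Qed.

Let bounded_sin (t : R) : bounded_measurable (fun x => sin (t * x)).
Proof. by split; [exact: measurable_sin_scale | exists 1 => x; rewrite norm_sin_le1]. Qed.

Let wexp_cst (c : R) i g : bounded_measurable g ->
  wexp P (fun=> c) (X i) g = c * \int[P]_w g (X i w).
Proof.
move=> bg; rewrite -RintegralZl//.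
have := weighted_integrable P (weighted_cst 1 i) bg; congr (P.-integrable _ _).
by apply/funext => w; rewrite /= mul1r.
Qed.

Let int_indic A i : (forall i, measurable (A i)) -> \int[P]_w \1_(A i) (X i w) = pr A i.
Proof.
move=> mA; rewrite /Rintegral /pr; congr fine.
rewrite -[X i @^-1` A i]setIT -integral_indic//; last exact: measurable_funPTI.
Qed.

Let ind_bigcap s A w : ind s A w = \1_(\bigcap_(i in [set` s]) X i @^-1` A i) w.
Proof.
rewrite bigcap_seq /ind; elim: s => [|i s IH]; first by rewrite !big_nil indicT.
by rewrite !big_cons IH indicI.
Qed.

Let measurable_bigcap s A : (forall i, measurable (A i)) ->
  measurable (\bigcap_(i in [set` s]) X i @^-1` A i).
Proof.
move=> mA; rewrite bigcap_seq; elim: s => [|i s IH]; first by rewrite big_nil.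
by rewrite big_cons; apply: measurableI => //; exact: measurable_funPTI.
Qed.

Let int_ind s A : (forall i, measurable (A i)) ->
  (\int[P]_w (ind s A w)%:E = P (\bigcap_(i in [set` s]) X i @^-1` A i))%E.
Proof.
move=> mA; rewrite (eq_integral (fun w => (\1_(\bigcap_(i in [set` s]) X i @^-1` A i) w)%:E)).
  by rewrite integral_indic ?setIT//; exact: measurable_bigcap.
by move=> w _; rewrite ind_bigcap.
Qed.

(* Knowing E[I_s exp(i <t, X_r>)] for all finite disjoint s, r interpolates between the
   joint characteristic function (s empty) and independence (r empty). *)
Let mixed s A r :=
  \int[P]_w (ind s A w * cos (lincomb r w)) = (\prod_(i <- s) pr A i) * chf r /\
  \int[P]_w (ind s A w * sin (lincomb r w)) = 0.

Let integrable_trig s A r i (g : R -> R) : (forall i, measurable (A i)) -> bounded_measurable g ->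
  P.-integrable setT (EFin \o (fun w => ind s A w * cos (lincomb r w) * g (X i w))) /\
  P.-integrable setT (EFin \o (fun w => ind s A w * sin (lincomb r w) * g (X i w))).
Proof.
by move=> mA bg; have [w1 w2] := weighted_trig s r i mA; split;
   [exact: weighted_integrable w1 bg | exact: weighted_integrable w2 bg].
Qed.

(** Induction on [s]. The hypothesis for [(i, u) :: r] and [(i, -u) :: r] gives the characteristic
    function of [X i] under the weights [ind s' A * cos (lincomb r)] and
    [ind s' A * sin (lincomb r)]; it is that of [X i] under a constant weight. [wexp_indic_unique]
    then puts the indicator of [A i] in place of the exponential. *)
Lemma cgauss_independent :
  (forall r, uniq [seq q.1 | q <- r] -> cgauss P (lincomb r) (linvar r)) ->
  independent_RVs X.
Proof.
move=> gX s A us mA.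
suff mix : forall s r, uniq (s ++ [seq q.1 | q <- r]) -> mixed s A r.
  have us0 : uniq (s ++ [seq q.1 | q <- [::] : seq (I * R)]) by rewrite cats0.
  have [+ _] := mix s [::] us0.
  have -> : chf [::] = 1 by rewrite /chf /linvar big_nil oppr0 mul0r expR0.
  have -> : \int[P]_w (ind s A w * cos (lincomb [::] w)) = \int[P]_w ind s A w.
    by apply: eq_Rintegral => w _; rewrite /lincomb big_nil cos0 mulr1.
  rewrite mulr1 /Rintegral int_ind// => {}E.
  have mi i : measurable (X i @^-1` A i) by exact: measurable_funPTI.
  rewrite -[LHS]fineK; last first.
    by rewrite fin_num_measure//; exact: measurable_bigcap.
  rewrite E -prodEFin; apply: eq_bigr => i _; rewrite fineK// fin_num_measure//.
elim=> [|i s' IH] r /=.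
  move=> ur; have [E1 E2] := gX r ur 1.
  rewrite /mixed big_nil mul1r; split.
    rewrite expr1n mul1r in E1; rewrite -[RHS]E1.
    by apply: eq_Rintegral => w _; rewrite /ind big_nil !mul1r.
  rewrite -[RHS]E2.
  by apply: eq_Rintegral => w _; rewrite /ind big_nil !mul1r.
move=> /andP[i_notin ur].
have ur' u : uniq (s' ++ [seq q.1 | q <- (i, u) :: r]).
  by rewrite /= -cat1s uniq_catCA/= i_notin.
have chf_cons u : chf ((i, u) :: r) = chf r * expR (- (u ^+ 2 * v i) / 2).
  by rewrite /chf /linvar big_cons/= -expRD; congr expR; field.
have [w1 w2] := weighted_trig s' r i mA.
have [Er1 Er2] := IH r ur.
have lc (u : R) w : lincomb ((i, u) :: r) w = u * X i w + lincomb r w by exact: lincomb_cons.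
have Xi u : \int[P]_w cos (u * X i w) = expR (- (u ^+ 2 * v i) / 2) /\
    \int[P]_w sin (u * X i w) = 0.
  have [] := gX [:: (i, 1)] isT u.
  rewrite /linvar big_seq1/= expr1n mul1r => <- e2; split.
    by apply: eq_Rintegral => w _; rewrite /lincomb big_seq1/= mul1r.
  by rewrite -[RHS]e2; apply: eq_Rintegral => w _; rewrite /lincomb big_seq1/= mul1r.
have int1 r0 : P.-integrable setT (EFin \o (fun w => ind s' A w * cos (lincomb r0 w))) /\
    P.-integrable setT (EFin \o (fun w => ind s' A w * sin (lincomb r0 w))).
  have [mc ms] := measurable_trig_lincomb r0; have mI := measurable_ind s' mA.
  split; (apply: bounded_integrable; first exact: measurable_funM); exists 1 => w;
    by rewrite normrM mulr_ile1 ?ind_le1 ?norm_cos_le1 ?norm_sin_le1.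
(* Product-to-sum formulas: each weighted trigonometric moment of [X i] is half a sum or difference
   of moments at [u] and at [-u]. *)
have pts (f g1 g2 : T -> R) (c : R) :
   P.-integrable setT (EFin \o g1) -> P.-integrable setT (EFin \o g2) ->
   (forall w, f w = 2^-1 * (g1 w + c * g2 w)) ->
   \int[P]_w f w = 2^-1 * (\int[P]_w g1 w + c * \int[P]_w g2 w).
  move=> i1 i2 fE; have i3 := integrable_mulr measurableT c i2.
  have i4 := integrable_addr measurableT i1 i3.
  have -> : c * \int[P]_w g2 w = \int[P]_w (c * g2 w) by rewrite RintegralZl.
  rewrite -RintegralD// -RintegralZl//.
  by apply: eq_Rintegral => w _; rewrite fE.
have cosE (u : R) : wexp P (fun w => ind s' A w * cos (lincomb r w)) (X i) (fun x => cos (u * x)) =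
    (\prod_(i <- s') pr A i) * chf r * expR (- (u ^+ 2 * v i) / 2).
  have [a1 _] := IH _ (ur' u); have [a2 _] := IH _ (ur' (- u)).
  rewrite /wexp (pts _ _ _ 1 (int1 ((i, u) :: r)).1 (int1 ((i, - u) :: r)).1).
    by rewrite a1 a2 !chf_cons sqrrN; field.
  by move=> w; rewrite !lc mulNr !cosD cosN sinN; field.
have cosS (u : R) : wexp P (fun w => ind s' A w * cos (lincomb r w)) (X i) (fun x => sin (u * x)) = 0.
  have [_ a1] := IH _ (ur' u); have [_ a2] := IH _ (ur' (- u)).
  rewrite /wexp (pts _ _ _ (-1) (int1 ((i, u) :: r)).2 (int1 ((i, - u) :: r)).2).
    by rewrite a1 a2; ring.
  by move=> w; rewrite !lc !mulNr !sinD !sinN !cosN; field.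
have sinE (u : R) : wexp P (fun w => ind s' A w * sin (lincomb r w)) (X i) (fun x => cos (u * x)) = 0.
  have [_ a1] := IH _ (ur' u); have [_ a2] := IH _ (ur' (- u)).
  rewrite /wexp (pts _ _ _ 1 (int1 ((i, u) :: r)).2 (int1 ((i, - u) :: r)).2).
    by rewrite a1 a2; ring.
  by move=> w; rewrite !lc !mulNr !sinD !sinN !cosN; field.
have sinS (u : R) : wexp P (fun w => ind s' A w * sin (lincomb r w)) (X i) (fun x => sin (u * x)) = 0.
  have [a1 _] := IH _ (ur' u); have [a2 _] := IH _ (ur' (- u)).
  rewrite /wexp (pts _ _ _ (-1) (int1 ((i, - u) :: r)).1 (int1 ((i, u) :: r)).1).
    by rewrite a1 a2 !chf_cons sqrrN; ring.
  by move=> w; rewrite !lc !mulNr !cosD !sinN !cosN; field.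
have mi := mA i.
have bI : bounded_measurable (\1_(A i) : R -> R).
  by split=> //; exists 1 => x; rewrite indicE; case: (_ \in _); rewrite ?normr1 ?normr0.
have indicE' w : ind (i :: s') A w = \1_(A i) (X i w) * ind s' A w by rewrite /ind big_cons.
split.
- have E : wexp P (fun w => ind s' A w * cos (lincomb r w)) (X i) \1_(A i) =
      wexp P (fun=> \prod_(i <- s') pr A i * chf r) (X i) \1_(A i).
    apply: wexp_indic_unique => // u; rewrite wexp_cst//.
      by rewrite cosE (Xi u).1.
    by rewrite cosS (Xi u).2 mulr0.
  rewrite wexp_cst// int_indic// in E.
  rewrite big_cons (_ : pr A i * _ * chf r = \prod_(i <- s') pr A i * chf r * pr A i); last by ring.
  by rewrite -E; apply: eq_Rintegral => w _; rewrite indicE'; ring.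
- have E : wexp P (fun w => ind s' A w * sin (lincomb r w)) (X i) \1_(A i) =
      wexp P (fun=> 0) (X i) \1_(A i).
    apply: wexp_indic_unique => // u; rewrite wexp_cst// mul0r.
      exact: sinE.
    exact: sinS.
  rewrite wexp_cst// mul0r in E.
  by rewrite -[RHS]E; apply: eq_Rintegral => w _; rewrite indicE'; ring.
Qed.

(** The reverse exchange, by induction on [r]: an arbitrary set placed at the index [i] identifies
    the weighted law of [X i], [wexp_bounded_unique] passes to cosines and sines, and the addition
    formulas rebuild the combination. *)
Lemma independent_cgauss : independent_RVs X -> (forall i, cgauss P (X i) (v i)) ->
  forall r, uniq [seq q.1 | q <- r] -> cgauss P (lincomb r) (linvar r).
Proof.
move=> indX gX.
suff mix : forall r s A, (forall i, measurable (A i)) -> uniq (s ++ [seq q.1 | q <- r]) -> mixed s A r.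
  move=> r ur t.
  (* [mixed] is stated at frequency 1, so [t] is absorbed into the coefficients. *)
  pose r' := [seq (q.1, t * q.2) | q <- r].
  have ur' : uniq [seq q.1 | q <- r'] by rewrite -map_comp.
  have lr w : lincomb r' w = t * lincomb r w.
    by rewrite /lincomb big_map mulr_sumr; apply: eq_bigr => q _; rewrite mulrA.
  have [E1 E2] := mix r' [::] (fun=> setT) (fun=> measurableT) ur'.
  split.
    transitivity (\int[P]_w (ind [::] (fun=> setT) w * cos (lincomb r' w))).
      by apply: eq_Rintegral => w _; rewrite /ind big_nil mul1r lr.
    have -> : t ^+ 2 * linvar r = linvar r'.
      by rewrite /linvar big_map mulr_sumr; apply: eq_bigr => q _; rewrite exprMn mulrA.
    by rewrite E1 big_nil mul1r.
  rewrite -[RHS]E2; apply: eq_Rintegral => w _; rewrite /ind big_nil mul1r lr//.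
elim=> [|[i u] r IH] s A mA.
  rewrite cats0 => us; split; last first.
    rewrite -[RHS](Rintegral_prob_cst P); apply: eq_Rintegral => w _.
    by rewrite /lincomb big_nil sin0 mulr0.
  have -> : chf [::] = 1 by rewrite /chf /linvar big_nil oppr0 mul0r expR0.
  have -> : \int[P]_w (ind s A w * cos (lincomb [::] w)) = \int[P]_w ind s A w.
    by apply: eq_Rintegral => w _; rewrite /lincomb big_nil cos0 mulr1.
  rewrite mulr1 /Rintegral int_ind// indX//.
  rewrite (eq_bigr (fun i => (pr A i)%:E)); first by rewrite prodEFin.
  by move=> i _; rewrite fineK// fin_num_measure//; exact: measurable_funPTI.
rewrite /= => ur.
have [uir us] : uniq (i :: s ++ [seq q.1 | q <- r]) /\ uniq (s ++ [seq q.1 | q <- r]).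
  by move: ur; rewrite -cat1s uniq_catCA/= => /andP[-> ->].
have [w1 w2] := weighted_trig s r i mA.
have [Er1 Er2] := IH s A mA us.
have key (B : set R) : measurable B ->
   wexp P (fun w => ind s A w * cos (lincomb r w)) (X i) \1_B =
     wexp P (fun=> \prod_(i <- s) pr A i * chf r) (X i) \1_B /\
   wexp P (fun w => ind s A w * sin (lincomb r w)) (X i) \1_B = wexp P (fun=> 0) (X i) \1_B.
  (* Overwriting the set at [i] leaves the other factors alone, because [i] does not occur in
     [s]. *)
  move=> mB; pose A' j := if j == i then B else A j.
  have mA' j : measurable (A' j) by rewrite /A'; case: ifP.
  have i_notin : i \notin s by move: uir; rewrite /= mem_cat negb_or -andbA => /andP[].
  have indA' w : ind (i :: s) A' w = \1_B (X i w) * ind s A w.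
    rewrite /ind big_cons {1}/A' eqxx; congr (_ * _).
    by apply: eq_big_seq => j js; rewrite /A'; case: eqP => // ji; move: js i_notin; rewrite ji => ->.
  have bB : bounded_measurable (\1_B : R -> R).
    by split=> //; exists 1 => x; rewrite indicE; case: (_ \in _); rewrite ?normr1 ?normr0.
  have [e1 e2] := IH (i :: s) A' mA' uir.
  rewrite !wexp_cst// mul0r; split.
    transitivity (\int[P]_w (ind (i :: s) A' w * cos (lincomb r w))).
      by apply: eq_Rintegral => w _; rewrite indA'; ring.
    rewrite e1 big_cons.
    have -> : \int[P]_w \1_B (X i w) = pr A' i.
      by rewrite -int_indic//; apply: eq_Rintegral => w _; rewrite /A' eqxx.
    have -> : \prod_(j <- s) pr A' j = \prod_(j <- s) pr A j.
      apply: eq_big_seq => j js; rewrite /pr /A'; case: eqP => // ji.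
      by move: js i_notin; rewrite ji => ->.
    ring.
  rewrite -[RHS]e2; apply: eq_Rintegral => w _; rewrite indA'; ring.
have chf_cons : chf ((i, u) :: r) = chf r * expR (- (u ^+ 2 * v i) / 2).
  by rewrite /chf /linvar big_cons/= -expRD; congr expR; field.
have uc := @wexp_bounded_unique R _ _ _ _ P P _ _ _ _ w1 (weighted_cst _ i) (fun B mB => (key B mB).1).
have uss := @wexp_bounded_unique R _ _ _ _ P P _ _ _ _ w2 (weighted_cst _ i) (fun B mB => (key B mB).2).
have [cX sX] := gX i u.
have cc := uc _ (bounded_cos u); have cs := uc _ (bounded_sin u).
have sc := uss _ (bounded_cos u); have ss := uss _ (bounded_sin u).
rewrite wexp_cst// cX in cc; rewrite wexp_cst// sX mulr0 in cs.
rewrite wexp_cst// mul0r in sc; rewrite wexp_cst// mul0r in ss.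
have [Icc Isc] := integrable_trig s r i mA (bounded_cos u).
have [Ics Iss] := integrable_trig s r i mA (bounded_sin u).
split.
- transitivity (\int[P]_w (ind s A w * cos (lincomb r w) * cos (u * X i w) -
     ind s A w * sin (lincomb r w) * sin (u * X i w))).
    by apply: eq_Rintegral => w _; rewrite lincomb_cons/= cosD; ring.
  by rewrite RintegralB// [X in X - _]cc [X in _ - X]ss subr0 chf_cons mulrA.
- transitivity (\int[P]_w (ind s A w * cos (lincomb r w) * sin (u * X i w) +
     ind s A w * sin (lincomb r w) * cos (u * X i w))).
    by apply: eq_Rintegral => w _; rewrite lincomb_cons/= sinD; ring.
  by rewrite RintegralD// [X in X + _]cs [X in _ + X]sc addr0.
Qed.
End independence.

(** * Mean-square integrals of processes on a graph *)

Section dyadic_riemann_sums.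
Context {R : realType} (G : metric_graph R).
Local Notation mu := (@lebesgue_measure R).

Lemma sum_halves (V : nmodType) (f : nat -> V) N :
  \sum_(0 <= j < N.*2) f j = \sum_(0 <= i < N) (f i.*2 + f i.*2.+1).
Proof.
elim: N => [|N IH]; first by rewrite !big_geq.
by rewrite doubleS !big_nat_recr//= IH addrA.
Qed.

Definition mesh (e : edge G) n : R := len e / 2 ^+ n.

Definition node (e : edge G) n i : R := i%:R * mesh e n.

Lemma mesh_ge0 e n : 0 <= mesh e n.
Proof. by rewrite divr_ge0 ?exprn_ge0// ltW ?len_gt0. Qed.

Lemma mesh_half e n : mesh e n.+1 = mesh e n / 2.
Proof. by rewrite /mesh exprS; field; rewrite expf_neq0. Qed.

Lemma node0 e n : node e n 0 = 0.
Proof. by rewrite /node mul0r. Qed.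

Lemma node_last e n : node e n (2 ^ n) = len e.
Proof. by rewrite /node /mesh natrX mulrC divfK// expf_neq0. Qed.

Lemma nodeS e n i : node e n i.+1 - node e n i = mesh e n.
Proof. by rewrite /node -natr1; ring. Qed.

Lemma node_double e n i : node e n.+1 i.*2 = node e n i.
Proof. by rewrite /node mesh_half -muln2 natrM; field. Qed.

Lemma node_range e n i : (i <= 2 ^ n)%N -> 0 <= node e n i <= len e.
Proof.
move=> i2; rewrite mulr_ge0 ?mesh_ge0//= -[leRHS](node_last e n).
by rewrite ler_wpM2r ?mesh_ge0// ler_nat.
Qed.

Lemma mesh_cvg0 e : mesh e n @[n --> \oo] --> (0 : R).
Proof.
rewrite (_ : mesh e = geometric (len e) 2^-1); last first.
  by apply/funext => n; rewrite /mesh /geometric/= exprVn.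
by apply: cvg_geometric; rewrite ger0_norm//; lra.
Qed.

Definition cells n : seq (edge G * nat) := [seq (e, i) | e <- enum (edge G), i <- iota 0 (2 ^ n)].

Lemma sum_cells (V : nmodType) (f : edge G -> nat -> V) n :
  \sum_(q <- cells n) f q.1 q.2 = \sum_e \sum_(0 <= i < 2 ^ n) f e i.
Proof.
rewrite /cells big_allpairs_dep big_enum/=; apply: eq_bigr => e _.
by rewrite /index_iota subn0.
Qed.

Variable phi : edge G -> R -> R.
Hypothesis cphi : forall e, {within `[0, len e], continuous (phi e)}.

(** An integral of [phi] over the cell rather than a value times the mesh: it is exactly additive
    under halving, so refining a Riemann sum changes it only through increments of the process. *)
Definition cell_weight n (e : edge G) i : R :=
  \int[mu]_(t in `[0, node e n i.+1]) phi e t - \int[mu]_(t in `[0, node e n i]) phi e t.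

Lemma cell_weight_halves n e i :
  cell_weight n.+1 e i.*2 + cell_weight n.+1 e i.*2.+1 = cell_weight n e i.
Proof. by rewrite /cell_weight -doubleS !node_double; ring. Qed.

Let iphi e : mu.-integrable `[0, len e] (EFin \o phi e).
Proof. exact/L2_segment_integrable/L2_segment_continuous. Qed.

Let subint e (g : R -> R) n i : mu.-integrable `[0, len e] (EFin \o g) -> (i < 2 ^ n)%N ->
  [/\ mu.-integrable `[0, node e n i.+1] (EFin \o g),
      mu.-integrable `]node e n i, node e n i.+1] (EFin \o g) &
  \int[mu]_(t in `[0, node e n i.+1]) g t - \int[mu]_(t in `[0, node e n i]) g t =
  \int[mu]_(t in `]node e n i, node e n i.+1]) g t].
Proof.
move=> gi i2.
have /andP[a0 a1] := node_range e (ltnW i2); have /andP[b0 b1] := node_range e (n := n) i2.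
have ab : node e n i <= node e n i.+1 by rewrite -subr_ge0 nodeS mesh_ge0.
have i1 : mu.-integrable `[0, node e n i.+1] (EFin \o g).
  by apply: (integrableS _ _ _ gi) => //; apply: subset_itvl; rewrite bnd_simp.
split=> //; last by apply: Rintegral_itvB; rewrite ?bnd_simp.
by apply: (integrableS _ _ _ gi) => //; apply: subset_itv; rewrite bnd_simp.
Qed.

Lemma cell_weight_le e : exists2 M : R, 0 < M & forall n i, (i < 2 ^ n)%N ->
  `|cell_weight n e i| <= M * mesh e n.
Proof.
have [M M0 HM] := within_continuous_bounded (ltW (len_gt0 e)) (@cphi e).
exists M => // n i i2; have [_ I2 E] := subint (iphi e) i2; rewrite /cell_weight E.
have /andP[a0 a1] := node_range e (ltnW i2); have /andP[b0 b1] := node_range e (n := n) i2.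
have ab : node e n i <= node e n i.+1 by rewrite -subr_ge0 nodeS mesh_ge0.
rewrite (le_trans (le_normr_Rintegral _ _))//.
have [_ Ic _] := subint (segment_integrable_cst (len e) M) i2.
rewrite -(nodeS e n i) -(fine_lebesgue_oc ab) -Rintegral_cst//.
apply: le_Rintegral => //; first exact: (integrable_normr I2).
move=> t; rewrite /= in_itv/= => /andP[t1 t2]; apply: HM.
by rewrite (le_trans a0 (ltW t1)) (le_trans t2 b1).
Qed.

Lemma riemann_edge_cvg e (g : R -> R) : abs_continuous (len e) g ->
  \sum_(0 <= i < 2 ^ n) cell_weight n e i * g (node e n i) @[n --> \oo] -->
  \int[mu]_(t in `[0, len e]) (g t * phi e t).
Proof.
move=> Ag; have l0 := len_gt0 e.
have [M M0 HM] := within_continuous_bounded (ltW l0) (@cphi e).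
have Lg := L2_segment_continuous (abs_continuous_continuous Ag).
have igp := L2_segment_mul Lg (L2_segment_continuous (@cphi e)).
apply/cvgrPdist_le => eps eps0.
(* Each cell contributes an error of at most [eta * M] times its length, and the lengths add up to
   [len e]. *)
pose eta := eps / (M * len e); have eta0 : 0 < eta by rewrite divr_gt0// mulr_gt0.
have [dl dl0 Hdl] := Ag _ eta0.
have /cvgrPdist_lt/(_ _ dl0)[n0 _ Hn0] := mesh_cvg0 e.
exists n0 => // n n0n; have := Hn0 n n0n; rewrite /= sub0r normrN ger0_norm ?mesh_ge0// => hdl.
pose J i := \int[mu]_(t in `[0, node e n i]) (g t * phi e t).
have -> : \int[mu]_(t in `[0, len e]) (g t * phi e t) = \sum_(0 <= i < 2 ^ n) (J i.+1 - J i).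
  by rewrite telescope_sumr// /J node_last node0 set_itv1 Rintegral_set1 subr0.
rewrite -sumrB; apply: le_trans (ler_norm_sum _ _ _) _.
apply: (@le_trans _ _ (\sum_(0 <= i < 2 ^ n) eta * M * mesh e n)); last first.
  rewrite sumr_const_nat subn0 -mulr_natr natrX /mesh /eta le_eqVlt; apply/orP; left; apply/eqP.
  by field; rewrite !gt_eqF ?exprn_gt0.
apply: ler_sum_nat => i /andP[_ i2].
have [_ I1 E1] := subint igp i2; have [_ I2 E2] := subint (iphi e) i2.
rewrite /J E1 /cell_weight E2 mulrC.
have /andP[a0 a1] := node_range e (ltnW i2); have /andP[b0 b1] := node_range e (n := n) i2.
have ab : node e n i <= node e n i.+1 by rewrite -subr_ge0 nodeS mesh_ge0.
have I3 := integrable_mulr (measurable_itvR `]node e n i, node e n i.+1]) (g (node e n i)) I2.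
rewrite -RintegralZl// -RintegralB//.
rewrite (le_trans (le_normr_Rintegral _ _))//; first exact: (integrable_subr _ I1 I3).
have [_ Ic _] := subint (segment_integrable_cst (len e) (eta * M)) i2.
rewrite -(nodeS e n i) -(fine_lebesgue_oc ab) -Rintegral_cst//.
apply: le_Rintegral => //.
  exact: (integrable_normr (integrable_subr (measurable_itvR _) I1 I3)).
move=> t; rewrite /= in_itv/= => /andP[t1 t2].
rewrite -mulrBl normrM ler_pM//; last first.
  by apply: HM; rewrite (le_trans a0 (ltW t1)) (le_trans t2 b1).
(* Absolute continuity for a single interval is uniform continuity. *)
apply: ltW; have := Hdl 1%N (fun=> node e n i) (fun=> t); rewrite !big_ord1; apply.
- by move=> _; rewrite a0 (ltW t1) (le_trans t2 b1).
- by move=> j k _ _ _; rewrite !ord1.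
- by rewrite (le_lt_trans _ hdl)// -(nodeS e n i) lerB.
Qed.

Lemma riemann_graph_cvg (f : gpoint G -> R) : (forall e, abs_continuous (len e) (edge_fun f e)) ->
  \sum_(q <- cells n) cell_weight n q.1 q.2 * f (edge_point q.1 (node q.1 n q.2))
    @[n --> \oo] --> edge_ip (edge_fun f) phi.
Proof.
move=> Af; under eq_fun do
  rewrite (sum_cells (fun e i => cell_weight _ e i * f (edge_point e (node e _ i)))).
apply: (cvg_sumr (F := fun e n => \sum_(0 <= i < 2 ^ n) cell_weight n e i * f (edge_point e (node e n i)))) => e.
exact: riemann_edge_cvg (Af e).
Qed.
End dyadic_riemann_sums.

Section square_integrable_moments.
Context {R : realType} {d : measure_display} {T : measurableType d} (P : probability T R).
Implicit Types (X Y : T -> R).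

Lemma ip_sqr X : ip P X X = \int[P]_w X w ^+ 2.
Proof. by apply: eq_Rintegral => w _; rewrite expr2. Qed.

Lemma integral_L2 X Y : L2 P X -> L2 P Y -> (\int[P]_w (X w * Y w)%:E = (ip P X Y)%:E)%E.
Proof.
move=> LX LY; rewrite /ip /Rintegral fineK//.
exact: (integrable_fin_num measurableT (L2_mul LX LY)).
Qed.

Lemma expectation_sqr X : L2 P X -> ('E_P[fun w => (X w ^+ 2)%R] = (ip P X X)%:E)%E.
Proof.
move=> LX; rewrite unlock -(integral_L2 LX LX).
by apply: eq_integral => w _; rewrite expr2.
Qed.

Lemma expectation_sqr_L2 X : measurable_fun setT X ->
  ('E_P[fun w => (X w ^+ 2)%R] < +oo)%E -> L2 P X.
Proof.
move=> mX; rewrite unlock => fX; split=> //; apply/integrableP; split.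
  by apply/measurable_EFinP; exact: measurable_funX.
rewrite (eq_integral (fun w => (X w ^+ 2)%:E))//.
by move=> w _; rewrite /= ger0_norm ?sqr_ge0.
Qed.

Lemma expectation0_Rintegral X : 'E_P[X]%E = 0%E -> \int[P]_w X w = 0.
Proof. by rewrite unlock /Rintegral => ->. Qed.

Lemma Rintegral0_expectation X : L2 P X -> \int[P]_w X w = 0 -> 'E_P[X]%E = 0%E.
Proof.
move=> LX E; rewrite unlock -(fineK (integrable_fin_num measurableT (L2_integrable LX))).
by rewrite -/(Rintegral P setT X) E.
Qed.

Lemma covariance_centred X Y : 'E_P[X]%E = 0%E -> 'E_P[Y]%E = 0%E ->
  (covariance P X Y = \int[P]_w (X w * Y w)%:E)%E.
Proof.
move=> EX EY; rewrite unlock EX EY unlock.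
by apply: eq_integral => w _; rewrite -[LHS]/(((X w - 0) * (Y w - 0))%:E) !subr0.
Qed.

Lemma ip_diag_cvg (X_ : nat -> T -> R) X : (forall n, L2 P (X_ n)) -> L2 P X ->
  ip P (fun w => X_ n w - X w) (fun w => X_ n w - X w) @[n --> \oo] --> (0 : R) ->
  ip P (X_ n) (X_ n) @[n --> \oo] --> ip P X X.
Proof.
move=> LX_ LX c0; have c1 := ip_cvgl LX_ LX c0 LX.
have -> : (fun n => ip P (X_ n) (X_ n)) = (fun n =>
    ip P (fun w => X_ n w - X w) (fun w => X_ n w - X w) + 2 * ip P (X_ n) X - ip P X X).
  by apply/funext => n; rewrite ip_sqrB//; ring.
rewrite [X in _ --> X](_ : ip P X X = 0 + 2 * ip P X X - ip P X X); last by ring.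
apply: cvgB; last exact: cvg_cst.
by apply: cvgD => //; apply: cvgM => //; exact: cvg_cst.
Qed.

Lemma ip_wsum_cvg (I : Type) (s : seq I) (c : I -> R) (X_ : nat -> I -> T -> R) (X : I -> T -> R) :
  (forall n i, L2 P (X_ n i)) -> (forall i, L2 P (X i)) ->
  (forall i, ip P (fun w => X_ n i w - X i w) (fun w => X_ n i w - X i w) @[n --> \oo] --> (0 : R)) ->
  let D n w := \sum_(i <- s) c i * X_ n i w - \sum_(i <- s) c i * X i w in
  ip P (D n) (D n) @[n --> \oo] --> (0 : R).
Proof.
move=> LX_ LX cX; cbv zeta.
have LD n i : L2 P (fun w => X_ n i w - X i w) by exact: L2B.
apply: (@squeeze_norm_cvg _ _ (fun n => (\sum_(i <- s) `|c i|) *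
    \sum_(i <- s) `|c i| * ip P (fun w => X_ n i w - X i w) (fun w => X_ n i w - X i w))).
  move=> n; rewrite subr0 ger0_norm ?ip_ge0//.
  have LS : L2 P (fun w => \sum_(i <- s) c i * (X_ n i w - X i w)).
    exact: (L2_wsum s c (LD n)).
  have -> : (fun w => \sum_(i <- s) c i * X_ n i w - \sum_(i <- s) c i * X i w) =
      (fun w => \sum_(i <- s) c i * (X_ n i w - X i w)).
    by apply/funext => w; rewrite -sumrB; apply: eq_bigr => i _; rewrite mulrBr.
  have I1 i : P.-integrable setT (EFin \o (fun w => `|c i| * ((X_ n i w - X i w) ^+ 2))).
    by apply: integrable_mulr => //; case: (LD n i).
  have -> : \sum_(i <- s) `|c i| * ip P (fun w => X_ n i w - X i w) (fun w => X_ n i w - X i w) =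
      \int[P]_w \sum_(i <- s) (`|c i| * (X_ n i w - X i w) ^+ 2).
    rewrite Rintegral_sum//; apply: eq_bigr => i _.
    by rewrite ip_sqr RintegralZl//; case: (LD n i).
  have I2 := integrable_sumr measurableT s I1.
  rewrite -RintegralZl//; apply: le_Rintegral => //.
  - exact: L2_mul.
  - exact: integrable_mulr.
  - by move=> w _; rewrite -expr2; exact: sqr_wsum_le.
rewrite -[X in _ --> X](mulr0 (\sum_(i <- s) `|c i|)); apply: cvgM; first exact: cvg_cst.
rewrite [X in _ --> X](_ : _ = \sum_(i <- s) `|c i| * 0); last first.
  by rewrite big1// => i _; rewrite mulr0.
by apply: cvg_sumr => i; apply: cvgM => //; exact: cvg_cst.
Qed.
End square_integrable_moments.

(** * The mean-square integral of a process against a continuous function *)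

Section process_integral.
Context {R : realType} (G : metric_graph R).
Context {d : measure_display} {T : measurableType d} (P : probability T R).
Variables (Z : gpoint G -> T -> R) (kappa : R).
Hypothesis LZ : forall x, L2 P (Z x).
Hypothesis kappa0 : 0 <= kappa.
Hypothesis Z_increment : forall e (t s : R), 0 <= t <= len e -> 0 <= s <= len e ->
  ip P (fun w => Z (edge_point e t) w - Z (edge_point e s) w)
       (fun w => Z (edge_point e t) w - Z (edge_point e s) w) <= kappa * `|t - s|.
Variable phi : edge G -> R -> R.
Hypothesis cphi : forall e, {within `[0, len e], continuous (phi e)}.

Definition riemann n : T -> R := fun w =>
  \sum_(q <- cells G n) cell_weight phi n q.1 q.2 * Z (edge_point q.1 (node q.1 n q.2)) w.

Lemma L2_riemann n : L2 P (riemann n).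
Proof.
exact: (@L2_wsum _ _ _ P _ (cells G n) (fun q => cell_weight phi n q.1 q.2)
  (fun q => Z (edge_point q.1 (node q.1 n q.2)))).
Qed.

Let refine n (q : edge G * nat) w :=
  Z (edge_point q.1 (node q.1 n.+1 q.2.*2.+1)) w - Z (edge_point q.1 (node q.1 n q.2)) w.

(** The left half of a cell keeps the node of the cell, so only the right half contributes. *)
Let riemann_increment n w : riemann n.+1 w - riemann n w =
  \sum_(q <- cells G n) cell_weight phi n.+1 q.1 q.2.*2.+1 * refine n q w.
Proof.
rewrite /riemann.
rewrite (sum_cells (fun e i => cell_weight phi n.+1 e i * Z (edge_point e (node e n.+1 i)) w)).
rewrite (sum_cells (fun e i => cell_weight phi n e i * Z (edge_point e (node e n i)) w)).
rewrite (sum_cells (fun e i => cell_weight phi n.+1 e i.*2.+1 * refine n (e, i) w)).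
rewrite -sumrB; apply: eq_bigr => e _; rewrite expnS mul2n sum_halves -sumrB.
apply: eq_bigr => i _; rewrite /refine/= node_double -(cell_weight_halves phi n e i); ring.
Qed.

Let weight_bound : exists2 M : R, 0 <= M & forall n e i, (i < 2 ^ n)%N ->
  `|cell_weight phi n e i| <= M * mesh e n.
Proof.
have H e : exists M : R, 0 < M /\ forall n i, (i < 2 ^ n)%N ->
    `|cell_weight phi n e i| <= M * mesh e n.
  by have [M M0 HM] := cell_weight_le (@cphi) e; exists M.
have [M HM] := choice H; exists (\sum_e M e).
  by apply: sumr_ge0 => e _; rewrite ltW// (HM e).1.
move=> n e i i2; apply: le_trans ((HM e).2 n i i2) _.
rewrite ler_wpM2r ?mesh_ge0// (bigD1 e)//= lerDl.
by apply: sumr_ge0 => e' _; rewrite ltW// (HM e').1.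
Qed.

Lemma process_integral : exists2 X, L2 P X &
  ip P (fun w => riemann n w - X w) (fun w => riemann n w - X w) @[n --> \oo] --> (0 : R).
Proof.
have [M M0 HM] := weight_bound.
pose L : R := \sum_(e : edge G) len e.
have len_ge0 (e : edge G) : 0 <= len e by rewrite ltW ?len_gt0.
have L0 : 0 <= L by exact: sumr_ge0.
have eL (e : edge G) : len e <= L by rewrite /L (bigD1 e)//= lerDl sumr_ge0.
(* Each factor [M * L] bounds the sum of the absolute weights, and [kappa * L * 2^-n] bounds the
   mean square of the increment of [Z] across half a cell. *)
apply: (@L2_complete _ _ _ _ _ ((M * L) * ((M * L) * (kappa * L))) L2_riemann) => n.
pose c (q : edge G * nat) := cell_weight phi n.+1 q.1 q.2.*2.+1.
have -> : (fun w => riemann n.+1 w - riemann n w) =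
    (fun w => \sum_(q <- cells G n) c q * refine n q w).
  by apply/funext => w; exact: riemann_increment.
have in_cells q : q \in cells G n -> (q.2 < 2 ^ n)%N.
  by case/allpairsP => -[e i] /= [_ + ->]; rewrite mem_iota.
have Lr q : L2 P (refine n q) by exact: L2B.
have mesh_le (e : edge G) : mesh e n.+1 <= L * 2^-1 ^+ n.
  rewrite mesh_half /mesh -exprVn ler_pdivrMr// -mulrA; apply: ler_pM => //.
  by rewrite ler_peMr ?exprn_ge0// ler1n.
have c_sum : \sum_(q <- cells G n) `|c q| <= M * L.
  apply: (@le_trans _ _ (\sum_(q <- cells G n) M * (mesh q.1 n))).
    rewrite big_seq [leRHS]big_seq; apply: ler_sum => q /in_cells q2.
    apply: le_trans (HM _ _ _ _) _; first by rewrite expnS mul2n -doubleS leq_double.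
    rewrite ler_wpM2l// mesh_half ler_pdivrMr// ler_peMr ?mesh_ge0// ler1n//.
  rewrite (sum_cells (fun e _ => M * mesh e n)) mulr_sumr; apply: ler_sum => e _.
  rewrite sumr_const_nat subn0 -mulr_natr natrX /mesh.
  by rewrite -mulrA divfK// expf_neq0.
have ref_le q : q \in cells G n -> ip P (refine n q) (refine n q) <= kappa * L * 2^-1 ^+ n.
  move=> /in_cells q2; apply: le_trans (Z_increment _ _) _.
  - by apply: node_range; rewrite expnS mul2n ltn_double.
  - by apply: node_range; rewrite ltnW.
  rewrite -mulrA ler_wpM2l// -(node_double _ n q.2) nodeS ger0_norm ?mesh_ge0//.
have I1 q : P.-integrable setT (EFin \o (fun w => `|c q| * (refine n q w ^+ 2))).
  by apply: integrable_mulr => //; case: (Lr q).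
have I2 := integrable_sumr measurableT (cells G n) I1.
apply: (@le_trans _ _ ((\sum_(q <- cells G n) `|c q|) *
    \sum_(q <- cells G n) `|c q| * ip P (refine n q) (refine n q))).
  have -> : \sum_(q <- cells G n) `|c q| * ip P (refine n q) (refine n q) =
      \int[P]_w \sum_(q <- cells G n) (`|c q| * refine n q w ^+ 2).
    rewrite Rintegral_sum//; apply: eq_bigr => q _.
    by rewrite ip_sqr RintegralZl//; case: (Lr q).
  rewrite -RintegralZl//; apply: le_Rintegral => //.
  - by apply: L2_mul; exact: L2_wsum.
  - exact: integrable_mulr.
  - by move=> w _; rewrite -expr2; exact: sqr_wsum_le.
rewrite -mulrA; apply: ler_pM => //.
- exact: sumr_ge0.
- by apply: sumr_ge0 => q _; rewrite mulr_ge0 ?ip_ge0.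
apply: (@le_trans _ _ ((\sum_(q <- cells G n) `|c q|) * (kappa * L * 2^-1 ^+ n))).
  rewrite mulr_suml big_seq [leRHS]big_seq; apply: ler_sum => q qn.
  by rewrite ler_wpM2l// ref_le.
rewrite -[leRHS]mulrA ler_wpM2r// !mulr_ge0// exprn_ge0//.
Qed.
End process_integral.

(** * The spectral representation *)

Section gaussian_moments.
Context {R : realType} {d : measure_display} {T : measurableType d} (P : probability T R).

Lemma RV_of_measurable (X : T -> R) : measurable_fun setT X ->
  exists Y : {RV P >-> R}, (Y : T -> R) = X.
Proof.
by move=> mX; exists (HB.pack_for {mfun T >-> R} X (isMeasurableFun.Build _ _ _ _ X mX)).
Qed.

Lemma cgauss_moments (X : T -> R) v : measurable_fun setT X -> 0 <= v -> cgauss P X v ->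
  [/\ L2 P X, \int[P]_w X w = 0 & ip P X X = v].
Proof.
move=> mX v0 gX; have nX := cgauss_normal_law mX v0 gX.
have [_ X2 X1 E2] := normal_law_moments mX v0 nX.
by split=> //; rewrite ip_sqr E2 expr0n addr0.
Qed.

Lemma uniq_map_inj (A B : eqType) (f : A -> B) (s : seq A) : uniq [seq f x | x <- s] ->
  {in s &, injective f}.
Proof.
elim: s => //= a s IH /andP[fa us] x y; rewrite !inE.
move=> /predU1P[->|xs] /predU1P[->|ys]//.
- by move=> E; move: fa; rewrite E map_f.
- by move=> E; move: fa; rewrite -E map_f.
- exact: IH.
Qed.

Lemma ip_orthogonal (I : eqType) (s : seq I) (c : I -> R) (F : I -> T -> R) :
  uniq s -> (forall i, L2 P (F i)) ->
  {in s &, forall i j, i != j -> ip P (F i) (F j) = 0} ->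
  ip P (fun w => \sum_(i <- s) c i * F i w) (fun w => \sum_(i <- s) c i * F i w) =
  \sum_(i <- s) c i ^+ 2 * ip P (F i) (F i).
Proof.
move=> us LF F0; rewrite ip_wsum// big_seq [RHS]big_seq; apply: eq_bigr => i si.
rewrite (bigD1_seq i)//= -expr2 big_seq_cond big1 ?addr0// => j /andP[sj ji].
by rewrite F0 ?mulr0// eq_sym.
Qed.
End gaussian_moments.

Section spectral_representation.
Context {R : realType} (G : metric_graph R).
Context {d : measure_display} {T : measurableType d} (P : probability T R).
Variables (p : nat) (K : gpoint G -> gpoint G -> R).
Hypotheses (p1 : (1 <= p)%N) (rK : reproducing_kernel p K).
Variables (phi : nat -> gpoint G -> R) (lam : nat -> R).
Hypothesis hphi : laplace_eigenbasis phi lam.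
Local Notation centred := (centred phi).

Lemma covariance_sumC x y N : covariance_sum p phi lam x y N = covariance_sum p phi lam y x N.
Proof. by apply: eq_bigr => k _; rewrite [_ * (phi k y - _)]mulrC. Qed.

Lemma kernel_sym x y : K x y = K y x.
Proof.
have c u v : covariance_sum p phi lam u v N @[N --> \oo] --> K u v by exact: kernel_expansion.
rewrite -(cvg_lim (@Rhausdorff R) (c x y)) -(cvg_lim (@Rhausdorff R) (c y x)).
by under eq_fun do rewrite covariance_sumC.
Qed.

Lemma variogram_sum_cvg x y :
  variogram_sum p phi lam x y N @[N --> \oo] --> K x x - 2 * K x y + K y y.
Proof.
under eq_fun do rewrite variogram_sumE.
rewrite (_ : K x x - 2 * K x y + K y y = K x x + K y y - 2 * K x y); last by ring.
apply: cvgB; first by apply: cvgD; exact: kernel_expansion.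
by apply: cvgM; [exact: cvg_cst | exact: kernel_expansion].
Qed.

(** * From a Gaussian process to its series *)

Section process_to_series.
Variable Z : gpoint G -> {RV P >-> R}.
Hypotheses (gZ : gaussian_process Z) (EZ : forall x, 'E_P[Z x]%E = 0%E).
Hypothesis covZ : forall x y, covariance P (Z x) (Z y) = (K x y)%:E.

Let covZ' x y : (\int[P]_w (Z x w * Z y w)%:E = (K x y)%:E)%E.
Proof. by rewrite -covariance_centred. Qed.

Lemma L2_process x : L2 P (Z x).
Proof.
apply: expectation_sqr_L2; first exact: measurable_funPT.
rewrite unlock (eq_integral (fun w => (Z x w * Z x w)%:E)); last first.
  by move=> w _; rewrite expr2.
by rewrite covZ' ltry.
Qed.

Lemma ip_process x y : ip P (Z x) (Z y) = K x y.
Proof. by rewrite /ip /Rintegral covZ'. Qed.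

Let span (X : T -> R) := exists s : seq (gpoint G * R),
  X = fun w => \sum_(q <- s) q.2 * Z q.1 w.

Let span_wsum (I : Type) (s : seq I) (c : I -> R) (F : I -> T -> R) : (forall i, span (F i)) ->
  span (fun w => \sum_(i <- s) c i * F i w).
Proof.
move=> sF; elim: s => [|i s [r Hr]].
  by exists [::]; apply/funext => w; rewrite !big_nil.
have [r' Hr'] := sF i; exists ([seq (q.1, c i * q.2) | q <- r'] ++ r).
apply/funext => w; rewrite big_cons big_cat big_map (congr1 (@^~ w) Hr) Hr' mulr_sumr; congr (_ + _).
by apply: eq_bigr => q _; rewrite mulrA.
Qed.

Let span_L2 X : span X -> L2 P X.
Proof.
by move=> [s ->]; apply: (@L2_wsum _ _ _ P _ s snd (fun q => Z q.1)) => q; exact: L2_process.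
Qed.

(** [gaussian_process] provides some mean and some variance; the zero mean of [Z] and the second
    moment of [X] identify them. *)
Let span_cgauss X : span X -> cgauss P X (ip P X X).
Proof.
move=> sX; have LX := span_L2 sX; case: (sX) => s XE.
have [m [v [v0 nX]]] := gZ (fun i => (tnth (in_tuple s) i).1) (fun i => (tnth (in_tuple s) i).2).
have {}nX : has_normal_law P X m v.
  by rewrite XE; move: nX; congr (has_normal_law P _ m v); apply/funext => w; rewrite [RHS]big_tnth.
have mX : measurable_fun setT X by case: LX.
have [_ _ X1 X2] := normal_law_moments mX v0 nX.
have m0 : m = 0.
  rewrite -X1 XE Rintegral_sum//.
    rewrite big1// => q _; rewrite RintegralZl//; last exact: L2_integrable (L2_process _).
    by rewrite expectation0_Rintegral ?mulr0.
  by move=> q; apply: integrable_mulr => //; exact: L2_integrable (L2_process _).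
rewrite m0 in nX X2; rewrite ip_sqr X2 expr0n addr0.
exact: normal_law_cgauss.
Qed.

Let process_increment e (t s : R) : 0 <= t <= len e -> 0 <= s <= len e ->
  ip P (fun w => Z (edge_point e t) w - Z (edge_point e s) w)
       (fun w => Z (edge_point e t) w - Z (edge_point e s) w) <= (lam 1 ^+ p.-1)^-1 * `|t - s|.
Proof.
move=> te se; rewrite ip_sqrB; [|exact: L2_process|exact: L2_process].
rewrite !ip_process; have c := @variogram_sum_cvg (edge_point e t) (edge_point e s).
rewrite -(cvg_lim (@Rhausdorff R) c); apply: limr_le.
  by apply/cvg_ex; eexists; exact: c.
by apply: nearW => N; exact: variogram_le.
Qed.

Let continuous_phi k e : {within `[0, len e], continuous (edge_fun (phi k) e)}.
Proof. by have [/abs_continuous_continuous] := basis_edge_H1 hphi k e. Qed.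

Let approx k n : T -> R := riemann Z (edge_fun (phi k)) n.

Let L2_approx k n : L2 P (approx k n).
Proof. exact: (L2_riemann L2_process). Qed.

Let limit k (X : T -> R) := L2 P X /\
  ip P (fun w => approx k n w - X w) (fun w => approx k n w - X w) @[n --> \oo] --> (0 : R).

Let exists_limit k : exists X : {RV P >-> R}, limit k X.
Proof.
have k0 : 0 <= (lam 1 ^+ p.-1)^-1 by rewrite invr_ge0 exprn_ge0// ltW// (lam_gt0 hphi).
have [X LX cX] := process_integral L2_process k0 process_increment (@continuous_phi k).
by have [Y YX] := RV_of_measurable P LX.1; exists Y; rewrite /limit YX.
Qed.

Let ip_approx k n Y : L2 P Y -> ip P (approx k n) Y =
  \sum_(q <- cells G n) cell_weight (edge_fun (phi k)) n q.1 q.2 *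
    ip P (Z (edge_point q.1 (node q.1 n q.2))) Y.
Proof.
move=> LY.
apply: (@ip_suml _ _ _ P _ (cells G n) (fun q => cell_weight (edge_fun (phi k)) n q.1 q.2)
  (fun q => Z (edge_point q.1 (node q.1 n q.2)))) => // q.
exact: L2_process.
Qed.

(** Expectation and integral over the graph commute: pairing the Riemann sums of [phi k Z] with [Y]
    gives Riemann sums of [phi k f], and both sides pass to the limit. *)
Let ip_limit k X (f : gpoint G -> R) Y : limit k X -> L2 P Y -> (forall x, ip P (Z x) Y = f x) ->
  (forall e, abs_continuous (len e) (edge_fun f e)) -> ip P X Y = inner_L2 f (phi k).
Proof.
move=> [LX cX] LY fE Af.
have c1 := ip_cvgl (L2_approx k) LX cX LY.
have c2 := riemann_graph_cvg (@continuous_phi k) Af.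
rewrite -(cvg_lim (@Rhausdorff R) c1); apply: cvg_lim => //.
under eq_fun do rewrite ip_approx//.
by under eq_fun do under eq_bigr do rewrite fE.
Qed.

Let ip_limit_process k X x : (0 < k)%N -> limit k X -> ip P X (Z x) = centred k x / lam k ^+ p.
Proof.
move=> k0 lX; rewrite -(kernel_coeff hphi x p1 rK k0).
apply: (ip_limit lX (L2_process x)) => [y|e].
  by rewrite ip_process kernel_sym.
by have [] := in_F_edge_H1 p1 (rK.1 x) e.
Qed.

(** [ip_limit] used twice: the pairing of [X] with [Z x] is a multiple of [centred j x], whose L2
    pairing with [phi k] is a Kronecker delta. *)
Let ip_limits j k X Y : (0 < j)%N -> (0 < k)%N -> limit j X -> limit k Y ->
  ip P X Y = (j == k)%:R * lam k ^- p.
Proof.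
move=> j0 k0 lX lY; rewrite ipC.
have Aj e : abs_continuous (len e) (edge_fun (centred j) e).
  by have [] := smooth_H1_segment 0 (ltW (len_gt0 e)) (@centred_smooth _ _ _ _ hphi j e).
rewrite (@ip_limit k Y (fun x => lam j ^- p * centred j x) X)//.
- rewrite -[inner_L2 _ _]/(edge_ip _ _).
  rewrite (@edge_ipZ _ _ (lam j ^- p) (edge_fun (centred j)) (edge_fun (phi k))).
  + have -> : edge_ip (edge_fun (centred j)) (edge_fun (phi k)) = (j == k)%:R.
      exact: (inner_centred hphi).
    rewrite mulrC.
    by have [->|] := eqVneq j k; rewrite ?mul0r.
  + by move=> e; exact: L2_segment_continuous (abs_continuous_continuous (Aj e)).
  + by move=> e; exact: L2_segment_continuous (@continuous_phi k e).
- by case: lX.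
- by move=> x; rewrite ipC (ip_limit_process x j0 lX) mulrC.
- by move=> e; apply: abs_continuousM; [exact/ltW/len_gt0 | exact: abs_continuous_cst | exact: Aj].
Qed.

Theorem process_spectral_representation : spectral_representation p phi lam Z.
Proof.
(* [xi' k] is the coefficient along [phi k.+1]; hence the predecessors below. *)
have [xi' Hxi'] := choice (fun k => exists_limit k.+1).
have lim_xi k : (0 < k)%N -> limit k (xi' k.-1) by case: k => // k _; exact: Hxi'.
have Lxi k : L2 P (xi' k) by case: (Hxi' k).
have ip_xi i j : ip P (xi' i) (xi' j) = (i == j)%:R * lam j.+1 ^- p.
  by rewrite (ip_limits _ _ (Hxi' i) (Hxi' j)) ?eqSS.
have gauss (r : seq (nat * R)) : uniq [seq q.1 | q <- r] ->
    cgauss P (lincomb xi' r) (linvar (fun k => lam k.+1 ^- p) r).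
  move=> ur.
  have us : uniq r by exact: map_uniq ur.
  have LX n (q : nat * R) : L2 P (approx q.1.+1 n) by exact: L2_approx.
  have LY (q : nat * R) : L2 P (xi' q.1) by exact: Lxi.
  have cX (q : nat * R) : ip P (fun w => approx q.1.+1 n w - xi' q.1 w)
     (fun w => approx q.1.+1 n w - xi' q.1 w) @[n --> \oo] --> (0 : R) by case: (Hxi' q.1).
  have c0 := ip_wsum_cvg r snd LX LY cX.
  have LS n := L2_wsum r snd (LX n); have LS' := L2_wsum r snd LY.
  have -> : linvar (fun k => lam k.+1 ^- p) r = ip P (lincomb xi' r) (lincomb xi' r).
    rewrite /lincomb (@ip_orthogonal _ _ _ P _ r snd (fun q => xi' q.1))//.
      by apply: eq_bigr => q _; rewrite ip_xi eqxx mul1r.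
    move=> q q' rq rq' qq'; rewrite ip_xi.
    suff /negbTE -> : q.1 != q'.1 by rewrite mul0r.
    by apply: contra_neq qq'; exact: (uniq_map_inj ur).
  have gS n : cgauss P (fun w => \sum_(q <- r) q.2 * approx q.1.+1 n w)
      (ip P (fun w => \sum_(q <- r) q.2 * approx q.1.+1 n w)
            (fun w => \sum_(q <- r) q.2 * approx q.1.+1 n w)).
    apply: span_cgauss; apply: (@span_wsum _ r snd (fun q => approx q.1.+1 n)) => q.
    apply: (@span_wsum _ (cells G n) _ (fun q => Z (edge_point q.1 (node q.1 n q.2)))) => q'.
    exists [:: (edge_point q'.1 (node q'.1 n q'.2), 1)].
    by apply/funext => w; rewrite big_seq1 mul1r.
  by apply: (cgauss_cvg LS LS' c0 gS); exact: (ip_diag_cvg LS LS' c0).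
have v_ge0 k : 0 <= lam k ^- p by rewrite invr_ge0 exprn_ge0// (lam_ge0 hphi).
exists (fun k => xi' k.-1); split.
- case=> // k _; apply: cgauss_normal_law => // t; have [] := gauss [:: (k, 1)] isT t.
  rewrite /linvar big_seq1/= expr1n mul1r => <- e2; split.
    by apply: eq_Rintegral => w _; rewrite /lincomb big_seq1/= mul1r.
  by rewrite -[RHS]e2; apply: eq_Rintegral => w _; rewrite /lincomb big_seq1/= mul1r.
- exact: (cgauss_independent gauss).
- move=> x; rewrite /mean_square_cvg.
  pose S N w := \sum_(k <- index_iota 1 N) centred k x * xi' k.-1 w.
  have LS N : L2 P (S N).
    by apply: (@L2_wsum _ _ _ P _ (index_iota 1 N) (centred ^~ x) (fun k => xi' k.-1)).
  (* The mean square of [S N] and its inner product with [Z x] both equal the partial covariance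
     sum, so the error is the missing tail of [K x x]. *)
  have SE N : ip P (fun w => S N w - Z x w) (fun w => S N w - Z x w) =
      K x x - covariance_sum p phi lam x x N.
    have LZ := L2_process x.
    have pos k : k \in index_iota 1 N -> (0 < k)%N by rewrite mem_index_iota => /andP[].
    rewrite ip_sqrB// ip_process.
    have -> : ip P (S N) (S N) = covariance_sum p phi lam x x N.
      rewrite /S (@ip_orthogonal _ _ _ P _ _ (centred ^~ x) (fun k => xi' k.-1)) ?iota_uniq//.
        rewrite big_seq /covariance_sum [RHS]big_seq; apply: eq_bigr => k /pos k0.
        by rewrite ip_xi eqxx mul1r prednK// /centred expr2.
      move=> i j /pos i0 /pos j0 ij; rewrite ip_xi.
      suff /negbTE -> : i.-1 != j.-1 by rewrite mul0r.
      by apply: contra_neq ij; case: i j i0 j0 => // i [] // j _ _ /= ->.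
    have -> : ip P (S N) (Z x) = covariance_sum p phi lam x x N.
      rewrite /S (@ip_suml _ _ _ P _ _ (centred ^~ x) (fun k => xi' k.-1))//.
      rewrite big_seq /covariance_sum [RHS]big_seq; apply: eq_bigr => k /pos k0.
      by rewrite (ip_limit_process x k0 (lim_xi k k0)) mulrA.
    ring.
  have c : K x x - covariance_sum p phi lam x x N @[N --> \oo] --> (0 : R).
    rewrite -[X in _ --> X](subrr (K x x)); apply: cvgB; first exact: cvg_cst.
    exact: kernel_expansion.
  suff -> : (fun N => 'E_P[fun w => ((\sum_(1 <= k < N) xi' k.-1 w *
      (phi k x - vertex_mean (phi k)) - Z x w) ^+ 2)%R])%E =
      (fun N => (K x x - covariance_sum p phi lam x x N)%:E).
    by apply: cvg_EFin; [exact: nearW | exact: c].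
  apply/funext => N; rewrite -SE -expectation_sqr; last exact: L2B (LS N) (L2_process x).
  congr expectation; apply/funext => w; congr (_ ^+ 2); congr (_ - _).
  by apply: eq_bigr => k _; rewrite mulrC.
Qed.

Lemma variogramE x y : variogram Z x y = (K x x - 2 * K x y + K y y)%:E.
Proof.
have LD := L2B (L2_process x) (L2_process y).
have E0 : ('E_P[fun w => (Z x w - Z y w)%R] = 0)%E.
  apply: Rintegral0_expectation => //.
  rewrite RintegralB//; try exact: L2_integrable (L2_process _).
  by rewrite !expectation0_Rintegral ?subrr.
rewrite /variogram /variance covariance_centred// integral_L2//.
by rewrite ip_sqrB ?ip_process//; exact: L2_process.
Qed.
End process_to_series.

(** * From a series back to a Gaussian process *)

Section series_to_process.
Variable Y : gpoint G -> {RV P >-> R}.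
Hypothesis hY : spectral_representation p phi lam Y.
Implicit Types (a : seq (gpoint G * R)).

Let form a := \sum_(q <- a) \sum_(q' <- a) q.2 * q'.2 * K q.1 q'.1.

(** A combination of values of [Y] is a mean-square limit of combinations of independent normal
    [xi k]. Their variances are nonnegative combinations of partial covariance sums, and tend to
    [form a]. *)
Let combination_cgauss : (forall x, L2 P (Y x)) /\
  forall a, 0 <= form a /\ cgauss P (fun w => \sum_(q <- a) q.2 * Y q.1 w) (form a).
Proof.
have [xi [nxi indxi cY]] := hY.
pose v k := lam k.+1 ^- p.
have v_ge0 k : 0 <= v k by rewrite invr_ge0 exprn_ge0// (lam_ge0 hphi).
have gX k : cgauss P (xi k.+1) (v k) by exact: normal_law_cgauss (measurable_funPT (xi k.+1)) (v_ge0 k) (nxi k.+1 isT).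
have gl := independent_cgauss indxi gX.
have LX k : L2 P (xi k.+1) by have [] := cgauss_moments (measurable_funPT (xi k.+1)) (v_ge0 k) (gX k).
pose S N x w := \sum_(1 <= k < N) xi k w * centred k x.
have sum_shift (V : nmodType) (f : nat -> V) N : \sum_(1 <= k < N) f k = \sum_(k <- iota 0 N.-1) f k.+1.
  rewrite /index_iota subn1 -[1%N]addn0 iotaDl big_map; apply: eq_bigr => k _.
  by rewrite add1n.
have LS N x : L2 P (S N x).
  rewrite (_ : S N x = fun w => \sum_(k <- iota 0 N.-1) centred k.+1 x * xi k.+1 w).
    exact: (@L2_wsum _ _ _ P _ (iota 0 N.-1) (fun k => centred k.+1 x) (fun k => xi k.+1)).
  by apply/funext => w; rewrite /S sum_shift; apply: eq_bigr => k _; rewrite mulrC.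
have mD N x : measurable_fun setT (fun w => S N x w - Y x w).
  by apply: measurable_funB => //; case: (LS N x).
have LY x : L2 P (Y x).
  (* Convergence to 0 in the extended reals makes some error finite; subtracting this error from the
     partial sum shows that [Y x] is square-integrable. *)
  have /fine_cvgP[[n0 _ H0] _] := cY x; have := H0 n0 (leqnn n0) => fin.
  have LD : L2 P (fun w => S n0 x w - Y x w).
    by apply: expectation_sqr_L2 => //; rewrite ltey_eq fin.
  have := L2B (LS n0 x) LD; congr (L2 P); apply/funext => w; ring.
split=> // a.
have cS (q : gpoint G * R) :
   ip P (fun w => S N q.1 w - Y q.1 w) (fun w => S N q.1 w - Y q.1 w) @[N --> \oo] --> (0 : R).
  have /fine_cvgP[_] := cY q.1; apply: cvg_trans; apply: near_eq_cvg; apply: nearW => N /=.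
  have LD := L2B (LS N q.1) (LY q.1).
  by rewrite (expectation_sqr LD).
have c0 := ip_wsum_cvg a snd (fun N q => LS N q.1) (fun q => LY q.1) cS.
have LSa N := L2_wsum a snd (fun q => LS N q.1); have LYa := L2_wsum a snd (fun q => LY q.1).
(* The coefficient of [xi k] in the combination, once the sums over points and over eigenfunctions
   are exchanged. *)
pose b k := \sum_(q <- a) q.2 * centred k q.1.
pose V N := linvar v [seq (k, b k.+1) | k <- iota 0 N.-1].
have VE N : V N = \sum_(q <- a) \sum_(q' <- a) q.2 * q'.2 * covariance_sum p phi lam q.1 q'.1 N.
  rewrite /V /linvar big_map/= -(sum_shift _ (fun k => b k ^+ 2 * lam k ^- p)).
  under [RHS]eq_bigr do under eq_bigr do rewrite /covariance_sum mulr_sumr.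
  under [RHS]eq_bigr do rewrite exchange_big.
  rewrite [RHS]exchange_big; apply: eq_bigr => k _.
  rewrite expr2 /b mulr_suml mulr_suml; apply: eq_bigr => q _.
  rewrite mulr_sumr mulr_suml; apply: eq_bigr => q' _.
  by rewrite -!/(centred k _); ring.
have cV : V N @[N --> \oo] --> form a.
  under eq_fun do rewrite VE.
  apply: (cvg_sumr (F := fun q N => \sum_(q' <- a) q.2 * q'.2 * covariance_sum p phi lam q.1 q'.1 N)) => q.
  apply: (cvg_sumr (F := fun q' N => q.2 * q'.2 * covariance_sum p phi lam q.1 q'.1 N)) => q'.
  by apply: cvgM; [exact: cvg_cst | exact: kernel_expansion].
have V0 N : 0 <= V N by apply: sumr_ge0 => q _; rewrite mulr_ge0 ?sqr_ge0.
split.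
  rewrite -(cvg_lim (@Rhausdorff R) cV); apply: limr_ge; last exact: nearW.
  by apply/cvg_ex; eexists; exact: cV.
have gS N : cgauss P (fun w => \sum_(q <- a) q.2 * S N q.1 w) (V N).
  have -> : (fun w => \sum_(q <- a) q.2 * S N q.1 w) =
      lincomb (fun k => xi k.+1) [seq (k, b k.+1) | k <- iota 0 N.-1].
    apply/funext => w; rewrite /lincomb big_map/= -(sum_shift _ (fun k => b k * xi k w)).
    rewrite /S /b; under eq_bigr do rewrite mulr_sumr.
    rewrite exchange_big; apply: eq_bigr => k _; rewrite mulr_suml.
    by apply: eq_bigr => q _; ring.
  by apply: gl; rewrite -map_comp map_id iota_uniq.
exact: (cgauss_cvg LSa LYa c0 gS cV).
Qed.

Let combination_moments a : \int[P]_w (\sum_(q <- a) q.2 * Y q.1 w) = 0 /\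
  form a = \sum_(q <- a) \sum_(q' <- a) q.2 * q'.2 * ip P (Y q.1) (Y q'.1).
Proof.
have [LY H] := combination_cgauss; have [f0 ga] := H a.
have [ma _] : L2 P (fun w => \sum_(q <- a) q.2 * Y q.1 w).
  exact: (@L2_wsum _ _ _ P _ a snd (fun q => Y q.1)).
have [_ m1 m2] := cgauss_moments ma f0 ga.
by split=> //; rewrite -m2 (@ip_wsum _ _ _ P _ a snd (fun q => Y q.1)).
Qed.

Theorem spectral_representation_process : gaussian_process_with_RKHS p Y.
Proof.
have [LY gY] := combination_cgauss.
have diag x : ip P (Y x) (Y x) = K x x.
  by have [_] := combination_moments [:: (x, 1)]; rewrite /form !big_seq1 !mul1r.
have ipY x y : ip P (Y x) (Y y) = K x y.
  (* Polarization: the diagonal being known, the second moment of [Y x + Y y] gives the mixed one,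
     and the symmetry of [K] merges the two cross terms. *)
  have [_] := combination_moments [:: (x, 1); (y, 1)].
  rewrite /form !big_cons !big_nil/= !mul1r !addr0 !diag (kernel_sym y x) (ipC P (Y y)); lra.
have EY x : 'E_P[Y x]%E = 0%E.
  apply: Rintegral0_expectation => //; have [<- _] := combination_moments [:: (x, 1)].
  by apply: eq_Rintegral => w _; rewrite big_seq1 mul1r.
split=> //.
- move=> n x a; pose r := [seq (x i, a i) | i <- index_enum 'I_n].
  have [f0 gr] := gY r; exists 0, (form r); split=> //.
  have -> : (fun w => \sum_(i < n) a i * Y (x i) w) = (fun w => \sum_(q <- r) q.2 * Y q.1 w).
    by apply/funext => w; rewrite big_map.
  apply: cgauss_normal_law => //.
  by have [] := @L2_wsum _ _ _ P _ r snd (fun q => Y q.1) (fun q => LY q.1).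
- by exists K => // x y; rewrite covariance_centred// integral_L2// ipY.
Qed.
End series_to_process.
End spectral_representation.

Theorem proposition3p6 (R : realType) (G : metric_graph R) (p : nat)
    (hp : (1 <= p)%N)
    (d : measure_display) (T : measurableType d) (P : probability T R)
    (Z : gpoint G -> {RV P >-> R}) (hZ : gaussian_process_with_RKHS p Z)
    (phi : nat -> gpoint G -> R) (lam : nat -> R)
    (hphi : laplace_eigenbasis phi lam) :
  [/\ forall x1 x2 : gpoint G,
        (variogram_sum p phi lam x1 x2 N)%:E @[N --> \oo] --> variogram Z x1 x2,
      forall x1 x2 : gpoint G,
        (covariance_sum p phi lam x1 x2 N)%:E @[N --> \oo]
          --> covariance P (Z x1) (Z x2),
      spectral_representation p phi lam Z &
      forall (psi : nat -> gpoint G -> R) (mu : nat -> R),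
        laplace_eigenbasis psi mu ->
        [/\ forall x1 x2 : gpoint G,
              lim (variogram_sum p phi lam x1 x2 N @[N --> \oo]) =
              lim (variogram_sum p psi mu x1 x2 N @[N --> \oo]),
            forall x1 x2 : gpoint G,
              lim (covariance_sum p phi lam x1 x2 N @[N --> \oo]) =
              lim (covariance_sum p psi mu x1 x2 N @[N --> \oo]) &
            forall Y : gpoint G -> {RV P >-> R},
              spectral_representation p phi lam Y <->
              spectral_representation p psi mu Y]].
Proof.
have [gZ EZ [K rK covZ]] := hZ.
have spectral (Y : gpoint G -> {RV P >-> R}) psi mu : gaussian_process_with_RKHS p Y ->
    laplace_eigenbasis psi mu -> spectral_representation p psi mu Y.
  by move=> [gY EY [K' rK' covY]] hpsi; exact: process_spectral_representation covY.
split.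
- move=> x y; rewrite (variogramE EZ covZ); apply: cvg_EFin; first exact: nearW.
  exact: variogram_sum_cvg.
- move=> x y; rewrite covZ; apply: cvg_EFin; first exact: nearW.
  exact: kernel_expansion.
- exact: spectral.
move=> psi mu hpsi; split.
- move=> x y; have c1 := @variogram_sum_cvg _ _ _ _ hp rK _ _ hphi x y.
  have c2 := @variogram_sum_cvg _ _ _ _ hp rK _ _ hpsi x y.
  by rewrite (cvg_lim (@Rhausdorff R) c1) (cvg_lim (@Rhausdorff R) c2).
- move=> x y; have c1 : covariance_sum p phi lam x y N @[N --> \oo] --> K x y.
    exact: kernel_expansion.
  have c2 : covariance_sum p psi mu x y N @[N --> \oo] --> K x y by exact: kernel_expansion.
  by rewrite (cvg_lim (@Rhausdorff R) c1) (cvg_lim (@Rhausdorff R) c2).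
- by move=> Y; split=> sY; apply: spectral => //;
    [exact: (spectral_representation_process hp rK hphi sY) | exact: (spectral_representation_process hp rK hpsi sY)].
Qed.
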